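(* Let $(\alpha,\beta,\gamma)$ be an element of the Thoma simplex. The jeu de taquin transformation $J:\mathbb{T}\to\mathbb{T}$ on the probability space $(\mathbb{T},\mathcal{F},\mathfrak{M}_{\alpha,\beta,\gamma})$ of infinite Young tableaux equipped with the Vershik-Kerov measure is (1) measure preserving; (2) ergodic, i.e. every $J$-invariant measurable set $E\in\mathcal{F}$ satisfies $\mathfrak{M}_{\alpha,\beta,\gamma}(E)\in\{0,1\}$.
   Context: Young diagrams and infinite tableaux. $\mathbb{N}=\{1,2,\dots\}$. A box is a pair $(x,y)\in\mathbb{N}^2$, where $x$ is the index of its column and $y$ the index of its row; the Young diagram $\lambda=(\lambda_1\ge\lambda_2\ge\cdots)$ is the set of boxes $(x,y)$ with $x\le\lambda_y$. Write $\lambda\nearrow\mu$ if $\mu$ is obtained from $\lambda$ by adding exactly one box. An infinite Young tableau is a function $t:\mathbb{N}^2\to\{1,2,\dots,\infty\}$, $(x,y)\mapsto t_{x,y}$, such that each finite value is taken in exactly one box and rows and columns are weakly increasing. It is identified with the infinite path $\emptyset=\lambda^0\nearrow\lambda^1\nearrow\cdots$, where $\lambda^i$ is the set of boxes with entries $\le i$. $\mathbb{T}$ is the set of infinite Young tableaux and $\mathcal{F}$ is the smallest $\sigma$-algebra making all maps $t\mapsto t_{x,y}$ measurable. Thoma simplex and Vershik-Kerov measures. The Thoma simplex is the set of triples $(\alpha,\beta,\gamma)$ with $\alpha_1\ge\alpha_2\ge\cdots\ge0$, $\beta_1\ge\beta_2\ge\cdots\ge0$, $\gamma\ge0$ and $\sum_i\alpha_i+\sum_i\beta_i+\gamma=1$.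 The corresponding indecomposable (Thoma) character $\chi_{\alpha,\beta,\gamma}$ of the infinite symmetric group takes at a finitely supported permutation $\sigma$ the value $\prod_{c}\big(\sum_i\alpha_i^{|c|}+(-1)^{|c|-1}\sum_i\beta_i^{|c|}\big)$, the product being over cycles $c$ of $\sigma$ of length $|c|\ge2$. The Vershik-Kerov measure $\mathfrak{M}_{\alpha,\beta,\gamma}$ is the associated central measure: the unique probability measure on $(\mathbb{T},\mathcal{F})$ such that for each $n$ the probability that the path begins with given $\emptyset=\lambda^0\nearrow\cdots\nearrow\lambda^n$ depends only on $\lambda^n$, and, denoting it $p(\lambda^n)$, one has $\chi_{\alpha,\beta,\gamma}(\sigma)=\sum_{\lambda\vdash n}p(\lambda)\chi^\lambda(\sigma)$ for all $\sigma\in\mathfrak{S}_n$, where $\chi^\lambda$ is the (unnormalized) irreducible character of $\mathfrak{S}_n$ indexed by $\lambda$ ($\chi^{(n)}$ being trivial). Jeu de taquin. For $t\in\mathbb{T}$ the jeu de taquin path $\mathbf{p}(t)=(\mathbf{p}_1(t),\mathbf{p}_2(t),\dots)$ is defined by $\mathbf{p}_1=(1,1)$ and $\mathbf{p}_{k+1}$ is that one of the two boxes $\mathbf{p}_k+(1,0)$, $\mathbf{p}_k+(0,1)$ which has the smaller entry in $t$; if both of these entries are $\infty$ the path ends at $\mathbf{p}_k$ (finite path). The jeu de taquin transform $J(t)\in\mathbb{T}$ is obtained by sliding boxes along the path and subtracting $1$ from every entry: $J(t)_{\mathbf{p}_k}=t_{\mathbf{p}_{k+1}}-1$ for boxes of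 the path having a successor, $J(t)=\infty$ at the last box if the path is finite, and $J(t)_{x,y}=t_{x,y}-1$ for boxes outside of the path (with $\infty-1=\infty$). *)

(* Defs.v *)
From HB Require Import structures.
From mathcomp Require Import all_boot all_order all_algebra all_fingroup.
From mathcomp Require Import all_solvable all_field all_character.
From mathcomp Require Import all_classical all_reals all_analysis.

Set Implicit Arguments.
Unset Strict Implicit.
Unset Printing Implicit Defensive.

Import Order.TTheory GRing.Theory Num.Theory.
Import numFieldNormedType.Exports.

Local Open Scope classical_set_scope.
Local Open Scope ring_scope.

(* The box in column x and row y, x, y >= 1, is encoded as (x - 1, y - 1). *)
Definition box : Type := (nat * nat)%type.
Definition right_box (b : box) : box := (b.1.+1, b.2).
Definition up_box (b : box) : box := (b.1, b.2.+1).

(* Entries are elements of {1, 2, ..., oo}, with None standing for oo; the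
   value Some 0 is excluded in is_tableau. *)
Definition entry : Type := option nat.

Definition le_entry (a b : entry) : bool :=
  match a, b with
  | _, None => true
  | None, Some _ => false
  | Some m, Some n => (m <= n)%N
  end.

Definition pred_entry (a : entry) : entry := omap predn a.

Definition is_tableau (t : box -> entry) : Prop :=
  [/\ forall b, t b <> Some 0%N,
      forall k, (0 < k)%N -> exists! b, t b = Some k,
      forall x x' y, (x <= x')%N -> le_entry (t (x, y)) (t (x', y))
    & forall x y y', (y <= y')%N -> le_entry (t (x, y)) (t (x, y'))].

Record tableau := Tableau {
  entries :> box -> entry;
  entriesP : is_tableau entries }.

Lemma tableau_eq (t u : tableau) : entries t =1 entries u -> t = u.
Proof.
case: t u => [t tP] [u uP] /= /funext tu.
by case: _ / tu uP => uP; congr Tableau; exact: Prop_irrelevance.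
Qed.

(* One step of the jeu de taquin path: the successor of the box b, or None if
   the path ends at b. *)
Definition jdt_next (t : box -> entry) (b : box) : option box :=
  if (t (right_box b) == None) && (t (up_box b) == None) then None
  else Some (if le_entry (t (right_box b)) (t (up_box b)) then right_box b else up_box b).

(* The k-th box of the jeu de taquin path, counted from k = 0. *)
Fixpoint jdt_path (t : box -> entry) (k : nat) : option box :=
  if k is k'.+1 then obind (jdt_next t) (jdt_path t k') else Some (0, 0)%N.

Definition on_path (t : box -> entry) (b : box) : Prop :=
  exists k, jdt_path t k = Some b.

Definition jdt_entries (t : box -> entry) (b : box) : entry :=
  if `[< on_path t b >] then
    if jdt_next t b is Some b' then pred_entry (t b') else None
  else pred_entry (t b).

Section jdt_tableau.
Variables (t : box -> entry) (tP : is_tableau t).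

Lemma le_entry_refl a : le_entry a a. Proof. by case: a => /=. Qed.

Lemma le_entry_trans a b c : le_entry a b -> le_entry b c -> le_entry a c.
Proof. by case: a b c => [m|] [n|] [p|] //=; exact: leq_trans. Qed.

Lemma le_pred_entry a b : le_entry a b -> le_entry (pred_entry a) (pred_entry b).
Proof. by case: a b => [m|] [n|] //= mn; rewrite -!subn1 leq_sub2r. Qed.

Let t_uniq b b' k : t b = Some k -> t b' = Some k -> b = b'.
Proof.
case: tP => t0 tex _ _ tb tb'.
have k0 : (0 < k)%N by rewrite lt0n; apply/eqP => k0; apply: (t0 b); rewrite tb k0.
by have [c [_ cu]] := tex k k0; rewrite -(cu _ tb) -(cu _ tb').
Qed.

Let t_right b : le_entry (t b) (t (right_box b)).
Proof. by case: b tP => x y [_ _ + _]; apply. Qed.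

Let t_up b : le_entry (t b) (t (up_box b)).
Proof. by case: b tP => x y [_ _ _]; apply. Qed.

Let t00 : t (0, 0)%N = Some 1%N.
Proof.
case: tP => t0 tex tr tu.
have [[x y] [txy _]] := tex 1%N isT.
have : le_entry (t (0, 0)%N) (Some 1%N).
  by rewrite -txy; apply: (@le_entry_trans _ (t (x, 0)%N)); [exact: tr|exact: tu].
by case E : (t _) => [[|[|//]]|//] // _; have := t0 _ E.
Qed.

Lemma jdt_next_neighbour b b' : jdt_next t b = Some b' -> b' = right_box b \/ b' = up_box b.
Proof.
rewrite /jdt_next; case: ifP => // _ [<-]; case: ifP => _; first by left.
by right.
Qed.

Let tnext b : option nat := obind t (jdt_next t b).

Let tnext_fin b b' : jdt_next t b = Some b' -> exists m, t b' = Some m.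
Proof.
rewrite /jdt_next; case: ifP => // /negbT; rewrite negb_and => tN [<-].
case E1 : (t (right_box b)) tN => [m|]; case E2 : (t (up_box b)) => [n|] //= _.
- by case: ifP => _; [exists m|exists n].
- by exists m.
- by exists n.
Qed.

Let tnext_right b : le_entry (tnext b) (t (right_box b)).
Proof.
rewrite /tnext /jdt_next; case: ifP => [/andP[/eqP-> _]//|_ /=].
by case: ifP => [_|]; [exact: le_entry_refl|
  case: (t (right_box b)) (t (up_box b)) => [m|] [n|] //= /negbT; rewrite -ltnNge => /ltnW].
Qed.

Let tnext_up b : le_entry (tnext b) (t (up_box b)).
Proof.
rewrite /tnext /jdt_next; case: ifP => [/andP[_ /eqP->]//|_ /=].
by case: ifP => // _; exact: le_entry_refl.
Qed.

Let le_tnext b : le_entry (t b) (tnext b).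
Proof.
rewrite /tnext; case E : (jdt_next t b) => [b'|] /=; last by case: (t b).
by have [->|->] := jdt_next_neighbour E.
Qed.

Let next_neq b b' : jdt_next t b = Some b' -> (b'.1 + b'.2)%N = (b.1 + b.2).+1.
Proof.
by move=> /jdt_next_neighbour[->|->] /=; rewrite ?addSn ?addnS.
Qed.

Lemma jdt_path_sum k b : jdt_path t k = Some b -> (b.1 + b.2)%N = k.
Proof.
elim: k b => [|k IH] b /=; first by case=> <-.
by case E : (jdt_path t k) => [c|//] /= /next_neq ->; rewrite (IH _ E).
Qed.

Let on_path_next b b' : on_path t b -> jdt_next t b = Some b' -> on_path t b'.
Proof. by move=> [k pk] bb'; exists k.+1 => /=; rewrite pk. Qed.

Let on_path_prev b' : on_path t b' -> b' <> (0, 0)%N ->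
  exists2 b, on_path t b & jdt_next t b = Some b'.
Proof.
move=> [[|k] /=]; first by case=> ->.
by case E : (jdt_path t k) => [b|//] /= bb' _; exists b => //; exists k.
Qed.

Let next_inj b c b' : on_path t b -> on_path t c ->
  jdt_next t b = Some b' -> jdt_next t c = Some b' -> b = c.
Proof.
move=> [k pk] [l pl] /next_neq Eb /next_neq; rewrite Eb => -[].
by rewrite (jdt_path_sum pk) (jdt_path_sum pl) => kl; move: pk; rewrite kl pl => -[].
Qed.

Let src b : option box := if `[< on_path t b >] then jdt_next t b else Some b.

Let src_inj b c d : src b = Some d -> src c = Some d -> b = c.
Proof.
rewrite /src; case: asboolP => pb; case: asboolP => pc.
- exact: next_inj.
- by move=> bd [cd]; case: pc; rewrite cd; exact: on_path_next bd.
- by move=> [bd] cd; case: pb; rewrite bd; exact: on_path_next cd.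
- by move=> [->] [->].
Qed.

Let src_surj d : d <> (0, 0)%N -> exists b, src b = Some d.
Proof.
move=> d0; have [pd|pd] := pselect (on_path t d).
  have [b pb bd] := on_path_prev pd d0.
  by exists b; rewrite /src asboolT.
by exists d; rewrite /src asboolF.
Qed.

Let src_neq0 b : src b <> Some (0, 0)%N.
Proof.
rewrite /src; case: asboolP => pb; first by move=> /next_neq.
by case=> b0; apply: pb; exists 0%N; rewrite b0.
Qed.

Let jdtE b : jdt_entries t b = pred_entry (obind t (src b)).
Proof. by rewrite /jdt_entries /src; case: asboolP => //; case: jdt_next. Qed.

Let srcP b k : obind t (src b) = Some k -> exists2 d, src b = Some d & t d = Some k.
Proof. by case: src => [d|//] /= tk; exists d. Qed.

Let src_gt1 b k : obind t (src b) = Some k -> (1 < k)%N.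
Proof.
move=> /srcP[d bd tk]; case: k tk => [|[|//]] tk; first by case: tP => /(_ d).
by case: (src_neq0 (b := b)); rewrite bd (t_uniq tk t00).
Qed.

Let le_src b : le_entry (t b) (obind t (src b)).
Proof. by rewrite /src; case: ifP => _; [exact: le_tnext|exact: le_entry_refl]. Qed.

Let src_right b : le_entry (obind t (src b)) (t (right_box b)).
Proof. by rewrite /src; case: ifP => _; [exact: tnext_right|exact: t_right]. Qed.

Let src_up b : le_entry (obind t (src b)) (t (up_box b)).
Proof. by rewrite /src; case: ifP => _; [exact: tnext_up|exact: t_up]. Qed.

Lemma jdt_is_tableau : is_tableau (jdt_entries t).
Proof.
split.
- move=> b; rewrite jdtE; case E : (obind t (src b)) => [k|//] /= [].
  by have := src_gt1 E; case: k {E} => [|[]].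
- move=> k k0; case: (tP) => _ /(_ k.+1 isT) [d [td _]] _ _.
  have [|b bd] := @src_surj d.
    by move=> d0; move: td k0; rewrite d0 t00 => -[<-].
  exists b; split; first by rewrite jdtE bd /= td.
  move=> c; rewrite jdtE; case E : (obind t (src c)) => [l|//] /= [lk].
  have l0 := src_gt1 E; have {}lk : l = k.+1 by rewrite -lk prednK // ltnW.
  have [d' cd'] := srcP E; rewrite lk => td'.
  by apply: (src_inj bd); rewrite (t_uniq td td').
- move=> x x' y /subnK <-; elim: (x' - x)%N => [|n IH]; first exact: le_entry_refl.
  apply: le_entry_trans IH _; rewrite !jdtE; apply: le_pred_entry.
  exact: le_entry_trans (src_right _) (le_src _).
- move=> x y y' /subnK <-; elim: (y' - y)%N => [|n IH]; first exact: le_entry_refl.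
  apply: le_entry_trans IH _; rewrite !jdtE; apply: le_pred_entry.
  exact: le_entry_trans (src_up _) (le_src _).
Qed.

End jdt_tableau.

Definition jdt (t : tableau) : tableau := Tableau (jdt_is_tableau (entriesP t)).

Definition row_entries (b : box) : entry := if b.2 == 0%N then Some b.1.+1 else None.

Lemma row_is_tableau : is_tableau row_entries.
Proof.
split; rewrite /row_entries /=.
- by move=> b; case: ifP.
- case=> // k _; exists (k, 0)%N; split => //= -[x y] /=.
  by case: eqP => // -> [->].
- by move=> x x' y xx'; case: ifP => //= _; rewrite ltnS.
- by move=> x [|y] [|y'] //= _; rewrite leqnn.
Qed.

HB.instance Definition _ := gen_eqMixin tableau.
HB.instance Definition _ := gen_choiceMixin tableau.
HB.instance Definition _ := isPointed.Build tableau (Tableau row_is_tableau).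

Definition entry_preimages : set (set tableau) :=
  [set E | exists (b : box) (A : set entry), E = [set t : tableau | A (t b)]].

HB.instance Definition _ := @isMeasurable.Build (sigma_display entry_preimages)
  tableau <<s entry_preimages >> (@sigma_algebra0 _ setT entry_preimages)
  (@sigma_algebraC _ entry_preimages)
  (@sigma_algebra_bigcup _ setT entry_preimages).

(* A partition of n is stored with its parts padded by zeros to length n. *)
Definition intpart (n : nat) : predArgType :=
  {la : n.-tuple 'I_n.+1 |
    sorted geq (map val la) && (sumn (map val la) == n)}.

Definition parts (n : nat) (la : intpart n) : seq nat := map val (val la).

Definition boxes (n : nat) (la : intpart n) : set box :=
  [set b | (b.1 < nth 0%N (parts la) b.2)%N].

Definition add_box (m n : nat) (la : intpart m) (mu : intpart n) : Prop :=
  exists2 b, ~ boxes la b & boxes mu = b |` boxes la.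

(* The i-th box of the diagram, rows being read one after the other. *)
Definition box_of (n : nat) (la : intpart n) (i : 'I_n) : box :=
  (reshape_offset (parts la) i, reshape_index (parts la) i).

Definition sym_group (n : nat) : {group 'S_n} := [set: 'S_n]%G.

Definition fiber_stab (n : nat) (f : 'I_n -> nat) : {set 'S_n} :=
  [set s : 'S_n | [forall i, f (s i) == f i]]%SET.

Lemma fiber_stabP (n : nat) (f : 'I_n -> nat) (s : 'S_n) :
  reflect (forall i, f (s i) = f i) (s \in fiber_stab f).
Proof. by rewrite inE; exact: 'forall_eqP. Qed.

Lemma fiber_stab_group_set (n : nat) (f : 'I_n -> nat) : group_set (fiber_stab f).
Proof.
apply/group_setP; split; first by apply/fiber_stabP => i; rewrite perm1.
move=> s s' /fiber_stabP fs /fiber_stabP fs'; apply/fiber_stabP => i.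
by rewrite permM fs' fs.
Qed.

Canonical fiber_stab_group (n : nat) (f : 'I_n -> nat) := Group (fiber_stab_group_set f).

Definition row_group (n : nat) (la : intpart n) : {group 'S_n} :=
  [group of fiber_stab (fun i => (box_of la i).2)].

Definition col_group (n : nat) (la : intpart n) : {group 'S_n} :=
  [group of fiber_stab (fun i => (box_of la i).1)].

Definition sign_mx (n : nat) (s : 'S_n) : 'M[algC]_1 := ((-1) ^+ s)%:M.

Lemma sign_mx_repr (n : nat) (H : {group 'S_n}) : mx_repr H (@sign_mx n).
Proof.
split; first by rewrite /sign_mx odd_perm1.
by move=> s s' _ _; rewrite /sign_mx odd_permM signr_addb scalar_mxM.
Qed.

Definition sign_cfun (n : nat) (H : {group 'S_n}) : 'CF(H) :=
  cfRepr (MxRepresentation (sign_mx_repr H)).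

Lemma sign_cfunE (n : nat) (H : {group 'S_n}) (s : 'S_n) :
  sign_cfun H s = (-1) ^+ s *+ (s \in H).
Proof. by rewrite cfunE /= mxtrace_scalar mulr1n. Qed.

Definition row_char (n : nat) (la : intpart n) : 'CF(sym_group n) :=
  'Ind[sym_group n] (1 : 'CF(row_group la)).

Definition col_char (n : nat) (la : intpart n) : 'CF(sym_group n) :=
  'Ind[sym_group n] (sign_cfun (col_group la)).

(* The irreducible character chi^la of the symmetric group is the unique common
   constituent of the character induced by the trivial character of the row
   stabilizer and of the one induced by the sign of the column stabilizer
   (James and Kerber, The Representation Theory of the Symmetric Group);
   see sym_Iirr_uniq below. *)
Definition sym_Iirr (n : nat) (la : intpart n) : Iirr (sym_group n) :=
  odflt 0 [pick i | (i \in irr_constt (row_char la))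
                    && (i \in irr_constt (col_char la))].

Definition sym_char (n : nat) (la : intpart n) : 'CF(sym_group n) :=
  'chi_(sym_Iirr la).

Section sym_char_theory.
Variables (n : nat) (la : intpart n).
Let G := sym_group n.
Let sh := parts la.
Let f i := (box_of la i).2.
Let c i := (box_of la i).1.
Let RG := row_group la.
Let CG := col_group la.

Let sum_sh : sumn sh = n.
Proof. by have /andP[_ /eqP] := valP la. Qed.

Let fc_inj i j : f i = f j -> c i = c j -> i = j.
Proof.
move=> fij cij; apply: val_inj.
by rewrite /= -(reshape_indexK sh i) -(reshape_indexK sh j); congr flatten_index.
Qed.

Let fc_lt i : (c i < nth 0%N sh (f i))%N.
Proof. by apply: reshape_offsetP; rewrite sum_sh. Qed.

Let fc_ex x y : (x < nth 0%N sh y)%N -> exists i, f i = y /\ c i = x.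
Proof.
move=> xy; have lt : (flatten_index sh y x < n)%N by rewrite -[X in (_ < X)%N]sum_sh flatten_indexP.
exists (Ordinal lt); rewrite /f /c /box_of /= -/sh.
by rewrite flatten_indexKl ?flatten_indexKr.
Qed.

Let mem_RG (s : 'S_n) : reflect (forall i, f (s i) = f i) (s \in RG).
Proof. exact: fiber_stabP. Qed.

Let mem_CG (s : 'S_n) : reflect (forall i, c (s i) = c i) (s \in CG).
Proof. exact: fiber_stabP. Qed.

Let RCG1 : (RG :&: CG)%SET = 1%g.
Proof.
apply/trivgP/fintype.subsetP => s.
rewrite finset.inE => /andP[/mem_RG fs /mem_CG cs]; rewrite finset.inE; apply/eqP/permP => i.
by rewrite perm1; exact: fc_inj.
Qed.

Let transversal_card (d : 'I_n -> nat) (k y : nat) :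
  (forall i j, f i = f j -> d i = d j -> i = j) ->
  (#|[set i | (f i == y) && (d i < k)%N]%SET| <= #|[set i | (f i == y) && (c i < k)%N]%SET|)%N.
Proof.
move=> dinj; have [yk|ky] := leqP (nth 0%N sh y) k.
  apply/subset_leq_card/fintype.subsetP => i; rewrite !inE => /andP[/eqP fi _].
  by rewrite fi eqxx /= (leq_trans (fc_lt i)) // fi.
apply: (@leq_trans k).
  pose D := [set i | (f i == y) && (d i < k)%N]%SET.
  case: k ky @D => [|k] ky D.
    by rewrite leqn0 cards_eq0; apply/eqP/finset.setP => i; rewrite !inE ltn0 andbF.
  rewrite -[X in (_ <= X)%N]card_ord.
  have : {in D &, injective (fun i => inord (d i) : 'I_k.+1)}.
    move=> i j; rewrite !inE => /andP[/eqP fi di] /andP[/eqP fj dj] /(congr1 val) /=.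
    by rewrite !inordK // => dij; apply: dinj => //; rewrite fi fj.
  by move=> /card_in_imset <-; exact: max_card.
have /choice[g gP] : forall x : 'I_k, exists i, f i = y /\ c i = x.
  by move=> x; apply: fc_ex; exact: ltn_trans ky.
rewrite -[X in (X <= _)%N]card_ord -(@card_imset _ _ g); last first.
  by move=> x x' xx'; apply: val_inj; rewrite /= -(gP x).2 -(gP x').2 xx'.
apply/subset_leq_card/fintype.subsetP => _ /imsetP[x _ ->].
by rewrite inE (gP x).1 (gP x).2 eqxx /=.
Qed.

Let card_rows (P : pred 'I_n) :
  #|[set i | P i]%SET| = \sum_(y < n) #|[set i | (f i == y) && P i]%SET|.
Proof.
have fn i : (f i < n)%N.
  have : (f i < size sh)%N by apply: reshape_indexP; rewrite sum_sh.
  by rewrite size_map size_tuple.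
rewrite -sum1_card (partition_big (fun i => Ordinal (fn i)) xpredT) //=.
apply: eq_bigr => y _; rewrite -sum1_card; apply: eq_bigl => i.
by rewrite !inE andbC -val_eqE.
Qed.

Let transversal_lt (g : 'S_n) :
  (forall i j, f i = f j -> c (g i) = c (g j) -> i = j) ->
  forall i, (c (g i) < nth 0%N sh (f i))%N.
Proof.
move=> ginj i0; rewrite ltnNge; apply/negP => le.
set y0 := f i0 in le; set k := nth 0%N sh y0 in le.
have cardE : #|[set i | (c (g i) < k)%N]%SET| = #|[set i | (c i < k)%N]%SET|.
  rewrite -(card_imset _ (@perm_inj _ g)); apply: eq_card => i; rewrite inE.
  apply/imsetP/idP => [[j + ->]|ik]; first by rewrite inE.
  by exists (g^-1%g i); rewrite ?inE permKV.
have fn : (y0 < n)%N.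
  have : (y0 < size sh)%N by apply: reshape_indexP; rewrite sum_sh.
  by rewrite size_map size_tuple.
move: cardE; rewrite !card_rows => /eqP; apply/negP; rewrite neq_ltn; apply/orP; left.
rewrite (bigD1 (Ordinal fn)) //= [X in (_ < X)%N](bigD1 (Ordinal fn)) //=.
rewrite -addSn leq_add //; last by apply: leq_sum => y _; exact: transversal_card.
apply: proper_card; apply/properP; split.
  apply/fintype.subsetP => i; rewrite !inE => /andP[/eqP fi _].
  by rewrite fi eqxx /= (leq_trans (fc_lt i)) // fi.
exists i0; rewrite !inE eqxx /= ?fc_lt //.
by rewrite -leqNgt.
Qed.

Let mem_RC (g : 'S_n) :
  reflect (forall i j, f i = f j -> c (g i) = c (g j) -> i = j) (g \in (RG * CG)%g).
Proof.
apply: (iffP mulsgP) => [[r q /mem_RG fr /mem_CG cq ->] i j fij|ginj].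
  rewrite !permM !cq => cij; apply: (@perm_inj _ r); apply: fc_inj => //.
  by rewrite !fr.
have /choice[r rP] : forall i, exists j, f j = f i /\ c j = c (g i).
  by move=> i; apply: fc_ex; exact: transversal_lt.
have rinj : injective r.
  move=> i j rij; apply: ginj; first by rewrite -(rP i).1 -(rP j).1 rij.
  by rewrite -(rP i).2 -(rP j).2 rij.
exists (perm rinj) ((perm rinj)^-1 * g)%g; last by rewrite mulKVg.
  by apply/mem_RG => i; rewrite permE (rP i).1.
apply/mem_CG => i; rewrite permM -{2}(permKV (perm rinj) i) permE.
by rewrite (rP _).2.
Qed.

Let sign_sum (g : 'S_n) :
  \sum_(r in RG) sign_cfun CG (r ^ g)%g = (g \in (RG * CG)%g)%:R.
Proof.
have memJ (r : 'S_n) : reflect (forall i, c (g (r i)) = c (g i)) ((r ^ g)%g \in CG).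
  apply: (iffP (mem_CG _)) => [h i|h i].
    by have := h (g i); rewrite /conjg !permM permK.
  by rewrite /conjg !permM h permKV.
have [/mem_RC ginj|] := boolP (g \in _).
  rewrite (bigD1 1%g) ?group1 //= conj1g sign_cfunE odd_perm1 group1.
  rewrite big1 ?addr0 // => r /andP[/mem_RG fr r1]; rewrite sign_cfunE.
  case: memJ => [h|_]; last by rewrite mulr0n.
  case/eqP: r1; apply/permP => i; rewrite perm1; apply: ginj => //.
move=> gN.
have [[i j] [fij cij ij]] : exists p : 'I_n * 'I_n,
    [/\ f p.1 = f p.2, c (g p.1) = c (g p.2) & p.1 <> p.2].
  apply: contrapT => nex; move/negP: gN; apply; apply/mem_RC => i j fij cij.
  by apply: contrapT => ij; apply: nex; exists (i, j).
rewrite /= in fij cij ij; pose tau : 'S_n := tperm i j.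
have tauR : tau \in RG by apply/mem_RG => k; rewrite /tau; case: tpermP => [->|->|].
have tauC : (tau ^ g)%g \in CG.
  by apply/memJ => k; rewrite /tau; case: tpermP => [->|->|].
set S := \sum_(r in RG) _.
suff SN : S = - S.
  by apply/eqP; move/eqP: SN; rewrite -addr_eq0 -mulr2n mulrn_eq0.
rewrite {1}/S (reindex_inj (mulgI tau)) /= -sumrN.
apply: eq_big => [r|r _]; first by rewrite groupMl.
rewrite !sign_cfunE conjMg groupMl // odd_permM.
rewrite [odd_perm (tau ^ g)%g]odd_permJ odd_tperm.
have -> : (i != j) by apply/eqP.
by rewrite signr_addb expr1 mulN1r mulNrn.
Qed.

Lemma cfdot_row_col_char : '[row_char la, col_char la] = 1.
Proof.
rewrite /row_char -Frobenius_reciprocity cfdotE.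
have -> : \sum_(r in RG) (1 : 'CF(RG)) r * (('Res[RG] (col_char la)) r)^*
    = \sum_(r in RG) #|CG|%:R^-1 * \sum_(g in G) sign_cfun CG (r ^ g)%g.
  apply: eq_bigr => r Rr; rewrite cfun1E Rr mul1r cfResE ?finset.subsetT //.
  rewrite cfIndE ?finset.subsetT // rmorphM fmorphV rmorph_nat rmorph_sum /=.
  congr (_ * _); apply: eq_bigr => g _.
  by rewrite sign_cfunE rmorphMn rmorphXn rmorphN1.
rewrite -mulr_sumr exchange_big /= (eq_bigr _ (fun g _ => sign_sum g)).
have -> : \sum_(g in G) (g \in (RG * CG)%g)%:R = (#|RG| * #|CG|)%:R :> algC.
  rewrite -TI_cardMg // -sum1_card natr_sum big_mkcond [RHS]big_mkcond /=.
  by apply: eq_bigr => g _; rewrite finset.in_setT; case: ifP.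
by rewrite natrM mulrA mulrACA mulVf ?mul1r ?mulVf // neq0CG.
Qed.

Lemma sign_cfun_char (H : {group 'S_n}) : sign_cfun H \is a character.
Proof. exact: cfRepr_char. Qed.

Lemma sym_Iirr_uniq (i : Iirr (sym_group n)) :
  (i \in irr_constt (row_char la)) && (i \in irr_constt (col_char la))
  = (i == sym_Iirr la).
Proof.
have rC : row_char la \is a character by rewrite cfInd_char ?cfun1_char.
have cC : col_char la \is a character by rewrite cfInd_char ?sign_cfun_char.
have /choice[a aP] : forall i, exists k, '[row_char la, 'chi_i] = k%:R.
  by move=> j; apply/natrP; exact: Cnat_cfdot_char_irr.
have /choice[b bP] : forall i, exists k, '[col_char la, 'chi_i] = k%:R.
  by move=> j; apply/natrP; exact: Cnat_cfdot_char_irr.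
have : (\sum_i a i * b i == 1)%N.
  rewrite -(@pnatr_eq1 algC) natr_sum; apply/eqP.
  rewrite -[RHS]cfdot_row_col_char cfdot_sum_irr.
  by apply: eq_bigr => j _; rewrite aP bP conjC_nat natrM.
move=> /sum_nat_eq1[i0 [_ ab1 ab0]].
have Pi0 j : (j \in irr_constt (row_char la)) && (j \in irr_constt (col_char la))
    = (j == i0).
  rewrite !irr_consttE aP bP !pnatr_eq0 -!lt0n -muln_gt0.
  by have [->|ji0] := eqVneq j i0; rewrite ?ab1 ?ab0.
rewrite Pi0 /sym_Iirr; case: pickP => [j|/(_ i0)]; rewrite Pi0 ?eqxx //.
by move=> /eqP ->.
Qed.

Lemma sym_char_int (s : 'S_n) : sym_char la s \in Num.int.
Proof.
have Aut u : cfAut u (sym_char la) = sym_char la.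
  rewrite /sym_char -aut_IirrE; congr 'chi_ _; apply/eqP; rewrite -sym_Iirr_uniq.
  have /andP[] : (sym_Iirr la \in irr_constt (row_char la))
    && (sym_Iirr la \in irr_constt (col_char la)) by rewrite sym_Iirr_uniq.
  have rA : cfAut u (row_char la) = row_char la by rewrite cfAutInd rmorph1.
  have cA : cfAut u (col_char la) = col_char la.
    rewrite cfAutInd; congr ('Ind _); apply/cfunP => x.
    by rewrite cfunE sign_cfunE rmorphMn rmorphXn rmorphN1.
  rewrite !irr_consttE -{2}rA -{2}cA aut_IirrE !cfdot_aut_irr !fmorph_eq0.
  by move=> -> ->.
have [Qn galQn [QnC gQnC [_ _ Qn_s]]] := group_num_field_exists (sym_group n).
have [a Da] := Qn_s _ _ _ (irr_char (sym_Iirr la)) s (order_dvdG (finset.in_setT s)).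
apply: Cint_rat_Aint; last exact: Aint_irr.
have : a \in fixedField 'Gal({:Qn} / 1)%g.
  apply/fixedFieldP => [|nu gal_nu]; first exact: memvf.
  apply: (fmorph_inj QnC); case: (gQnC nu) => v /= ->.
  by rewrite Da; have /cfunP/(_ s) := Aut v; rewrite cfunE.
rewrite (galois_fixedField galQn) => /vlineP[q aq].
by rewrite /sym_char -Da aq alg_num_field fmorph_rat rpred_rat.
Qed.

End sym_char_theory.

Definition thoma_simplex (R : realType) (al be : nat -> R) (ga : R) : Prop :=
  [/\ nonincreasing_seq al /\ (forall i, 0 <= al i),
      nonincreasing_seq be /\ (forall i, 0 <= be i),
      0 <= ga
    & (\sum_(i <oo) (al i)%:E + \sum_(i <oo) (be i)%:E + ga%:E = 1)%E].

(* The restriction of the Thoma character to 'S_n. The parameter gamma enters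
   only through the constraint of thoma_simplex. *)
Definition thoma_char (R : realType) (al be : nat -> R) (n : nat) (s : 'S_n) : R :=
  \prod_(C in porbits s | (1 < #|C|)%N)
    (limn (series (fun i => al i ^+ #|C|))
     + (-1) ^+ #|C|.-1 * limn (series (fun i => be i ^+ #|C|))).

(* The set lambda^i of the boxes of t with entries at most i. *)
Definition subshape (t : tableau) (i : nat) : set box :=
  [set b | le_entry (t b) (Some i)].

(* The values of sym_char are rational integers (sym_char_int), so taking the
   floor only moves them from algC to R. The L i of index i > n play no role. *)
Definition vershik_kerov (R : realType) (al be : nat -> R)
    (M : probability tableau R) : Prop :=
  exists p : forall n, intpart n -> R,
    (forall (n : nat) (L : forall i, intpart i),
       (forall i, (i < n)%N -> add_box (L i) (L i.+1)) ->
       M [set t | forall i, (i <= n)%N -> subshape t i = boxes (L i)]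
       = (p n (L n))%:E) /\
    (forall (n : nat) (s : 'S_n),
       thoma_char al be s
       = \sum_(la : intpart n) p n la * (Num.floor (sym_char la s))%:~R).

Definition measure_preserving (d : measure_display) (T : measurableType d)
    (R : realType) (P : probability T R) (f : T -> T) : Prop :=
  measurable_fun setT f /\
  (forall E, measurable E -> P (f @^-1` E) = P E).

Definition ergodic (d : measure_display) (T : measurableType d)
    (R : realType) (P : probability T R) (f : T -> T) : Prop :=
  forall E, measurable E -> f @^-1` E = E -> P E = 0%E \/ P E = 1%E.

(* Main.v *)
(* A tableau is read as the infinite word of its boxes in the order of their
   entries; J then acts as a transducer whose state is the end of the current jeu
   de taquin path. Prefixes of J(t) of length n together with this end correspond
   bijectively to prefixes of t of length n + 1, so that J preserves every central
   measure.

   For ergodicity, k iterations of J give the same result on two tableaux which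
   differ only in their first k entries and have the same shape there. This is the
   confluence of jeu de taquin; it is proved by exchanging two removable corners,
   an exchange which is a Knuth relation on contents and is preserved by slides.
   Hence for a J-invariant event E the measure M(E /\ .) is again central, and it
   remains to see that M is extremal among central measures. Its character Theta is
   multiplicative on permutations of disjoint supports, so for fixed s the variable
   chi^la(s) / chi^la(1), where la is the shape of the first n boxes, has mean
   Theta(s) and, averaging Theta(s * s^g) over g, variance O(1/n). By the branching
   rule the character of M(E /\ .) is then M(E) Theta, so that E is independent of
   all cylinders, hence of itself.

   The branching rule is obtained for sym_char as defined here: the Young
   symmetrizer shows that chi^la occurs in the restriction of chi^mu whenever mu
   covers la, so the degrees dominate the numbers of paths in the Young graph, and
   the sums of squares of both equal n!. *)

Require Import Defs.
From mathcomp Require Import all_boot all_order all_algebra all_fingroup.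
From mathcomp Require Import all_field all_character.
From mathcomp Require Import all_classical all_reals all_analysis.
From mathcomp Require Import zify lra ring.

Set Implicit Arguments.
Unset Strict Implicit.
Unset Printing Implicit Defensive.

Import Order.TTheory GRing.Theory Num.Theory.
Import numFieldNormedType.Exports.

Local Open Scope classical_set_scope.
Local Open Scope ring_scope.

(** * Slides on words of boxes *)

(** Adjacency of successively added boxes is tested through contents, so that a slide step only
    involves order and distance of integers; the diagrams intervene to exclude coincidences of
    contents. This turns the invariance of the Knuth relation into a finite check by linear
    arithmetic.

    Two corners cannot be exchanged by themselves: the Knuth relation needs a third box of
    intermediate content, which is found as a corner of the diagram left after both removals.

    No modules are constructed. That an element of the group algebra acts by 0 on an irreducible
    module is expressed by the vanishing of the character on all its left translates, and this is
    deduced from a single value by a norm computation.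

    The bound O(1/n) comes from a count: if [s] moves only the first [k] points, [s] and [s ^ g]
    have disjoint supports unless [g] sends one of these points into the same set, which holds for a
    proportion at most [k ^ 2 / n] of all [g]. *)

Definition content (b : box) : int := b.1%:Z - b.2%:Z.

(* For two boxes added in succession to a Young diagram, this means that they are
   adjacent (linked_adjacent). *)
Definition linked (x a : box) : bool :=
  (content a == content x + 1) || (content x == content a + 1).

(* [x] is the last box that the jeu de taquin path has reached so far and [a] the
   box of the next entry: either [x] receives this entry and the path moves on to
   [a], or [a] keeps it. *)
Definition slide_step (x a : box) : box * box := if linked x a then (x, a) else (a, x).

Fixpoint slide (x : box) (v : seq box) : seq box :=
  if v is a :: v' then (slide_step x a).1 :: slide (slide_step x a).2 v' else [::].

Fixpoint carry (x : box) (v : seq box) : box :=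
  if v is a :: v' then carry (slide_step x a).2 v' else x.

Definition left_mem (s : seq box) (b : box) := (0 < b.1)%N ==> ((b.1.-1, b.2) \in s).
Definition below_mem (s : seq box) (b : box) := (0 < b.2)%N ==> ((b.1, b.2.-1) \in s).

Definition addable (s : seq box) (b : box) : bool :=
  [&& b \notin s, left_mem s b & below_mem s b].

Definition young (s : seq box) : bool := all (fun b => left_mem s b && below_mem s b) s.

(** A path in the Young graph from the diagram [s], recorded by its added boxes. Starting diagrams
    other than [[::]] give the skew paths that remain once a prefix has been read. *)
Fixpoint walk (s : seq box) (w : seq box) : bool :=
  if w is b :: w' then addable s b && walk (b :: s) w' else true.

Lemma eq_addable s s' b : s =i s' -> addable s b = addable s' b.
Proof. by move=> ss'; rewrite /addable /left_mem /below_mem !ss'. Qed.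

Lemma eq_walk s s' w : s =i s' -> walk s w = walk s' w.
Proof.
elim: w s s' => //= b w IH s s' ss'; rewrite (eq_addable b ss'); congr (_ && _).
by apply: IH => c; rewrite !inE ss'.
Qed.

Lemma eq_young s s' : s =i s' -> young s = young s'.
Proof.
move=> ss'; rewrite /young (eq_all_r ss'); apply: eq_all => b.
by rewrite /left_mem /below_mem !ss'.
Qed.

Lemma young_add s b : young s -> addable s b -> young (b :: s).
Proof.
move=> /allP ys /and3P[_ sl sb]; apply/allP => c; rewrite inE => /predU1P[->|/ys].
  by rewrite /left_mem /below_mem !inE; apply/andP; split; apply/implyP => h;
    rewrite ?(implyP sl h) ?(implyP sb h) orbT.
move=> /andP[cl cb]; rewrite /left_mem /below_mem !inE.
by apply/andP; split; apply/implyP => h; rewrite ?(implyP cl h) ?(implyP cb h) orbT.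
Qed.

Lemma young_down s x y x' y' :
  young s -> (x, y) \in s -> (x' <= x)%N -> (y' <= y)%N -> (x', y') \in s.
Proof.
move=> /allP ys xys x'x y'y.
have {xys} : (x', y) \in s.
  elim: x x'x xys => [|x IH]; first by rewrite leqn0 => /eqP->.
  rewrite leq_eqVlt => /predU1P[->//|x'x] /ys/andP[/implyP/(_ isT) + _].
  exact: IH.
elim: y y'y => [|y IH]; first by rewrite leqn0 => /eqP->.
rewrite leq_eqVlt => /predU1P[->//|y'y] /ys/andP[_ /implyP/(_ isT)].
exact: IH.
Qed.

Lemma walk_cat s w v : walk s (w ++ v) = walk s w && walk (rev w ++ s) v.
Proof.
elim: w s => //= b w IH s; rewrite IH -andbA rev_cons -cats1 -catA.
by [].
Qed.

Lemma walk_young s w : young s -> walk s w -> young (rev w ++ s).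
Proof.
elim: w s => //= b w IH s ys /andP[sb /IH]; rewrite rev_cons -cats1 -catA; apply.
exact: young_add.
Qed.

Lemma walk_uniq s w : uniq s -> walk s w -> uniq (rev w ++ s).
Proof.
elim: w s => //= b w IH s us /andP[/and3P[bs _ _] /IH]; rewrite rev_cons -cats1 -catA.
by apply => /=; rewrite bs.
Qed.

(** A box further out on the diagonal of [x] has to wait for the boxes to the right of and above
    [x], and a box further in is already present. *)
Lemma content_succ s x a : young s -> addable s x -> addable (x :: s) a ->
  content a != content x.
Proof.
case: x => x y; case: a => x' y' ys /and3P[xs xl xb] /and3P[+ + +].
rewrite /left_mem /below_mem /content /= !inE !xpair_eqE /= negb_or => /andP[xa as_] al ab.
apply/eqP => cc; have [xx'|x'x] := ltnP x x'.
  move: al; rewrite (leq_ltn_trans (leq0n _) xx') /= => /orP[/andP[/eqP ? /eqP ?]|]; first by lia.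
  by move=> h; have := @young_down s _ _ x y ys h; rewrite (negbTE xs); lia.
have {}x'x : (x' < x)%N by move: xa; lia.
move: xl; rewrite /left_mem /= (leq_ltn_trans (leq0n _) x'x) /= => h; have := @young_down s _ _ x' y' ys h.
by rewrite (negbTE as_); lia.
Qed.

(** Adjacent boxes have contents that differ by 1, so unlinked boxes do not support each other and
    their additions commute. *)
Lemma linkedPn s x a : young s -> addable s x -> addable (x :: s) a -> ~~ linked x a ->
  addable s a && addable (a :: s) x.
Proof.
case: x => x y; case: a => x' y' ys /and3P[xs xl xb] /and3P[+ + +].
rewrite /linked /addable /left_mem /below_mem /content /= in xs xl xb *.
rewrite !inE !xpair_eqE /= negb_or => /andP[xa as_] al ab nl.
rewrite as_ negb_or xs.
have -> /= : ~~ ((x == x') && (y == y')) by rewrite (eq_sym x) (eq_sym y).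
apply/andP; split; apply/andP; split; apply/implyP => h.
- by move: al; rewrite h /= => /orP[/andP[/eqP e1 /eqP e2]|//]; move: nl; lia.
- by move: ab; rewrite h /= => /orP[/andP[/eqP e1 /eqP e2]|//]; move: nl; lia.
- by rewrite (implyP xl h) orbT.
- by rewrite (implyP xb h) orbT.
Qed.

Lemma mem_slide_step x a b :
  ((b == (slide_step x a).1) || (b == (slide_step x a).2)) = ((b == x) || (b == a)).
Proof. by rewrite /slide_step; case: ifP => //= _; rewrite orbC. Qed.

Lemma walk_slide_step s x a v : young s -> walk s [:: x, a & v] ->
  walk s [:: (slide_step x a).1, (slide_step x a).2 & v].
Proof.
move=> ys /= /and3P[sx sa sv].
rewrite /slide_step; case: ifPn => [_|/(linkedPn ys sx sa)/andP[-> ->]] /=.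
  by rewrite sx sa.
by rewrite (eq_walk (s' := [:: a, x & s])) // => b; rewrite !inE orbCA.
Qed.

Lemma walk_slide s x v : young s -> walk s (x :: v) -> walk s (rcons (slide x v) (carry x v)).
Proof.
elim: v s x => [|a v IH] s x ys //.
move=> /(walk_slide_step ys); rewrite [walk _ _]/= => /andP[sx xa].
rewrite /= sx /=; apply: IH => //; exact: young_add.
Qed.

Lemma mem_slide x v : rcons (slide x v) (carry x v) =i x :: v.
Proof.
elim: v x => [|a v IH] x b //=.
by rewrite inE IH !inE orbA mem_slide_step orbA.
Qed.

Lemma size_slide x v : size (slide x v) = size v.
Proof. by elim: v x => //= a v IH x; rewrite IH. Qed.

Lemma slide_cat x v v' : slide x (v ++ v') = slide x v ++ slide (carry x v) v'.
Proof. by elim: v x => //= a v IH x; rewrite IH. Qed.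

Definition between (b a c : box) : bool :=
  (content a < content b < content c) || (content c < content b < content a).

(* The Knuth relation on the contents of three successive boxes; it is Haiman's
   elementary dual equivalence of the corresponding skew tableaux. *)
Definition knuth (u1 u2 u3 v1 v2 v3 : box) : Prop :=
  [/\ v1 = u1, v2 = u3, v3 = u2 & between u1 u2 u3] \/
  [/\ v1 = u2, v2 = u1, v3 = u3 & between u3 u1 u2].

(** A later box on the diagonal of [x] waits for two boxes, one on either neighbouring diagonal, and
    [y] is only one box. If [y] is unlinked from [x] or from [z], a swap reduces the claim to
    [content_succ]. *)
Lemma content_succ2 s x y z : young s -> walk s [:: x; y; z] -> content z != content x.
Proof.
move=> ys; have [lxy|nxy] := boolP (linked x y); last first.
  move=> /(walk_slide_step ys); rewrite /slide_step (negbTE nxy) [walk _ _]/=.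
  by move=> /and4P[sy sx sz _]; apply: content_succ sx sz; exact: young_add.
have [lyz|nyz] := boolP (linked y z); last first.
  move=> w; have [sx w'] : addable s x /\ walk (x :: s) [:: y; z] by apply/andP.
  move: (walk_slide_step (young_add ys sx) w').
  rewrite /slide_step (negbTE nyz) => /andP[sz _].
  exact: content_succ sx sz.
case: x y z lxy lyz => [x1 x2] [y1 y2] [z1 z2]; rewrite /linked /content /= => lxy lyz.
move=> /and4P[/and3P[xs xl _] _ /and3P[zs zl zb] _]; apply/eqP => zx.
move: zs zl zb xl; rewrite /left_mem /below_mem !inE !xpair_eqE !negb_or /=.
move=> /and3P[zy zx' zs] zl zb xl.
have [xz|zx1] := ltnP x1 z1; last first.
  have zx2 : (z1 < x1)%N by move: zx'; lia.
  move: xl; rewrite (leq_ltn_trans (leq0n _) zx2) /= => h; have := @young_down s _ _ z1 z2 ys h.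
  by rewrite (negbTE zs); lia.
move: zl zb; rewrite (leq_ltn_trans (leq0n _) xz) /=.
have -> /= : (0 < z2)%N by lia.
move=> /or3P[/andP[/eqP ? /eqP ?]|/andP[/eqP ? /eqP ?]|]; last first.
- by move=> h; have := @young_down s _ _ x1 x2 ys h; rewrite (negbTE xs); lia.
- by lia.
move=> /or3P[/andP[/eqP ? /eqP ?]|/andP[/eqP ? /eqP ?]|]; last first.
- by move=> h; have := @young_down s _ _ x1 x2 ys h; rewrite (negbTE xs); lia.
- by lia.
by lia.
Qed.

(** If [e] is on the diagonal of [u1], the two boxes that it waits for are [u2] and [u3]. Were one
    of them unlinked from [u1], a swap would leave a single box between [u1] and [e], against
    [content_succ2]. *)
Lemma walk3 s u1 u2 u3 e : young s -> walk s [:: u1; u2; u3; e] ->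
  [/\ content e != content u3, content e != content u2 &
   content e = content u1 -> linked u1 u2 && linked u1 u3].
Proof.
move=> ys w; have [s1 w'] : addable s u1 /\ walk (u1 :: s) [:: u2; u3; e] by apply/andP.
have ys1 := young_add ys s1.
split.
- case/andP: w' => s2 /=/and3P[s3 se _]; apply: content_succ s3 se.
  exact: young_add.
- exact: content_succ2 w'.
move=> eu1; have l12 : linked u1 u2.
  apply: contraT => n12; move: (walk_slide_step ys w); rewrite /slide_step (negbTE n12).
  case/andP=> s2 /(content_succ2 (young_add ys s2)); by rewrite eu1 eqxx.
rewrite l12 /=; apply: contraT => n13.
have [s2 w3] : addable (u1 :: s) u2 /\ walk (u2 :: u1 :: s) [:: u3; e] by apply/andP.
have := walk_slide_step (young_add ys1 s2) w3; rewrite /slide_step.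
have -> : linked u3 e = false by move: n13; rewrite /linked eu1; lia.
case/andP=> se _; have : walk s [:: u1; u2; e] by rewrite /= s1 s2 se.
by move/(content_succ2 ys); rewrite eu1 eqxx.
Qed.

Lemma linkedC x a : linked x a = linked a x.
Proof. by rewrite /linked orbC. Qed.

Lemma linked_cases x a :
  [\/ content a = content x /\ (linked x a = false /\ linked a x = false),
      content a = content x + 1 /\ (linked x a = true /\ linked a x = true),
      content x = content a + 1 /\ (linked x a = true /\ linked a x = true)
    | (content x + 2 <= content a \/ content a + 2 <= content x) /\
      (linked x a = false /\ linked a x = false)].
Proof.
rewrite (linkedC a) /linked; case: (ltgtP (content x) (content a)) => h.
- have [e|e] := eqVneq (content a) (content x + 1).
    by constructor 2; split; [|lia].
  by constructor 4; split; lia.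
- have [e|e] := eqVneq (content x) (content a + 1).
    by constructor 3; split; [|lia].
  by constructor 4; split; lia.
- by constructor 1; rewrite h; split; [|lia].
Qed.

(** The slides are composed, so [e] meets [u3] first, and what [u3] emits meets [u2]. Only the
    relative positions of the four contents matter: [linked_cases] enumerates them pair by pair,
    [between] and [walk3] refute the inconsistent choices, and the remaining ones are computed. *)
Lemma knuth_step s u1 u2 u3 v1 v2 v3 e : young s -> walk s [:: u1; u2; u3; e] ->
  knuth u1 u2 u3 v1 v2 v3 ->
  let s3 := slide_step u3 e in let s2 := slide_step u2 s3.1 in let s1 := slide_step u1 s2.1 in
  let t3 := slide_step v3 e in let t2 := slide_step v2 t3.1 in let t1 := slide_step v1 t2.1 in
  s1.1 = t1.1 /\ knuth s1.2 s2.2 s3.2 t1.2 t2.2 t3.2.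
Proof.
move=> ys /(walk3 ys)[eu3 eu2 eu1] K.
have {}eu1 : content e = content u1 ->
    (content u2 = content u1 + 1 \/ content u1 = content u2 + 1) /\
    (content u3 = content u1 + 1 \/ content u1 = content u3 + 1).
  by move=> /eu1/andP[/orP[]/eqP? /orP[]/eqP?]; split; by [left|right].
have {}eu2 : content e <> content u2 by apply/eqP.
have {}eu3 : content e <> content u3 by apply/eqP.
rewrite /slide_step; case: K => -[-> -> -> /orP[]/andP[h1 h2]];
case: (linked_cases u2 u3) => -[c23 [l23 l32]]; try (exfalso; clear - c23 h1 h2; lia);
case: (linked_cases u1 u2) => -[c12 [l12 l21]]; try (exfalso; clear - c23 c12 h1 h2; lia);
case: (linked_cases u1 u3) => -[c13 [l13 l31]]; try (exfalso; clear - c23 c12 c13 h1 h2; lia);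
case: (linked_cases u3 e) => -[c3 [l3 l3']]; try (exfalso; clear - c3 c23 c12 c13 h1 h2 eu3; lia);
case: (linked_cases u2 e) => -[c2 [l2 l2']]; try (exfalso; clear - c2 c3 c23 c12 c13 h1 h2 eu2; lia);
case: (linked_cases u1 e) => -[c1 [l1 l1']]; try (exfalso; clear - c1 c2 c3 c23 c12 c13 h1 h2 eu1; lia).
all: repeat (rewrite ?l3 ?l2 ?l1 ?l12 ?l13 ?l23 ?l21 ?l32 ?l31 /=).
all: clear - c1 c2 c3 c23 c12 c13 h1 h2; split=> //; rewrite /knuth /between;
  first [left; split=> //; clear - c1 c2 c3 c23 c12 c13 h1 h2; lia
        |right; split=> //; clear - c1 c2 c3 c23 c12 c13 h1 h2; lia].
Qed.

Lemma walk_cons s b w : walk s (b :: w) = addable s b && walk (b :: s) w.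
Proof. by []. Qed.

Lemma walk_mem4 s u1 u2 u3 e v u1' u2' u3' e' : young s ->
  walk s [:: u1, u2, u3, e & v] ->
  let s3 := slide_step u3 e in let s2 := slide_step u2 s3.1 in let s1 := slide_step u1 s2.1 in
  u1' = s1.1 -> u2' = s1.2 -> u3' = s2.2 -> e' = s3.2 ->
  walk s [:: u1', u2', u3', e' & v].
Proof.
move=> ys w s3 s2 s1 -> -> -> ->; apply: walk_slide_step => //.
have [h1 w1] : addable s u1 /\ walk (u1 :: s) [:: u2, u3, e & v] by apply/andP.
have ys1 := young_add ys h1.
have [h2 w2] : addable (u1 :: s) u2 /\ walk (u2 :: u1 :: s) [:: u3, e & v] by apply/andP.
have w3 := walk_slide_step (young_add ys1 h2) w2.
have w4 : walk (u1 :: s) [:: u2, s3.1, s3.2 & v] by rewrite walk_cons h2.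
by rewrite walk_cons h1; exact: walk_slide_step w4.
Qed.

Lemma slide_knuth s u1 u2 u3 v1 v2 v3 v : young s -> walk s [:: u1, u2, u3 & v] ->
  knuth u1 u2 u3 v1 v2 v3 ->
  slide u1 (slide u2 (slide u3 v)) = slide v1 (slide v2 (slide v3 v)).
Proof.
elim: v s u1 u2 u3 v1 v2 v3 => [|e v IH] s u1 u2 u3 v1 v2 v3 ys w K //=.
have w4 : walk s [:: u1; u2; u3; e].
  by move: w; rewrite -[[:: _, _, _, _ & _]]/([:: u1; u2; u3; e] ++ v) walk_cat => /andP[].
have [e1 K'] := knuth_step ys w4 K.
rewrite e1; congr (_ :: _).
have := walk_mem4 ys w erefl erefl erefl erefl.
rewrite walk_cons => /andP[ha wa].
apply: IH K' => //; last exact: wa.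
exact: young_add.
Qed.

(** * Corners of a diagram and confluence of slides *)

Definition corner (s : seq box) (b : box) : bool :=
  [&& b \in s, right_box b \notin s & up_box b \notin s].

Lemma corner_above s x y : (x, y) \in s ->
  exists b, [/\ corner s b, (x <= b.1)%N & (y <= b.2)%N].
Proof.
pose m := (\max_(b <- s) (b.1 + b.2))%N.
have bd b : b \in s -> (b.1 + b.2 <= m)%N by move=> bs; rewrite /m (big_rem _ bs) /= leq_maxl.
have [n] := ubnP (m - (x + y)); move: m bd => m bd.
elim: n x y => // n IH x y lt xys.
have [r|nr] := boolP ((x.+1, y) \in s).
  have [|//|b [cb xb yb]] := IH x.+1 y; last by exists b; split=> //; exact: ltnW.
  by move: lt; have /= := bd _ r; clear; lia.
have [u|nu] := boolP ((x, y.+1) \in s).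
  have [|//|b [cb xb yb]] := IH x y.+1; last by exists b; split=> //; exact: ltnW.
  by move: lt; have /= := bd _ u; clear; lia.
by exists (x, y); rewrite /corner xys nr nu.
Qed.

Lemma corner_rem s b : uniq s -> young s -> corner s b ->
  young (rem b s) && addable (rem b s) b.
Proof.
move=> us ys /and3P[bs rb ub]; have mr := mem_rem_uniq b us.
have ys' := allP ys.
apply/andP; split; last first.
  have /andP[l d] := ys' _ bs; rewrite /addable /left_mem /below_mem !mr !inE eqxx /=.
  apply/andP; split; apply/implyP => h; case: b {rb ub} bs l d mr h => x y bs l d mr h;
    rewrite /left_mem /below_mem /= in h l d *; rewrite xpair_eqE ?(implyP l h) ?(implyP d h) andbT; lia.
apply/allP => -[x y]; rewrite mr inE => /andP[cb cs]; have /andP[l d] := ys' _ cs.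
rewrite /left_mem /below_mem /= in l d *; apply/andP; split; apply/implyP => h;
  rewrite mr inE ?(implyP l h) ?(implyP d h) andbT; apply/eqP => e; rewrite -e in rb ub.
- by move: rb; rewrite /right_box /= prednK // cs.
- by move: ub; rewrite /up_box /= prednK // cs.
Qed.

Lemma young_walk s : uniq s -> young s -> exists2 w, walk [::] w & perm_eq w s.
Proof.
have [n] := ubnP (size s); elim: n s => // n IH [|c s] lt us ys; first by exists [::].
have [|b [cb _ _]] := @corner_above (c :: s) c.1 c.2.
  by rewrite -surjective_pairing mem_head.
have /andP[ys' ab] := corner_rem us ys cb.
have bs : b \in c :: s by case/and3P: cb.
have [||//|w ww pw] := IH (rem b (c :: s)); rewrite ?rem_uniq //.
  by rewrite size_rem.
exists (rcons w b).
  rewrite -cats1 walk_cat ww /= andbT cats0.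
  by rewrite (@eq_addable _ (rem b (c :: s))) // => d; rewrite mem_rev (perm_mem pw).
by rewrite perm_rcons (permPr (perm_to_rem bs)) perm_cons.
Qed.

Lemma walk_rcons w b : walk [::] (rcons w b) = walk [::] w && addable w b.
Proof.
rewrite -cats1 walk_cat /= andbT cats0; congr (_ && _).
by apply: eq_addable => c; rewrite mem_rev.
Qed.

Lemma walk0_young w : walk [::] w -> young w.
Proof.
move/(walk_young (isT : young [::])); rewrite cats0 => yw.
by rewrite -(eq_young (s := rev w)) // => b; rewrite mem_rev.
Qed.

Lemma walk0_uniq w : walk [::] w -> uniq w.
Proof. by move/(walk_uniq (isT : uniq [::])); rewrite cats0 rev_uniq. Qed.

Lemma addable_corner s b : young s -> addable s b -> corner (b :: s) b.
Proof.
case: b => x y ys /and3P[bs _ _]; rewrite /corner mem_head !inE !negb_or !xpair_eqE /=.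
apply/andP; split; apply/andP; split; try lia.
- by apply: contra bs => h; exact: young_down ys h _ _.
- by apply: contra bs => h; exact: young_down ys h _ _.
Qed.

Lemma eq_corner s s' b : s =i s' -> corner s b = corner s' b.
Proof. by move=> ss'; rewrite /corner !ss'. Qed.

Lemma rcons_walk_corner w b : walk [::] (rcons w b) -> corner (rcons w b) b.
Proof.
rewrite walk_rcons => /andP[/walk0_young yw ab].
rewrite (eq_corner (s' := b :: w)); first exact: addable_corner.
by move=> c; rewrite mem_rcons.
Qed.

(** Supplies the third box, the witness of a Knuth relation that exchanges [z] and [z']. *)
Lemma corner_between s z z' : uniq s -> young s -> corner s z -> corner s z' -> z != z' ->
  exists2 y, corner (rem z' (rem z s)) y & between y z' z.
Proof.
wlog zz : z z' / content z < content z'.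
  move=> H us ys cz cz' zz'.
  have [/H h|ne] := boolP (content z < content z'); first exact: h.
  have [|h] := boolP (content z' < content z).
    move/H => /(_ us ys cz' cz); rewrite eq_sym zz' => /(_ isT)[y cy bt]; exists y.
      rewrite (eq_corner (s' := rem z (rem z' s))) // => c.
      by rewrite !mem_rem_uniq ?rem_uniq // !inE !mem_rem_uniq // !inE andbCA.
    by move: bt; rewrite /between orbC.
  (* On a common diagonal, the outer box would force a neighbour of the inner one into [s]. *)
  have cc : content z = content z' by lia.
  case: z z' cz cz' zz' cc {H ne h} => [x y] [x' y'] /and3P[zs zr zu] /and3P[z's z'r z'u].
  rewrite /content xpair_eqE /= => ne cc; exfalso.
  have [h|h] := ltnP x x'.
    by move/negP: zr; apply; apply: young_down ys z's _ _; rewrite /=; lia.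
  by move/negP: z'r; apply; apply: young_down ys zs _ _; rewrite /=; lia.
move=> us ys cz cz' zz'.
have us' : uniq (rem z s) by exact: rem_uniq.
case: z z' zz cz cz' zz' us' => [x y] [x' y'] zz /and3P[zs zr zu] /and3P[z's z'r z'u] zz' us'.
have xx : (x < x')%N.
  rewrite ltnNge; apply/negP => h; move: zz; rewrite /content /= => zz.
  by move/negP: z'u; apply; apply: young_down ys zs _ _; rewrite /=; lia.
have yy : (y' < y)%N.
  rewrite ltnNge; apply/negP => h; move: zz; rewrite /content /= => zz.
  by move/negP: zr; apply; apply: young_down ys z's _ _; rewrite /=; lia.
(* The box in the column of [z] and the row of [z'] survives both removals. As [z] and [z'] are
   corners, a corner beyond this box stays below the row of [z] and left of the column of [z'],
   which bounds its content on both sides. *)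
have [|[a b] [/and3P[cs cr cu] /= xa yb]] := @corner_above (rem (x', y') (rem (x, y) s)) x y'.
  rewrite !mem_rem_uniq // !inE !xpair_eqE mem_rem_uniq // !inE !xpair_eqE.
  have -> : (x, y') \in s by apply: young_down ys zs _ _; rewrite /=; lia.
  by lia.
exists (a, b); first by rewrite /corner cs cr cu.
move: cs; rewrite !mem_rem_uniq // !inE !xpair_eqE mem_rem_uniq // !inE !xpair_eqE.
move=> /and3P[n1 n2 cs].
have yb' : (b < y)%N.
  rewrite ltnNge; apply/negP => h.
  have [e|ne] := eqVneq a x.
    by move/negP: zu; apply; apply: young_down ys cs _ _; clear - h n1 n2 xa yb e; rewrite /=; lia.
  by move/negP: zr; apply; apply: young_down ys cs _ _; clear - h n1 n2 xa yb ne; rewrite /=; lia.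
have xa' : (a < x')%N.
  rewrite ltnNge; apply/negP => h.
  have [e|ne] := eqVneq b y'.
    by move/negP: z'r; apply; apply: young_down ys cs _ _; clear - h n1 n2 xa yb e; rewrite /=; lia.
  by move/negP: z'u; apply; apply: young_down ys cs _ _; clear - h n1 n2 xa yb ne; rewrite /=; lia.
by clear - xa yb xa' yb'; rewrite /between /content /=; lia.
Qed.

(** The slides start at the boxes of [zs] from the head on. In the uses [rev zs] is a walk: the head
    is a corner of the diagram, the next box a corner of what is left, and so on. *)
Definition slides (v zs : seq box) : seq box := foldl (fun v z => slide z v) v zs.

Lemma corner_sub s s' b : {subset s' <= s} -> b \in s' -> corner s b -> corner s' b.
Proof.
move=> ss' bs' /and3P[_ r u]; apply/and3P; split=> //.
- by apply: contra r; exact: ss'.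
- by apply: contra u; exact: ss'.
Qed.

Lemma walk_cat_slide w z v : walk [::] (rcons w z ++ v) -> walk [::] (w ++ slide z v).
Proof.
rewrite -cats1 -catA walk_cat cat1s => /andP[ww wv]; rewrite walk_cat ww /=.
have yw : young (rev w ++ [::]) by apply: walk_young.
by have := walk_slide yw wv; rewrite -cats1 walk_cat => /andP[].
Qed.

(* Two corners removed in either order leave a diagram having a corner of
   intermediate content; this reduces the claim to a Knuth move at the top. *)
Lemma slides_confluent zs zs' v : walk [::] (rev zs ++ v) -> walk [::] (rev zs') ->
  zs =i zs' -> slides v zs = slides v zs'.
Proof.
have [n] := ubnP (size zs); elim: n zs zs' v => // n IH [|z ds] [|z' ds'] v lt.
- by [].
- by move=> _ _ /(_ z'); rewrite mem_head.
- by move=> _ _ /(_ z); rewrite mem_head.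
set s := z :: ds => wv w' ss'.
have w : walk [::] (rev s) by move: wv; rewrite walk_cat => /andP[].
have us : uniq s by rewrite -rev_uniq; exact: walk0_uniq.
have us' : uniq (z' :: ds') by rewrite -rev_uniq; exact: walk0_uniq.
have revs c : (c \in rev s) = (c \in s) by rewrite mem_rev.
have ys : young s by rewrite -(eq_young revs); exact: walk0_young.
have wd : walk [::] (rev ds) by move: w; rewrite rev_cons walk_rcons => /andP[].
have wd' : walk [::] (rev ds') by move: w'; rewrite rev_cons walk_rcons => /andP[].
have corn : corner s z by rewrite -(eq_corner z revs) rev_cons; apply: rcons_walk_corner; rewrite -rev_cons.
have corn' : corner s z'.
  rewrite (eq_corner z' (ss' : s =i _)) -(@eq_corner (rev (z' :: ds'))); last by move=> c; rewrite mem_rev.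
  by rewrite rev_cons; apply: rcons_walk_corner; rewrite -rev_cons.
have dsE : ds =i rem z s by rewrite /s /= eqxx.
have dsE' : ds' =i rem z' s.
  move=> c; rewrite (mem_rem_uniq _ us) inE ss' !inE.
  by case: eqP => [->|//] /=; apply/negbTE; case/andP: us'.
have [/andP[yz az] /andP[yz' az']] := (corner_rem us ys corn, corner_rem us ys corn').
have szE : size ds' = size ds.
  have : perm_eq s (z' :: ds') by apply: uniq_perm.
  by move/perm_size => [].
have wv' : walk [::] (rev (z' :: ds') ++ v).
  move: wv; rewrite !walk_cat w' => /andP[_]; rewrite (@eq_walk _ (rev (rev (z' :: ds')) ++ [::])) //.
  by move=> c; rewrite !cats0 !mem_rev ss'.
have wz : walk [::] (rev ds ++ slide z v) by apply: walk_cat_slide; rewrite -rev_cons.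
have wz' : walk [::] (rev ds' ++ slide z' v) by apply: walk_cat_slide; rewrite -rev_cons.
have [zz'|nzz] := eqVneq z z'.
  rewrite /= -zz'; apply: IH => // c.
  by rewrite dsE dsE' zz'.
(* With [e] a walk filling the rest, the induction hypothesis replaces [ds] by [z', y, rev e] and
   [ds'] by [z, y, rev e]. The two complete orders then differ only by the exchange of [z] and [z']
   next to [y], a Knuth move. *)
have [y cy bt] := corner_between us ys corn corn' nzz.
set k := rem z' (rem z s) in cy.
have kE : k =i rem z (rem z' s).
  by move=> c; rewrite /k !mem_rem_uniq ?rem_uniq // !inE !mem_rem_uniq // !inE andbCA.
have uk : uniq k by rewrite !rem_uniq.
have cz' : corner (rem z s) z'.
  apply: (corner_sub _ _ corn'); first by move=> c; exact: mem_rem.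
  by rewrite mem_rem_uniq // inE eq_sym nzz; case/and3P: corn'.
have cz : corner (rem z' s) z.
  apply: (corner_sub _ _ corn); first by move=> c; exact: mem_rem.
  by rewrite mem_rem_uniq // inE nzz; case/and3P: corn.
have /andP[yk ak'] := corner_rem (rem_uniq z us) yz cz'.
have /andP[_ ak] := corner_rem (rem_uniq z' us) yz' cz.
have /andP[yy ay] := corner_rem uk yk cy.
have [e we pe] := young_walk (rem_uniq y uk) yy.
have memk c : (c \in k) = (c == y) || (c \in e).
  rewrite (perm_mem pe) mem_rem_uniq // inE; case: eqP => [->|//].
  by case/and3P: cy.
have memz c : (c \in rem z s) = [|| c == z', c == y | c \in e].
  rewrite -memk (mem_rem_uniq _ (rem_uniq z us)) inE; case: eqP => [->|//].
  by case/and3P: cz'.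
have memz' c : (c \in rem z' s) = [|| c == z, c == y | c \in e].
  rewrite -memk kE (mem_rem_uniq _ (rem_uniq z' us)) inE; case: eqP => [->|//].
  by case/and3P: cz.
have ey : walk [::] (rcons e y).
  by rewrite walk_rcons we (@eq_addable _ (rem y k)) //; exact: perm_mem.
have eyz' : walk [::] (rcons (rcons e y) z').
  by rewrite walk_rcons ey (@eq_addable _ k) // => c; rewrite memk mem_rcons inE.
have eyz : walk [::] (rcons (rcons e y) z).
  by rewrite walk_rcons ey (@eq_addable _ (rem z (rem z' s))) // => c; rewrite -kE memk mem_rcons inE.
rewrite /=.
have -> : slides (slide z v) ds = slides (slide z v) [:: z', y & rev e].
  apply: IH => //; first by rewrite !rev_cons revK.
  by move=> c; rewrite dsE memz !inE mem_rev.
have -> : slides (slide z' v) ds' = slides (slide z' v) [:: z, y & rev e].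
  apply: IH => //; [by rewrite szE|by rewrite !rev_cons revK|].
  by move=> c; rewrite dsE' memz' !inE mem_rev.
rewrite /=; congr (slides _ (rev e)).
apply: (@slide_knuth e y z' z y z z') (walk0_young we) _ _; last by left.
have wrest : walk [:: z, z', y & e] v.
  move: wv; rewrite walk_cat => /andP[_]; rewrite (@eq_walk _ [:: z, z', y & e]) //.
  move=> c; rewrite cats0 !mem_rev inE; congr (_ || _).
  by rewrite dsE memz.
rewrite !walk_cons wrest andbT; apply/and3P; split.
- by rewrite (@eq_addable _ (rem y k)) //; exact: perm_mem.
- by rewrite (@eq_addable _ k) // => c; rewrite memk inE.
- by rewrite (@eq_addable _ (rem z s)) // => c; rewrite memz !inE.
Qed.

Definition jdt_word (w : seq box) : seq box := if w is x :: v then slide x v else [::].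

(* The boxes at which the paths of the first [n] slides leave [w]. *)
Fixpoint vacated (n : nat) (w : seq box) : seq box :=
  if n is n'.+1 then
    if w is x :: v then carry x v :: vacated n' (slide x v) else [::]
  else [::].

Lemma vacatedP w : walk [::] w -> walk [::] (rev (vacated (size w) w)) /\ vacated (size w) w =i w.
Proof.
have [n] := ubnPeq (size w); elim: n w => [|n IH] [|x v] // [sv] w.
have := walk_slide (isT : young [::]) w; rewrite walk_rcons => /andP[ws ac].
have [|+ E] := IH (slide x v) _ ws; first by rewrite size_slide.
move=> wr.
rewrite /= rev_cons walk_rcons wr.
split; last by move=> c; rewrite [LHS]in_cons E -in_cons -mem_rcons mem_slide.
by rewrite (@eq_addable _ (slide x v)) // => c; rewrite mem_rev E.
Qed.

Lemma iter_jdt_word_cat w v :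
  iter (size w) jdt_word (w ++ v) = slides v (vacated (size w) w).
Proof.
have [n] := ubnPeq (size w); elim: n w v => [|n IH] [|x u] v // [su].
by rewrite iterSr /= slide_cat IH ?size_slide.
Qed.

Lemma iter_jdt_word_prefix w w' v : walk [::] (w ++ v) -> walk [::] w' -> w =i w' ->
  iter (size w) jdt_word (w ++ v) = iter (size w') jdt_word (w' ++ v).
Proof.
move=> wv ww' ww; rewrite !iter_jdt_word_cat.
have ww0 : walk [::] w by move: wv; rewrite walk_cat => /andP[].
have [r e] := vacatedP ww0; have [r' e'] := vacatedP ww'.
apply: slides_confluent => //; last by move=> c; rewrite e ww e'.
move: wv; rewrite !walk_cat r => /andP[_].
rewrite (@eq_walk _ (rev (rev (vacated (size w) w)) ++ [::])) // => c.
by rewrite !cats0 !mem_rev e.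
Qed.

(** * Tableaux and words *)

Definition cylinder (w : seq box) : set tableau :=
  [set t | forall i, (i < size w)%N -> t (nth (0, 0)%N w i) = Some i.+1].

Lemma entry_inj (t : tableau) b b' k : t b = Some k -> t b' = Some k -> b = b'.
Proof.
case: (entriesP t) => t0 tex _ _ tb tb'.
have k0 : (0 < k)%N by rewrite lt0n; apply/eqP => k0; apply: (t0 b); rewrite tb k0.
by have [c [_ cu]] := tex k k0; rewrite -(cu _ tb) -(cu _ tb').
Qed.

Lemma entry_right (t : tableau) b : le_entry (t b) (t (right_box b)).
Proof. by case: b (entriesP t) => x y [_ _ + _]; apply. Qed.

Lemma entry_up (t : tableau) b : le_entry (t b) (t (up_box b)).
Proof. by case: b (entriesP t) => x y [_ _ _]; apply. Qed.

Lemma cylinder_cat w v t : cylinder (w ++ v) t -> cylinder w t.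
Proof.
move=> h i iw; rewrite -h; first by rewrite nth_cat iw.
by rewrite size_cat (leq_trans iw) ?leq_addr.
Qed.

Lemma cylinder_rcons w b t : cylinder (rcons w b) t <-> cylinder w t /\ t b = Some (size w).+1.
Proof.
split=> [h|[h tb] i].
  split; first by move: h; rewrite -cats1 => /cylinder_cat.
  by rewrite -h ?size_rcons // nth_rcons ltnn eqxx.
rewrite size_rcons nth_rcons ltnS leq_eqVlt => /predU1P[->|iw]; first by rewrite ltnn eqxx.
by rewrite iw; exact: h.
Qed.

Lemma mem_cylinder w t b : cylinder w t -> (b \in w) = le_entry (t b) (Some (size w)).
Proof.
move=> tw; apply/idP/idP => [bw|].
  by rewrite -(nth_index (0, 0)%N bw) tw ?index_mem //= index_mem.
case tb : (t b) => [[|k]|//] /= kw; first by have [/(_ b)] := entriesP t.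
by rewrite (entry_inj tb (tw _ kw)) mem_nth.
Qed.

Lemma subshape_cylinder w t : cylinder w t -> subshape t (size w) = [set b | b \in w].
Proof.
by move=> tw; apply/seteqP; split=> b; rewrite /subshape /= (mem_cylinder _ tw).
Qed.

Lemma cylinder_walk w t : cylinder w t -> walk [::] w.
Proof.
elim/last_ind: w => // w b IH /cylinder_rcons[tw tb].
rewrite walk_rcons (IH tw) /=; apply/and3P; split.
- by rewrite (mem_cylinder _ tw) tb /= ltnn.
- apply/implyP => b1; rewrite (mem_cylinder _ tw).
  have := entry_right t (b.1.-1, b.2); rewrite /right_box /= prednK // -surjective_pairing tb.
  case e : (t _) => [k|//] /=; rewrite leq_eqVlt ltnS => /predU1P[k1|//].
  by have := entry_inj tb (etrans e (congr1 _ k1)); case: b b1 {tb e} => [[|x] y] // _ []; lia.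
- apply/implyP => b1; rewrite (mem_cylinder _ tw).
  have := entry_up t (b.1, b.2.-1); rewrite /up_box /= prednK // -surjective_pairing tb.
  case e : (t _) => [k|//] /=; rewrite leq_eqVlt ltnS => /predU1P[k1|//].
  by have := entry_inj tb (etrans e (congr1 _ k1)); case: b b1 {tb e} => [x [|y]] // _ []; lia.
Qed.

Lemma cylinder_exists t n : exists2 w, size w = n & cylinder w t.
Proof.
elim: n => [|n [w <- tw]]; first by exists [::].
case: (entriesP t) => _ /(_ (size w).+1 isT)[b [tb _]] _ _.
by exists (rcons w b); rewrite ?size_rcons //; apply/cylinder_rcons.
Qed.

Lemma cylinder_inj w w' t : size w = size w' -> cylinder w t -> cylinder w' t -> w = w'.
Proof.
move=> sw tw tw'; apply: (@eq_from_nth _ (0, 0)%N) => // i iw.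
by apply: (entry_inj (tw _ iw)); apply: tw'; rewrite -sw.
Qed.

(** On a neighbouring diagonal, a box further in than the neighbours of [x] already belongs to [s],
    and one further out would need its left neighbour in [s], hence [x] too. *)
Lemma linked_adjacent s x a : young s -> addable s x -> addable (x :: s) a -> linked x a ->
  a = right_box x \/ a = up_box x.
Proof.
case: x a => [x y] [x' y'] ys /and3P[xs xl xb] /and3P[+ al ab].
rewrite /linked /left_mem /below_mem /content /right_box /up_box /= in xl xb al ab *.
rewrite inE negb_or xpair_eqE => /andP[ne as_] l.
have [h|h] := leqP x x'; last first.
  have x0 : (0 < x)%N by clear -h; lia.
  rewrite x0 /= in xl; have := @young_down s _ _ x' y' ys xl.
  by rewrite (negbTE as_); clear - h l; lia.
have [h'|h'] := leqP y y'; last first.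
  have y0 : (0 < y)%N by clear -h'; lia.
  rewrite y0 /= in xb; have := @young_down s _ _ x' y' ys xb.
  by rewrite (negbTE as_); clear - h' l; lia.
have [e|ne1] := eqVneq x' x; first by right; congr pair; clear - e h' l; lia.
have [e|ne2] := eqVneq y' y; first by left; congr pair; clear - e h l; lia.
have x0 : (0 < x')%N by clear -ne1 h; lia.
move: al; rewrite x0 inE xpair_eqE /= (negbTE ne2) andbF /= => al.
have := @young_down s _ _ x y ys al; rewrite (negbTE xs); clear -h h' ne1 ne2; lia.
Qed.

Lemma jdt_path_le (t : tableau) j k b b' : (j <= k)%N ->
  jdt_path t j = Some b -> jdt_path t k = Some b' -> le_entry (t b) (t b').
Proof.
move=> /subnK <-; elim: (k - j)%N b' => [|d IH] b' /=.
  by move=> -> [->]; exact: le_entry_refl.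
move=> jb; case e : (jdt_path t (d + j)) => [c|//] /= /jdt_next_neighbour nb.
apply: le_entry_trans (IH _ jb e) _.
by case: nb => ->; [exact: entry_right|exact: entry_up].
Qed.

Lemma slide_rcons x v a : slide x (rcons v a) = rcons (slide x v) (slide_step (carry x v) a).1.
Proof. by elim: v x => //= b v IH x; rewrite IH. Qed.

Lemma carry_rcons x v a : carry x (rcons v a) = (slide_step (carry x v) a).2.
Proof. by elim: v x => //= b v IH x; rewrite IH. Qed.

(** Boxes outside [w] have entries at least [(size w).+1], a value attained only at [a]; so [a], if
    it is a neighbour of [c], wins the comparison. *)
Lemma jdt_next_corner t w c a : cylinder (rcons w a) t -> corner w c ->
  (jdt_next t c == Some a) = ((a == right_box c) || (a == up_box c)).
Proof.
move=> /cylinder_rcons[tw ta] /and3P[cw rw uw].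
have gt b b' : b \notin w -> t b' = Some (size w).+1 -> le_entry (t b') (t b) /\ (le_entry (t b) (t b') -> b = b').
  move=> + tb'; rewrite (mem_cylinder _ tw) tb'; case tb : (t b) => [k|//] /=.
  rewrite -ltnNge => wk; split=> // kw; apply: entry_inj tb _; rewrite tb'; congr Some.
  by apply/eqP; rewrite eqn_leq wk kw.
apply/idP/idP => [/eqP/jdt_next_neighbour[->|->]|]; rewrite ?eqxx ?orbT //.
have ru : right_box c != up_box c by case: c {cw rw uw} => x y; rewrite xpair_eqE /=; lia.
rewrite /jdt_next => /orP[]/eqP ac; rewrite -?ac ta.
  by have [h _] := gt _ _ uw ta; rewrite ta in h; rewrite h andFb eqxx.
rewrite andbF; case: ifP => // le; have [_] := gt _ _ rw ta.
by rewrite ta => /(_ le) e; rewrite -ac -e eqxx in ru.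
Qed.

(** Identifies the word transducer with the slide of tableaux. The induction on the last letter also
    keeps the carried box on the path of [t]; it is always a corner of the shape read so far. *)
Lemma jdt_cylinder w t : cylinder w t -> cylinder (jdt_word w) (jdt t).
Proof.
case: w => // x v tw; suff : cylinder (slide x v) (jdt t) /\ on_path t (carry x v) by case.
elim/last_ind: v tw => [|v a IH].
  move=> tw; split=> //; exists 0%N => /=.
  by have /= /andP[/and3P[_]] := cylinder_walk tw; case: x {tw} => [[|?] [|?]].
rewrite -rcons_cons => tw; have /cylinder_rcons[tv ta] := tw.
have [jv [k pk]] := IH tv.
have wv := walk_slide (isT : young [::]) (cylinder_walk tv).
have cc : corner (x :: v) (carry x v).
  rewrite -(eq_corner _ (@mem_slide x v)); exact: rcons_walk_corner.
have mc : carry x v \in x :: v by case/and3P: cc.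
have nx := jdt_next_corner tw cc.
rewrite slide_rcons carry_rcons /slide_step.
move: wv; rewrite walk_rcons => /andP[ws ac].
have aa : addable (carry x v :: slide x v) a.
  move: (cylinder_walk tw); rewrite walk_rcons => /andP[_].
  by rewrite -(eq_addable _ (@mem_slide x v)) (@eq_addable _ (carry x v :: slide x v)) // => b; rewrite mem_rcons.
have [l|nl] := boolP (linked _ _) => /=.
  have na : jdt_next t (carry x v) = Some a.
    apply/eqP; rewrite nx; have [->|->] := linked_adjacent (walk0_young ws) ac aa l; rewrite eqxx ?orbT //.
  split; last by exists k.+1; rewrite /= pk.
  apply/cylinder_rcons; split=> //; rewrite /= /jdt_entries asboolT; last by exists k.
  by rewrite na /= ta size_slide.
split; last by exists k.
apply/cylinder_rcons; split=> //; rewrite /= /jdt_entries asboolF; first by rewrite ta size_slide.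
(* The box [a] is not on the path, since entries increase along it: up to the carried box they are
   at most the size of [x :: v], and the successor [b] of that box lies outside [x :: v] and differs
   from [a], so its entry already exceeds that of [a]. *)
move=> [j pj]; have [jk|kj] := leqP j k.
  have := jdt_path_le jk pj pk; rewrite ta; move: mc; rewrite (mem_cylinder _ tv).
  case: (t (carry x v)) => [m|//] /= m1 m2; have := leq_trans m2 m1; rewrite ltnn //.
case e : (jdt_next t (carry x v)) => [b|]; last first.
  have : jdt_path t k.+1 = None by rewrite /= pk /= e.
  move: kj => /subnK; move: (j - k.+1)%N => d dj; rewrite -dj in pj; move=> pN.
  suff : jdt_path t (d + k.+1) = None by rewrite pj.
  by elim: d {dj pj} => //= d ->.
have pb : jdt_path t k.+1 = Some b by rewrite /= pk /= e.
have := jdt_path_le kj pb pj; rewrite ta.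
have ba : b <> a.
  move=> ba; rewrite ba in e; move: nl; rewrite /linked.
  have := jdt_next_neighbour e; case: (carry x v) => x0 y0 /= [] -> /=; rewrite /content /=; lia.
have : b \notin x :: v.
  by case/and3P: cc => _ r u; have [->|->] := jdt_next_neighbour e.
rewrite (mem_cylinder _ tv); case tb : (t b) => [m|//] /=; rewrite -ltnNge => m1 m2.
apply: ba; apply: entry_inj tb _; rewrite ta; congr Some; apply/eqP.
by rewrite eqn_leq m1 m2.
Qed.

(** * The Young graph *)

Definition part (n : nat) (la : intpart n) (i : nat) : nat := nth 0%N (parts la) i.

Lemma size_parts n (la : intpart n) : size (parts la) = n.
Proof. by rewrite size_map size_tuple. Qed.

Lemma part_ge n (la : intpart n) i : (n <= i)%N -> part la i = 0%N.
Proof. by move=> ni; rewrite /part nth_default // size_parts. Qed.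

Lemma part_mono n (la : intpart n) i j : (i <= j)%N -> (part la j <= part la i)%N.
Proof.
move=> ij; have [nj|jn] := leqP n j; first by rewrite part_ge.
have /andP[s _] := valP la; rewrite /part.
have tr : transitive geq by move=> a b c h1 h2; exact: leq_trans h2 h1.
by apply: (sorted_leq_nth tr leqnn 0%N s) => //; rewrite inE size_parts // (leq_ltn_trans ij).
Qed.

Lemma sum_part n (la : intpart n) : (\sum_(i < n) part la i = n)%N.
Proof.
have /andP[_ /eqP] := valP la; rewrite -/(parts la) sumnE (big_nth 0%N) size_parts.
by rewrite big_mkord.
Qed.

Lemma part_inj n (la mu : intpart n) : part la =1 part mu -> la = mu.
Proof.
move=> e; apply: val_inj; apply: val_inj; apply: (inj_map val_inj).
by apply: (@eq_from_nth _ 0%N) => [|i _]; [rewrite !size_parts|exact: e].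
Qed.

Lemma intpart_exists n (g : nat -> nat) : (forall i, (g i.+1 <= g i)%N) ->
  (forall i, (n <= i)%N -> g i = 0%N) -> (\sum_(i < n) g i = n)%N ->
  exists la : intpart n, part la =1 g.
Proof.
move=> gm g0 gs; pose s := [tuple inord (g i) : 'I_n.+1 | i < n].
have gn i : (g i < n.+1)%N.
  have [ni|ni] := leqP n i; first by rewrite g0.
  by rewrite ltnS -[X in (_ <= X)%N]gs (bigD1 (Ordinal ni)) //= leq_addr.
have sE : map val s = [seq g i | i <- iota 0 n].
  rewrite /= -val_enum_ord -!map_comp; apply: eq_map => i /=.
  by rewrite inordK.
have P : sorted geq (map val s) && (sumn (map val s) == n).
  rewrite sE; apply/andP; split; last first.
    by rewrite sumnE big_map -{1}[n]subn0 -/(index_iota 0 n) big_mkord gs.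
  rewrite (@homo_sorted _ _ g leq geq) ?iota_sorted // => i j /subnK <-.
  by elim: (j - i)%N => [|d IH]; [exact: leqnn|exact: leq_trans (gm _) IH].
exists (exist _ s P) => i; rewrite /part /parts [map _ _]sE.
have [ni|ni] := leqP n i; first by rewrite nth_default ?g0 // size_map size_iota.
by rewrite (nth_map 0%N) ?size_iota // nth_iota.
Qed.

Lemma boxesE n (la : intpart n) b : boxes la b <-> (b.1 < part la b.2)%N.
Proof. by []. Qed.

Lemma boxes_inj n (la mu : intpart n) : boxes la = boxes mu -> la = mu.
Proof.
move=> e; apply: part_inj => i.
apply/eqP; rewrite eqn_leq; apply/andP; split; rewrite leqNgt; apply/negP => lt.
- have : boxes mu (part mu i, i) by rewrite -e boxesE.
  by rewrite boxesE ltnn.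
- have : boxes la (part la i, i) by rewrite e boxesE.
  by rewrite boxesE ltnn.
Qed.

Definition covers n (la : intpart n) (mu : intpart n.+1) : bool := `[< add_box la mu >].

Lemma coversP n (la : intpart n) (mu : intpart n.+1) :
  reflect (exists i, forall j, part mu j = (part la j + (j == i))%N) (covers la mu).
Proof.
apply: (iffP (asboolP _)) => [[[x y] nb bE]|[i h]].
  have bE' c : (c.1 < part mu c.2)%N <-> c = (x, y) \/ (c.1 < part la c.2)%N.
    by rewrite -!boxesE bE.
  have xy : part la y = x.
    apply/eqP; rewrite eqn_leq; apply/andP; split; rewrite leqNgt; apply/negP => h.
      by apply: nb; rewrite boxesE.
    have : (x < part mu y)%N by apply/(bE' (x, y)); left.
    move=> /(ltn_trans h)/(bE' (part la y, y)) [[e]|/=]; last by rewrite ltnn.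
    by rewrite e ltnn in h.
  exists y => j; apply/eqP; rewrite eqn_leq; apply/andP; split; rewrite leqNgt; apply/negP => h.
    have [[e1 e2]|/=] := (bE' ((part la j + (j == y))%N, j)).1 h.
      by move: e1; rewrite e2 eqxx xy => /eqP; rewrite addn1; lia.
    by lia.
  have [e|ne] := eqVneq j y.
    rewrite e eqxx in h; have : (x < part mu y)%N by apply/(bE' (x, y)); left.
    by move: h; rewrite xy; lia.
  move: h; rewrite (negbTE ne) addn0 => h.
  by have := (bE' (part mu j, j)).2 (or_intror h); rewrite /= ltnn.
exists (part la i, i); first by rewrite boxesE /= ltnn.
apply/seteqP; split=> -[x y]; rewrite boxesE /= h.
  have [->|ne] := eqVneq y i; last by rewrite addn0; right.
  by rewrite addn1 ltnS leq_eqVlt => /predU1P[->|]; [left|right].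
move=> [[-> ->]|]; first by rewrite eqxx addn1.
by rewrite boxesE /= => /leq_trans; apply; exact: leq_addr.
Qed.

(** The number of standard Young tableaux of the given shape, usually written f^la. *)
Fixpoint npaths (n : nat) : intpart n -> nat :=
  if n is n'.+1 then fun mu => \sum_(la : intpart n' | covers la mu) npaths la
  else fun=> 1%N.

Arguments npaths : simpl never.

Lemma npathsS n (mu : intpart n.+1) :
  npaths mu = (\sum_(la : intpart n | covers la mu) npaths la)%N.
Proof. by []. Qed.

Lemma npaths0 (la : intpart 0) : npaths la = 1%N.
Proof. by []. Qed.

(** [ka] arises from [la] by moving one box from row [j] to row [i]. Having a common cover and
    covering a common diagram both reduce to this. *)
Definition apart n (la ka : intpart n) : Prop :=
  exists i j, i <> j /\ forall k, (part la k + (k == i) = part ka k + (k == j))%N.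

Lemma sum_part_ge n (la : intpart n) m : (n <= m)%N -> (\sum_(i < m) part la i = n)%N.
Proof.
move=> nm; rewrite -[RHS](sum_part la) -!(big_mkord xpredT (part la)).
rewrite (big_cat_nat _ nm) //= [X in (_ + X)%N]big1_seq ?addn0 // => i.
by rewrite mem_index_iota /= => /andP[ni _]; rewrite part_ge.
Qed.

Lemma sum_eq1 n i : (i < n)%N -> (\sum_(j < n) (nat_of_ord j == i) = 1)%N.
Proof.
move=> ni; rewrite (bigD1 (Ordinal ni)) //= eqxx big1 ?addn0 // => j.
by rewrite -val_eqE /= => /negbTE ->.
Qed.

Lemma covers_exists n (la : intpart n) (g : nat -> nat) (i : nat) :
  (forall j, (g j.+1 <= g j)%N) -> (forall j, g j = part la j + (j == i))%N ->
  exists2 mu : intpart n.+1, covers la mu & part mu =1 g.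
Proof.
move=> gm gE.
have ni : (i <= n)%N.
  rewrite leqNgt; apply/negP; case: i gE => // i gE ni.
  have ii : (i == i.+1) = false by lia.
  by have := gm i; rewrite !gE eqxx ii !part_ge // ltnW.
have [||mu muE] := @intpart_exists n.+1 g gm.
- by move=> j nj; rewrite gE part_ge ?(ltnW nj) // (gtn_eqF (leq_ltn_trans ni nj)).
- under eq_bigr do rewrite gE.
  by rewrite big_split /= sum_part_ge // sum_eq1 ?addn1.
by exists mu => //; apply/coversP; exists i => j; rewrite muE.
Qed.

Lemma covers_exists_low n (mu : intpart n.+1) (g : nat -> nat) (i : nat) :
  (forall j, (g j.+1 <= g j)%N) -> (forall j, part mu j = g j + (j == i))%N ->
  exists2 la : intpart n, covers la mu & part la =1 g.
Proof.
move=> gm gE.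
have ni : (i <= n)%N.
  rewrite leqNgt; apply/negP => ni.
  by have := gE i; rewrite eqxx part_ge //; lia.
have gs : (\sum_(j < n.+1) g j = n)%N.
  have := sum_part mu; under eq_bigr do rewrite gE.
  by rewrite big_split /= sum_eq1 // addn1 => -[].
have gn j : (n <= j)%N -> g j = 0%N.
  move=> nj; have le : (g j <= g n)%N.
    move: nj => /subnK <-; elim: (j - n)%N => // d; exact: leq_trans (gm _).
  suff : g n = 0%N by lia.
  apply/eqP; rewrite -leqn0 leqNgt; apply/negP => g0.
  (* A nonzero [g n] would make all [n.+1] rows nonempty, too many for [n] boxes. *)
  suff : (n.+1 <= \sum_(j < n.+1) g j)%N by rewrite gs ltnn.
  rewrite -[X in (X <= _)%N]card_ord -sum1_card; apply: leq_sum => k _.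
  apply: leq_trans g0 _; have := ltn_ord k; rewrite ltnS => /subnK e.
  by rewrite -{1}e; elim: (n - k)%N => // d; exact: leq_trans (gm _).
have [|la laE] := @intpart_exists n g gm gn.
  by move: gs; rewrite big_ord_recr /= gn // addn0.
by exists la => //; apply/coversP; exists i => j; rewrite laE.
Qed.

Lemma part_mono1 n (la : intpart n) i : (part la i.+1 <= part la i)%N.
Proof. exact: part_mono. Qed.

(** A box fits in row 0 always, and in row [i.+1] exactly when row [i] is strictly longer; row 0 is
    the extra unit. The strict descents counted here are also the removable rows of
    [card_covers_down]. *)
Lemma card_covers_up n (la : intpart n) :
  #|[pred mu | covers la mu]| = #|[pred i : 'I_n | (part la i.+1 < part la i)%N]|.+1.
Proof.
pose P (i : 'I_n.+1) := (i == 0%N :> nat) || (part la i < part la i.-1)%N.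
have up (i : 'I_n.+1) : P i -> exists2 mu : intpart n.+1, covers la mu &
    forall j, part mu j = (part la j + (j == i))%N.
  move=> Pi; have [|//|mu cm muE] := @covers_exists n la (fun j => part la j + (j == i))%N i.
    move=> j; have := part_mono1 la j; move: Pi => /orP[/eqP->|].
      by rewrite addn0 => /leq_trans; apply; exact: leq_addr.
    have [ji|_] := eqVneq j.+1 i; first by rewrite -ji /= => lt _; rewrite addn1 ltn_addr.
    by rewrite addn0 => _ /leq_trans; apply; exact: leq_addr.
  by exists mu.
have /choice[f fP] : forall i : 'I_n.+1, exists mu : option (intpart n.+1),
    P i -> if mu is Some r then forall j, part r j = (part la j + (j == i))%N else False.
  move=> i; have [Pi|_] := boolP (P i); last by exists None.
  by have [r _ h] := up i Pi; exists (Some r).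
have finj : {in P &, injective f}.
  move=> i j Pi Pj fij; apply: val_inj; apply/eqP => /=.
  have := fP i Pi; have := fP j Pj; rewrite fij; case: (f j) => // r hj hi.
  by have := hi i; rewrite hj eqxx; case: eqP => //; lia.
have -> : #|[pred mu | covers la mu]| = #|P|.
  rewrite -(card_in_imset finj) -(@card_imset _ _ Some [pred mu | covers la mu] (@Some_inj _)).
  apply: eq_card => o.
  apply/imsetP/imsetP => [[mu cm ->]|[i Pi ->]]; last first.
    have := fP _ Pi; case: (f i) => // r hr; exists r => //.
    by apply/coversP; exists (i : nat).
  have /coversP[i muE] : covers la mu by exact: cm.
  have ni : (i < n.+1)%N.
    rewrite ltnNge; apply/negP => ni.
    by have := muE i; rewrite (part_ge mu) // eqxx; lia.
  have Pi : P (Ordinal ni).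
    rewrite /P /=; case: i muE {ni} => // i muE.
    have := part_mono1 mu i; rewrite !muE eqxx /=.
    have -> : (i == i.+1) = false by lia.
    by rewrite addn0 addn1.
  exists (Ordinal ni) => //; have := fP _ Pi; case: (f _) => // r hr; congr Some.
  by apply: part_inj => j; rewrite hr muE.
rewrite -!sum1_card big_mkcond [in RHS]big_mkcond big_ord_recl; congr (_ + _)%N.
Qed.

Lemma card_covers_down n (la : intpart n.+1) :
  #|[pred rho | covers rho la]| = #|[pred i : 'I_n.+1 | (part la i.+1 < part la i)%N]|.
Proof.
pose P := [pred i : 'I_n.+1 | (part la i.+1 < part la i)%N].
have low (i : 'I_n.+1) : P i -> exists2 rho : intpart n, covers rho la &
    forall j, part la j = (part rho j + (j == i))%N.
  rewrite /= => Pi; pose g j := (part la j - (j == i))%N.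
  have gE j : part la j = (g j + (j == i))%N.
    by rewrite /g; have [->|] := eqVneq j i; [move: Pi; lia|lia].
  have [|//|rho cr rhoE] := @covers_exists_low n la g i.
    move=> j; have := part_mono1 la j; rewrite /g.
    have [->|_] := eqVneq (j : nat) i; first by move: Pi => /=; case: eqP; lia.
    by lia.
  by exists rho => // j; rewrite rhoE.
have /choice[f fP] : forall i : 'I_n.+1, exists rho : option (intpart n),
    P i -> if rho is Some r then forall j, part la j = (part r j + (j == i))%N else False.
  move=> i; have [Pi|_] := boolP (P i); last by exists None.
  by have [r _ h] := low i Pi; exists (Some r).
have finj : {in P &, injective f}.
  move=> i j Pi Pj fij; apply: val_inj; apply/eqP => /=.
  have := fP i Pi; have := fP j Pj; rewrite fij; case: (f j) => // r hj hi.
  by have := hi i; rewrite hj eqxx; case: eqP => //; lia.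
rewrite -(card_in_imset finj) -(@card_imset _ _ Some [pred rho | covers rho la] (@Some_inj _)).
apply: eq_card => o.
apply/imsetP/imsetP => [[rho cr ->]|[i Pi ->]].
  have /coversP[i h] : covers rho la by exact: cr.
  have ni : (i < n.+1)%N.
    by rewrite ltnNge; apply/negP => ni; have := h i; rewrite part_ge // eqxx; lia.
  have Pi : P (Ordinal ni).
    rewrite /= !h eqxx; have := part_mono1 rho i.
    have -> : (i.+1 == i) = false by lia.
    by lia.
  exists (Ordinal ni) => //; have := fP _ Pi; case: (f _) => // r hr; congr Some.
  by apply: part_inj => j; have := hr j; rewrite h /=; lia.
have := fP _ Pi; case: (f i) => // r hr; exists r => //.
by apply/coversP; exists (i : nat).
Qed.

(** A common cover is the union of the two diagrams, that is the maximum row by row. *)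
Lemma covers2_exists n (la ka : intpart n) : reflect (apart la ka)
  ((la != ka) && [exists mu, covers la mu && covers ka mu]).
Proof.
apply: (iffP andP) => [[ne /existsP[mu /andP[/coversP[i hi] /coversP[j hj]]]]|[i [j [ij h]]]].
  exists i, j; split; last by move=> k; rewrite -hi hj.
  move=> ij; case/eqP: ne; apply: part_inj => k; have := hi k; rewrite hj ij; lia.
split.
  by apply/eqP => e; have := h i; rewrite e eqxx; case: eqP => //; lia.
have [|k|mu cmu muE] := @covers_exists n la (fun k => maxn (part la k) (part ka k)) i.
- move=> k; rewrite geq_max !leq_max !part_mono1 orbT //.
- by have := h k; case: eqP => [->|]; case: eqP => //=; lia.
apply/existsP; exists mu; rewrite cmu; apply/coversP; exists j => k; rewrite muE.
by have := h k; case: eqP => [->|]; case: eqP => //=; lia.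
Qed.

(** Dually, the intersection of the diagrams, the minimum row by row. *)
Lemma covers2_exists_low n (la ka : intpart n.+1) : reflect (apart la ka)
  ((la != ka) && [exists rho, covers rho la && covers rho ka]).
Proof.
apply: (iffP andP) => [[ne /existsP[rho /andP[/coversP[i hi] /coversP[j hj]]]]|[i [j [ij h]]]].
  exists j, i; split; last by move=> k; rewrite hi hj; lia.
  move=> ij; case/eqP: ne; apply: part_inj => k; rewrite hi hj ij; lia.
split.
  by apply/eqP => e; have := h i; rewrite e eqxx; case: eqP => //; lia.
have [|k|rho cmu muE] := @covers_exists_low n la (fun k => minn (part la k) (part ka k)) j.
- move=> k; rewrite leq_min !geq_min !part_mono1 orbT //.
- by have := h k; case: eqP => [->|]; case: eqP => //=; lia.
apply/existsP; exists rho; rewrite cmu; apply/coversP; exists i => k; rewrite muE.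
by have := h k; case: eqP => [->|]; case: eqP => //=; lia.
Qed.

Lemma card_unique (T : finType) (P : pred T) :
  (forall x y, P x -> P y -> x = y) -> #|P| = [exists x, P x].
Proof.
move=> u; case: existsP => [[x Px]|nP].
  by rewrite /= (@fintype.eq_card1 _ x) // => y; apply/idP/eqP => [Py|->]; [exact: u|exact: Px].
by rewrite /= fintype.eq_card0 // => x /=; apply/negbTE/negP => Px; apply: nP; exists x.
Qed.

(** The relation DU = UD + 1 entry by entry. Off the diagonal both counts are at most 1 and both are
    1 exactly when [apart]; on it, addable rows outnumber removable ones by one. *)
Lemma card_covers2 n (la ka : intpart n.+1) :
  #|[pred mu | covers la mu && covers ka mu]| =
  (#|[pred rho | covers rho la && covers rho ka]| + (la == ka))%N.
Proof.
have [<-|ne] := eqVneq la ka.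
  rewrite addn1 (eq_card (B := [pred mu | covers la mu])); last by move=> mu; rewrite !inE andbb.
  rewrite [in RHS](eq_card (B := [pred rho | covers rho la])); last by move=> mu; rewrite !inE andbb.
  by rewrite card_covers_up card_covers_down.
rewrite addn0 !card_unique /=.
- congr nat_of_bool; have := covers2_exists la ka; have := covers2_exists_low la ka.
  by rewrite ne /= => h1 h2; apply/h2/h1.
- move=> mu mu' /andP[/coversP[i hi] /coversP[j hj]] /andP[/coversP[i' hi'] /coversP[j' hj']].
  have ij : i <> j.
    by move=> ij; case/eqP: ne; apply: part_inj => k; rewrite hi hj ij.
  have ij' : i' <> j'.
    by move=> e; case/eqP: ne; apply: part_inj => k; rewrite hi' hj' e.
  have ii : i = i'.
    have := hi i; have := hj i; have := hi' i; have := hj' i; rewrite eqxx.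
    by case: (i =P j) => // _; case: (i =P i') => // _; case: (i =P j') => /=; lia.
  by apply: part_inj => k; have := hi k; rewrite hi' ii; lia.
- move=> mu mu' /andP[/coversP[i hi] /coversP[j hj]] /andP[/coversP[i' hi'] /coversP[j' hj']].
  have ij : i <> j.
    by move=> ij; case/eqP: ne; apply: part_inj => k; have := hi k; rewrite hj ij; lia.
  have ij' : i' <> j'.
    by move=> e; case/eqP: ne; apply: part_inj => k; have := hi' k; rewrite hj' e; lia.
  have E (x y : nat) z w : x <> y -> (forall k, (part la k + (k == x) = part ka k + (k == y))%N) -> 
    z <> w -> (forall k, (part la k + (k == z) = part ka k + (k == w))%N) -> x = z.
    move=> xy h zw h'; have := h x; have := h' x; rewrite eqxx.
    by case: (x =P y) => // _; case: (x =P z) => // _; case: (x =P w) => /=; lia.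
  have ii : i = i'.
    by apply: (E _ j _ j') => // k; [rewrite -hi hj|rewrite -hi' hj'].
  by apply: part_inj => k; rewrite hi hi' ii.
Qed.

Lemma intpart0 (la ka : intpart 0) : la = ka.
Proof. by apply: part_inj => i; rewrite !part_ge. Qed.

(* The commutation relation DU = UD + 1 of the Young graph. *)
Lemma sum_npaths_up n (la : intpart n) :
  (\sum_(mu | covers la mu) npaths mu = n.+1 * npaths la)%N.
Proof.
have E m (ka : intpart m) : (\sum_(mu | covers ka mu) npaths mu =
    \sum_(nu : intpart m) npaths nu * #|[pred mu | covers ka mu && covers nu mu]|)%N.
  under eq_bigr do rewrite npathsS.
  rewrite (exchange_big_dep xpredT) //=; apply: eq_bigr => nu _.
  by rewrite sum_nat_const mulnC.
elim: n la => [|n IH] la.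
  rewrite E (big_pred1 la) => [|ka]; last by apply/esym/eqP; exact: intpart0.
  rewrite (eq_card (B := [pred mu | covers la mu])); last by move=> mu; rewrite !inE andbb.
  by rewrite card_covers_up fintype.eq_card0 ?muln1 ?mul1n //; case.
rewrite E; under eq_bigr do rewrite card_covers2 mulnDr.
rewrite big_split /= [X in (_ + X)%N](bigD1 la) //= eqxx muln1.
rewrite [X in (_ + (_ + X))%N]big1 ?addn0 => [|ka /negbTE]; last by rewrite eq_sym => ->; rewrite muln0.
have -> : (\sum_nu npaths nu * #|[pred rho | covers rho la && covers rho nu]| =
    \sum_(rho : intpart n | covers rho la) \sum_(nu | covers rho nu) npaths nu)%N.
  rewrite (exchange_big_dep xpredT) //=; apply: eq_bigr => nu _.
  by rewrite sum_nat_const mulnC.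
under eq_bigr do rewrite IH.
by rewrite -big_distrr /= -npathsS [RHS]mulSn addnC.
Qed.

(** One factor is expanded over the lower neighbours; resummed over the covers, the other one yields
    [n.+1 * npaths la]. *)
Lemma sum_npaths_sqr n : (\sum_(la : intpart n) npaths la ^ 2 = n`!)%N.
Proof.
elim: n => [|n IH].
  have [la _] := @intpart_exists 0 (fun=> 0%N) (fun=> isT) (fun _ _ => erefl) (big_ord0 _ _ _ _).
  by rewrite (big_pred1 la) // => ka; apply/esym/eqP; exact: intpart0.
under eq_bigr do rewrite -mulnn {1}npathsS big_distrl /=.
rewrite (exchange_big_dep xpredT) //= factS -IH big_distrr /=.
by apply: eq_bigr => la _; rewrite -big_distrr /= sum_npaths_up mulnCA mulnn.
Qed.

(** * Words that fill a partition *)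

Definition fills n (la : intpart n) (w : seq box) : Prop :=
  forall b, (b \in w) = (b.1 < part la b.2)%N.

Lemma fills_boxes n (la : intpart n) w : fills la w <-> boxes la = [set b | b \in w].
Proof.
split=> [h|h b]; first by apply/seteqP; split=> b; rewrite boxesE /= h.
apply/idP/idP => [bw|bla].
  by have : boxes la b by rewrite h.
by have : [set b | b \in w] b by rewrite -h.
Qed.

Lemma fills_inj n (la mu : intpart n) w : fills la w -> fills mu w -> la = mu.
Proof. by move=> /fills_boxes h /fills_boxes h'; apply: boxes_inj; rewrite h. Qed.

Lemma addable_part n (la : intpart n) w b : fills la w -> addable w b ->
  b.1 = part la b.2 /\ ((0 < b.2)%N -> (b.1 < part la b.2.-1)%N).
Proof.
case: b => x y h /and3P[]; rewrite /left_mem /below_mem !h /= -leqNgt => xy xl xb.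
split; last by move/(implyP xb).
by case: x xy xl {xb} => [|x] /= xy xl; apply/eqP; rewrite eqn_leq xy ?leq0n ?xl.
Qed.

Lemma fills_rcons n (la : intpart n) w b : fills la w -> addable w b ->
  exists2 mu : intpart n.+1, covers la mu & fills mu (rcons w b).
Proof.
case: b => x y h ab; have [/= xE yP] := addable_part h ab.
have [|//|mu cm muE] := @covers_exists n la (fun j => part la j + (j == y))%N y.
  move=> j; have [jy|_] := eqVneq j.+1 y.
    have := yP; rewrite -jy /= xE -jy => /(_ isT); move: (part _ _) => a lt; lia.
  by rewrite addn0 (leq_trans (part_mono1 la j)) // leq_addr.
exists mu => // -[x' y']; rewrite mem_rcons inE h muE xpair_eqE /= xE.
have [->|ne] := eqVneq y' y; last by rewrite andbF addn0.
by rewrite andbT addn1 ltnS -leq_eqVlt.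
Qed.

Lemma fills_covers n (la : intpart n) (mu : intpart n.+1) w : fills la w -> covers la mu ->
  exists2 b, addable w b & fills mu (rcons w b).
Proof.
move=> h /coversP[i muE]; exists (part la i, i).
  rewrite /addable /left_mem /below_mem !h /= ltnn /=; apply/andP; split; apply/implyP.
    by case: (part la i).
  case: i muE => // i muE _ /=; have := part_mono1 mu i; rewrite !muE eqxx.
  have -> : (i == i.+1) = false by lia.
  by rewrite addn0 addn1.
move=> [x y]; rewrite mem_rcons inE h muE xpair_eqE /=.
have [->|ne] := eqVneq y i; last by rewrite andbF addn0.
by rewrite andbT addn1 ltnS -leq_eqVlt.
Qed.

Lemma walk_fills w : walk [::] w -> exists la : intpart (size w), fills la w.
Proof.
elim/last_ind: w => [_|w b IH].
  have [la laE] := @intpart_exists 0 (fun=> 0%N) (fun=> isT) (fun _ _ => erefl) (big_ord0 _ _ _ _).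
  by exists la => b; rewrite laE.
by rewrite walk_rcons size_rcons => /andP[/IH[la h] ab]; have [mu _] := fills_rcons h ab; exists mu.
Qed.

Lemma intpart_walk n (la : intpart n) : exists w, [/\ size w = n, walk [::] w & fills la w].
Proof.
pose s := [seq (x, y) | y <- iota 0 n, x <- iota 0 (part la y)].
have ms b : (b \in s) = (b.1 < part la b.2)%N.
  apply/allpairsPdep/idP => [[y [x [_ + ->]]]|]; first by rewrite mem_iota.
  case: b => x y /= lt; exists y, x; rewrite !mem_iota /= lt; split=> //.
  by rewrite ltnNge; apply/negP => ny; rewrite part_ge in lt.
have us : uniq s.
  apply: allpairs_uniq_dep; [exact: iota_uniq|by move=> y _; exact: iota_uniq|].
  by move=> [y x] [y' x'] _ _ /= [-> ->].
have ys : young s.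
  apply/allP => -[x y]; rewrite ms /= => lt; rewrite /left_mem /below_mem !ms /=.
  apply/andP; split; apply/implyP => _; first by rewrite (leq_ltn_trans _ lt) // leq_pred.
  by rewrite (leq_trans lt) // part_mono // leq_pred.
have [w ww pw] := young_walk us ys; exists w; split=> //; last by move=> b; rewrite (perm_mem pw) ms.
rewrite (perm_size pw) size_allpairs_dep -[RHS](sum_part la) sumnE big_map -{1}[n]subn0.
by rewrite -/(index_iota 0 n) big_mkord; apply: eq_bigr => i _; rewrite size_iota.
Qed.

Lemma box_of_inj n (la : intpart n) : injective (box_of la).
Proof.
move=> i j [cij fij]; apply: val_inj.
by rewrite /= -(reshape_indexK (parts la) i) -(reshape_indexK (parts la) j) fij cij.
Qed.

Lemma box_of_part n (la : intpart n) i : ((box_of la i).1 < part la (box_of la i).2)%N.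
Proof.
by apply: reshape_offsetP; have /andP[_ /eqP->] := valP la.
Qed.

(** [sym_Iirr] is defined through the row reading of the diagram, whereas the branching rule needs
    fillings that grow with the diagram. Conjugation by [g] carries the stabilizers of one to those
    of the other. *)
Lemma filling_perm n (la : intpart n) w : size w = n -> walk [::] w -> fills la w ->
  exists g : 'S_n, forall i, box_of la i = nth (0, 0)%N w (g i).
Proof.
move=> sw ww h; have mw i : box_of la i \in w by rewrite h box_of_part.
have /choice[g gP] : forall i, exists j : 'I_n, box_of la i = nth (0, 0)%N w j.
  move=> i; have jn : (index (box_of la i) w < n)%N by have := mw i; rewrite -index_mem sw.
  by exists (Ordinal jn); rewrite nth_index.
have gi : injective g by move=> i j e; apply: (@box_of_inj n la); rewrite !gP e.
by exists (perm gi) => i; rewrite permE.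
Qed.

(** * Branching rule for the symmetric groups *)

Lemma irr_mulC (gT : finGroupType) (G : {group gT}) (phi : 'CF(G)) x y :
  x \in G -> y \in G -> phi (x * y)%g = phi (y * x)%g.
Proof.
by move=> Gx Gy; rewrite -(cfunJ phi (x * y)%g Gx) conjgE !mulgA mulVg mul1g.
Qed.

Lemma sum_irr_mul (gT : finGroupType) (G : {group gT}) (i : Iirr G) (y : gT) :
  \sum_(x in G) 'chi_i (x * y)%g * 'chi_i x^-1%g = #|G|%:R * ('chi_i y / 'chi_i 1%g).
Proof.
have := generalized_orthogonality_relation y i i; rewrite eqxx mul1r => <-.
by rewrite mulrA divff ?mul1r // neq0CG.
Qed.

(* If [psi] does not occur in the pullback of [chi], then [chi * psi = 0]:
   the squared norm of this convolution is a multiple of the multiplicity. *)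
Lemma irr_convolution_eq0 (gT kT : finGroupType) (G : {group gT}) (K : {group kT})
    (f : kT -> gT) (i : Iirr G) (j : Iirr K) :
  {in K, forall k, f k \in G} -> {in K &, {morph f : x y / (x * y)%g}} ->
  \sum_(k in K) 'chi_i (f k) * 'chi_j k^-1%g = 0 ->
  {in G, forall g, \sum_(k in K) 'chi_i (g * f k)%g * 'chi_j k^-1%g = 0}.
Proof.
move=> fG fM f0; pose F g := \sum_(k in K) 'chi_i (g * f k)%g * 'chi_j k^-1%g.
have f1 : f 1%g = 1%g by apply: (mulgI (f 1%g)); rewrite mulg1 -fM ?group1 // mulg1.
have fV : {in K, forall k, f k^-1%g = (f k)^-1%g}.
  by move=> k Kk; apply: (mulgI (f k)); rewrite -fM ?groupV // !mulgV.
suff F0 : \sum_(g in G) `|F g| ^+ 2 = 0.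
  move=> g Gg; apply/eqP; rewrite -normr_eq0 -sqrf_eq0; apply/eqP.
  by apply: (psumr_eq0P _ F0) => // h _; rewrite exprn_ge0.
have -> : \sum_(g in G) `|F g| ^+ 2 = \sum_(k' in K) \sum_(k in K)
    ('chi_j k^-1%g * 'chi_j k') * \sum_(g in G) 'chi_i (g * f k)%g * 'chi_i (g * f k')^-1%g.
  rewrite (eq_bigr (fun g => \sum_(k' in K) \sum_(k in K)
    ('chi_j k^-1%g * 'chi_j k') * ('chi_i (g * f k)%g * 'chi_i (g * f k')^-1%g))).
    rewrite exchange_big; apply: eq_bigr => k' _; rewrite exchange_big.
    by apply: eq_bigr => k _; rewrite -mulr_sumr.
  move=> g _; rewrite normCK rmorph_sum mulr_sumr; apply: eq_bigr => k' _.
  rewrite mulr_suml; apply: eq_bigr => k _.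
  by rewrite rmorphM /= -!irr_inv invgK mulrACA mulrC.
have E k k' : k \in K -> k' \in K ->
    \sum_(g in G) 'chi_i (g * f k)%g * 'chi_i (g * f k')^-1%g =
    #|G|%:R * ('chi_i (f (k'^-1 * k)%g) / 'chi_i 1%g).
  move=> Kk Kk'; rewrite -sum_irr_mul (reindex_inj (mulIg (f k')^-1%g)) /=.
  apply: eq_big => [g|g Gg]; first by rewrite groupMr // groupV fG.
  by rewrite mulgKV fM ?groupV // fV // mulgA.
have -> : \sum_(k' in K) \sum_(k in K) ('chi_j k^-1%g * 'chi_j k') *
      \sum_(g in G) 'chi_i (g * f k)%g * 'chi_i (g * f k')^-1%g =
    \sum_(k in K) (#|G|%:R / 'chi_i 1%g * 'chi_i (f k)) *
      \sum_(x in K) 'chi_j (x * k^-1)%g * 'chi_j x^-1%g.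
  transitivity (\sum_(k' in K) \sum_(k in K) (#|G|%:R / 'chi_i 1%g * 'chi_i (f k)) *
      ('chi_j (k'^-1 * k^-1)%g * 'chi_j k')).
    apply: eq_bigr => k' Kk'; rewrite (reindex_inj (mulgI k')) /=.
    apply: eq_big => [k|k]; first by rewrite groupMl.
    rewrite groupMl // => Kk; rewrite E ?groupM // mulKg invMg irr_mulC ?groupV //.
    by rewrite mulrC !mulrA; congr (_ * _ * _); rewrite mulrAC.
  rewrite exchange_big; apply: eq_bigr => k Kk; rewrite -mulr_sumr; congr (_ * _).
  rewrite (reindex_inj invg_inj) /=; apply: eq_big => x; first by rewrite groupV.
  by move=> _; rewrite invgK.
under eq_bigr => k _ do rewrite sum_irr_mul.
transitivity (#|G|%:R / 'chi_i 1%g * (#|K|%:R / 'chi_j 1%g) *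
   \sum_(k in K) 'chi_i (f k) * 'chi_j k^-1%g); last by rewrite f0 mulr0.
by rewrite mulr_sumr; apply: eq_bigr => k _; rewrite [RHS]mulrACA; congr (_ * _); rewrite mulrA mulrAC.
Qed.

Lemma sum_fiber_stab_perm n (f f' : 'I_n -> nat) (g : 'S_n) (phi : 'S_n -> algC) :
  (forall s, phi (s ^ g)%g = phi s) -> (forall i, f i = f' (g i)) ->
  \sum_(s in fiber_stab f) phi s = \sum_(s in fiber_stab f') phi s.
Proof.
move=> phiJ ff'; rewrite [RHS](reindex_inj (conjg_inj g)) /=.
apply: eq_big => s; last by rewrite phiJ.
apply/fiber_stabP/fiber_stabP => h i.
  by rewrite -(permKV g i) /conjg !permM permK -!ff' h.
by have := h (g i); rewrite /conjg !permM permK -!ff'.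
Qed.

Definition rows n (w : seq box) : {group 'S_n} :=
  [group of fiber_stab (fun i : 'I_n => (nth (0, 0)%N w i).2)].

Definition cols n (w : seq box) : {group 'S_n} :=
  [group of fiber_stab (fun i : 'I_n => (nth (0, 0)%N w i).1)].

Definition filling n (la : intpart n) (w : seq box) : Prop :=
  [/\ size w = n, walk [::] w & fills la w].

Lemma irr_constt_Ind (gT : finGroupType) (G H : {group gT}) (phi : 'CF(H)) (i : Iirr G) :
  H \subset G -> (i \in irr_constt ('Ind[G] phi)) = (\sum_(x in H) phi x * 'chi_i x^-1%g != 0).
Proof.
move=> sHG; rewrite irr_consttE -Frobenius_reciprocity cfdotE mulf_eq0 negb_or.
rewrite invr_eq0 neq0CG /=; congr (_ != _); apply: eq_bigr => x Hx.
by rewrite cfResE // irr_inv.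
Qed.

Lemma sym_IirrE n (la : intpart n) w (i : Iirr (sym_group n)) : filling la w ->
  (i == sym_Iirr la) = (\sum_(s in rows n w) 'chi_i s != 0) &&
    (\sum_(s in cols n w) (-1) ^+ s * 'chi_i s != 0).
Proof.
move=> [sw ww lw]; have [g gP] := filling_perm sw ww lw.
rewrite -sym_Iirr_uniq !irr_constt_Ind ?finset.subsetT //.
have chiJ s : 'chi_i (s ^ g)%g = 'chi_i s by rewrite cfunJ // finset.in_setT.
congr (_ && _); congr (_ != _).
  rewrite (eq_bigr (fun s => 'chi_i s^-1%g)) => [|s Rs]; last by rewrite cfun1E Rs mul1r.
  rewrite (reindex_inj invg_inj) /= (eq_bigl (mem (row_group la))) => [|s]; last by rewrite groupV.
  under eq_bigr do rewrite invgK.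
  by apply: (sum_fiber_stab_perm chiJ) => j; rewrite gP.
rewrite (eq_bigr (fun s => (-1) ^+ odd_perm s^-1%g * 'chi_i s^-1%g)) => [|s Rs]; last first.
  by rewrite sign_cfunE Rs odd_permV.
rewrite (reindex_inj invg_inj) /= (eq_bigl (mem (col_group la))) => [|s]; last by rewrite groupV.
under eq_bigr do rewrite invgK.
apply: (@sum_fiber_stab_perm _ _ _ g (fun s => (-1) ^+ s * 'chi_i s)) => [s|j]; last by rewrite gP.
by rewrite chiJ odd_permJ.
Qed.

Lemma sign_cfun_irr n (H : {group 'S_n}) : exists j : Iirr H, sign_cfun H = 'chi_j.
Proof.
apply/irrP/lin_char_irr; rewrite qualifE /= sign_cfun_char sign_cfunE group1 odd_perm1.
by rewrite /= expr0 mulr1n eqxx.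
Qed.

(** Any other irreducible character is missing from one of the two induced characters, so the row
    symmetrizer or the column antisymmetrizer acts on its module by 0. *)
Lemma sym_Iirr_neq n (la : intpart n) w (i : Iirr (sym_group n)) : filling la w ->
  i != sym_Iirr la ->
  (forall g, \sum_(s in rows n w) 'chi_i (g * s)%g = 0) \/
  (forall g, \sum_(s in cols n w) (-1) ^+ s * 'chi_i (g * s)%g = 0).
Proof.
move=> fw; rewrite (sym_IirrE _ fw) negb_and !negbK => /orP[]/eqP s0; [left|right] => g.
  have := @irr_convolution_eq0 _ _ (sym_group n) (rows n w) id i 0.
  rewrite irr0 => H; rewrite (eq_bigr (fun s => 'chi_i (g * s)%g * (1 : 'CF(rows n w)) s^-1%g)).
    apply: H; rewrite ?finset.in_setT //; first by move=> ? _; rewrite finset.in_setT.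
    rewrite -[RHS]s0; apply: eq_bigr => s Rs.
    by rewrite cfun1E groupV Rs mulr1.
  by move=> s Rs; rewrite cfun1E groupV Rs mulr1.
have [j jE] := sign_cfun_irr (cols n w).
have := @irr_convolution_eq0 _ _ (sym_group n) (cols n w) id i j.
rewrite -jE => H; rewrite (eq_bigr (fun s => 'chi_i (g * s)%g * sign_cfun (cols n w) s^-1%g)).
  apply: H; rewrite ?finset.in_setT //; first by move=> ? _; rewrite finset.in_setT.
  rewrite -[RHS]s0; apply: eq_bigr => s Rs.
  by rewrite sign_cfunE groupV Rs odd_permV mulrC.
by move=> s Rs; rewrite sign_cfunE groupV Rs odd_permV mulrC.
Qed.

Lemma rows_cols1 n (la : intpart n) w r q : filling la w ->
  r \in rows n w -> q \in cols n w -> (r * q == 1)%g = (r == 1%g) && (q == 1%g).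
Proof.
move=> [sw ww lw] Rr Cq; apply/eqP/andP => [rq|[/eqP-> /eqP->]]; last by rewrite mulg1.
have E : r = q^-1%g by apply: (mulIg q); rewrite rq mulVg.
have Cr : r \in cols n w by rewrite E groupV.
have r1 : r = 1%g.
  apply/permP => i; rewrite perm1; apply: val_inj; apply/eqP.
  have /fiber_stabP/(_ i) /= h1 := Rr; have /fiber_stabP/(_ i) /= h2 := Cr.
  rewrite -(@nth_uniq _ (0, 0)%N w) ?sw ?walk0_uniq //.
  by rewrite [nth _ _ _]surjective_pairing h1 h2 -surjective_pairing.
by move: rq; rewrite r1 mul1g => ->; rewrite eqxx.
Qed.

(* The Young symmetrizer does not act by 0 on the irreducible module of [la]. *)
Lemma young_symmetrizer_neq0 n (la : intpart n) w : filling la w ->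
  \sum_(r in rows n w) \sum_(q in cols n w) (-1) ^+ q * sym_char la (r * q)%g != 0.
Proof.
move=> fw; set S := \sum_(r in _) _.
(* The symmetrizer is evaluated on the regular character in two ways: by [sym_Iirr_neq] only the
   constituent of [la] contributes, and as [r * q] is trivial only for [r = q = 1], the value is the
   group order. *)
suff : sym_char la 1%g * S = #|sym_group n|%:R.
  by move=> e; apply: contraNneq (neq0CG (sym_group n)) => S0; rewrite -e S0 mulr0.
transitivity (\sum_(i : Iirr (sym_group n)) 'chi_i 1%g *
   \sum_(r in rows n w) \sum_(q in cols n w) (-1) ^+ q * 'chi_i (r * q)%g).
  rewrite (bigD1 (sym_Iirr la)) //= [X in _ + X]big1 ?addr0 // => i /(sym_Iirr_neq fw)[] h.
    rewrite exchange_big /= big1 ?mulr0 // => q _; rewrite -mulr_sumr.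
    rewrite (eq_bigr (fun r => 'chi_i (q * r)%g)); first by rewrite h mulr0.
    by move=> r _; rewrite irr_mulC ?finset.in_setT.
  by rewrite big1 ?mulr0 // => r _; rewrite h.
transitivity (\sum_(r in rows n w) \sum_(q in cols n w)
   (-1) ^+ q * cfReg (sym_group n) (r * q)%g).
  rewrite (eq_bigr (fun i => \sum_(r in rows n w) \sum_(q in cols n w)
     (-1) ^+ q * ('chi_i 1%g * 'chi_i (r * q)%g))) => [|i _]; last first.
    rewrite mulr_sumr; apply: eq_bigr => r _; rewrite mulr_sumr; apply: eq_bigr => q _.
    by rewrite mulrCA.
  rewrite exchange_big; apply: eq_bigr => r _; rewrite exchange_big; apply: eq_bigr => q _.
  rewrite -mulr_sumr cfReg_sum sum_cfunE; congr (_ * _); apply: eq_bigr => i _.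
  by rewrite cfunE.
rewrite (bigD1 1%g) ?group1 //= (bigD1 1%g) ?group1 //= odd_perm1 mulg1 cfRegE eqxx mul1r.
rewrite big1 ?addr0 => [|q /andP[Cq q1]]; last first.
  by rewrite cfRegE (rows_cols1 fw) ?group1 // eqxx (negbTE q1) mulr0n mulr0.
rewrite big1 ?addr0 ?mulr1n // => r /andP[Rr r1]; rewrite big1 // => q Cq.
by rewrite cfRegE (rows_cols1 fw) // (negbTE r1) mulr0n mulr0.
Qed.

(** * Restriction to the stabilizer of the last point *)

Definition extend n (s : 'S_n) : 'S_n.+1 := lift_perm ord_max ord_max s.

Lemma extendM n : {morph @extend n : s t / (s * t)%g}.
Proof. by move=> s t; rewrite /extend lift_permM. Qed.

Lemma extend1 n : extend 1 = 1%g :> 'S_n.+1.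
Proof. exact: lift_perm1. Qed.

Lemma odd_extend n (s : 'S_n) : odd_perm (extend s) = odd_perm s.
Proof. by rewrite /extend odd_lift_perm addbb. Qed.

Lemma extend_max n (s : 'S_n) : extend s ord_max = ord_max.
Proof. exact: lift_perm_id. Qed.

Lemma extend_lift n (s : 'S_n) (i : 'I_n) : extend s (lift ord_max i) = lift ord_max (s i).
Proof. exact: lift_perm_lift. Qed.

Lemma val_lift_max n (i : 'I_n) : lift ord_max i = i :> nat.
Proof. by rewrite /= /bump leqNgt ltn_ord. Qed.

Lemma extend_fiber_stab n (f : nat -> nat) (s : 'S_n) :
  s \in fiber_stab (fun i : 'I_n => f i) -> extend s \in fiber_stab (fun i : 'I_n.+1 => f i).
Proof.
move=> /fiber_stabP fs; apply/fiber_stabP => i.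
have [j ->|->] := unliftP ord_max i; last by rewrite extend_max.
by rewrite extend_lift !val_lift_max fs.
Qed.

Lemma eq_fiber_stab n (f f' : 'I_n -> nat) : f =1 f' -> fiber_stab f = fiber_stab f'.
Proof. by move=> ff'; apply/finset.setP => s; apply/fiber_stabP/fiber_stabP => h i; have := h i; rewrite !ff'. Qed.

Lemma filling_rcons n (la : intpart n) (mu : intpart n.+1) w : filling la w -> covers la mu ->
  exists b, filling mu (rcons w b).
Proof.
move=> [sw ww lw] cm; have [b ab mb] := fills_covers lw cm; exists b; split=> //.
  by rewrite size_rcons sw.
by rewrite walk_rcons ww.
Qed.

Lemma extend_rows n w b (s : 'S_n) : size w = n -> s \in rows n w -> extend s \in rows n.+1 (rcons w b).
Proof.
move=> sw Rs; apply: (@extend_fiber_stab _ (fun i => (nth (0, 0)%N (rcons w b) i).2)).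
rewrite (_ : fiber_stab _ = rows n w) //; apply: eq_fiber_stab => i.
by rewrite nth_rcons sw ltn_ord.
Qed.

Lemma extend_cols n w b (s : 'S_n) : size w = n -> s \in cols n w -> extend s \in cols n.+1 (rcons w b).
Proof.
move=> sw Rs; apply: (@extend_fiber_stab _ (fun i => (nth (0, 0)%N (rcons w b) i).1)).
rewrite (_ : fiber_stab _ = cols n w) //; apply: eq_fiber_stab => i.
by rewrite nth_rcons sw ltn_ord.
Qed.

(* Otherwise the Young symmetrizer of [la], a factor of that of [mu], would act
   by 0 on every constituent of the restriction of [sym_char mu]. *)
Lemma sym_char_restr_neq0 n (la : intpart n) (mu : intpart n.+1) : covers la mu ->
  \sum_(s in sym_group n) sym_char mu (extend s) * sym_char la s^-1%g != 0.
Proof.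
move=> cm; have [w fw] := intpart_walk la; have [b fb] := filling_rcons fw cm.
apply: contraTneq isT => s0; have sw : size w = n by case: fw.
have conv := @irr_convolution_eq0 _ _ (sym_group n.+1) (sym_group n) (@extend n)
  (sym_Iirr mu) (sym_Iirr la) _ _ s0.
have {}conv g : \sum_(s : 'S_n) sym_char mu (g * extend s)%g * sym_char la s^-1%g = 0.
  rewrite -[RHS](conv _ _ g) ?finset.in_setT //; last 2 first.
  - by move=> s _; rewrite finset.in_setT.
  - by move=> s t _ _; exact: extendM.
  by apply: eq_bigl => s; rewrite finset.in_setT.
(* The symmetrizer of [la] acts by 0 on the restriction: [reg] expands the delta function at [x]
   over all irreducible characters, the term of [la] vanishes by [conv], the others by
   [sym_Iirr_neq]. *)
have Z g : \sum_(r in rows n w) \sum_(q in cols n w)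
    (-1) ^+ q * sym_char mu (g * extend (r * q))%g = 0.
  have reg (x : 'S_n) : sym_char mu (g * extend x)%g = #|sym_group n|%:R^-1 *
      \sum_(j : Iirr (sym_group n)) \sum_(s : 'S_n) 'chi_j 1%g *
        ('chi_j (s^-1 * x)%g * sym_char mu (g * extend s)%g).
    rewrite exchange_big /= (bigD1 x) //= [X in _ + X]big1 => [|s sx]; last first.
      transitivity (cfReg (sym_group n) (s^-1 * x)%g * sym_char mu (g * extend s)%g).
        rewrite cfReg_sum sum_cfunE mulr_suml; apply: eq_bigr => j _.
        by rewrite cfunE mulrA.
      rewrite cfRegE (_ : (s^-1 * x == 1)%g = false) ?mulr0n ?mul0r //.
      by apply/negbTE; apply: contra sx => /eqP h; rewrite -[x](mulKVg s) h mulg1.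
    rewrite addr0; transitivity (#|sym_group n|%:R^-1 *
        (cfReg (sym_group n) (x^-1 * x)%g * sym_char mu (g * extend x)%g)).
      by rewrite mulVg cfRegE eqxx mulr1n mulrA mulVf ?mul1r // neq0CG.
    congr (_ * _); rewrite cfReg_sum sum_cfunE mulr_suml; apply: eq_bigr => j _.
    by rewrite cfunE mulrA.
  transitivity (#|sym_group n|%:R^-1 * \sum_(j : Iirr (sym_group n)) 'chi_j 1%g *
     \sum_(s : 'S_n) sym_char mu (g * extend s)%g *
       \sum_(r in rows n w) \sum_(q in cols n w) (-1) ^+ q * 'chi_j (s^-1 * (r * q))%g).
    under eq_bigr => r _ do under eq_bigr => q _ do rewrite reg mulrCA.
    under eq_bigr => r _ do rewrite -mulr_sumr.
    rewrite -mulr_sumr; congr (_ * _).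
    under eq_bigr => r _ do under eq_bigr => q _ do rewrite mulr_sumr.
    under eq_bigr => r _ do rewrite exchange_big.
    rewrite exchange_big; apply: eq_bigr => j _ /=.
    under eq_bigr => r _ do under eq_bigr => q _ do rewrite mulr_sumr.
    under eq_bigr => r _ do rewrite exchange_big.
    rewrite exchange_big mulr_sumr; apply: eq_bigr => s _ /=.
    rewrite mulr_sumr mulr_sumr; apply: eq_bigr => r _.
    rewrite mulr_sumr mulr_sumr; apply: eq_bigr => q _.
    by rewrite mulrCA; congr (_ * _); rewrite mulrA mulrC.
  rewrite big1 ?mulr0 // => j _.
  have [->|/(sym_Iirr_neq fw)[] h] := eqVneq j (sym_Iirr la).
  - suff -> : \sum_(s : 'S_n) sym_char mu (g * extend s)%g *
       (\sum_(r in rows n w) \sum_(q in cols n w) (-1) ^+ q * sym_char la (s^-1 * (r * q))%g)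
       = \sum_(r in rows n w) \sum_(q in cols n w) (-1) ^+ q *
         (\sum_(s : 'S_n) sym_char mu (g * extend (r * q) * extend s)%g * sym_char la s^-1%g).
      rewrite big1 ?mulr0 // => r _; rewrite big1 // => q _.
      by rewrite conv mulr0.
    under eq_bigr => s _ do rewrite mulr_sumr.
    rewrite exchange_big; apply: eq_bigr => r _ /=.
    under eq_bigr => s _ do rewrite mulr_sumr.
    rewrite exchange_big; apply: eq_bigr => q _ /=.
    rewrite (reindex_inj (mulgI (r * q)%g)) mulr_sumr; apply: eq_bigr => s _ /=.
    by rewrite extendM mulgA invMg mulgKV mulrCA.
  - rewrite big1 ?mulr0 // => s _; rewrite exchange_big big1 ?mulr0 //= => q _.
    rewrite -mulr_sumr (eq_bigr (fun r => 'chi_j (q * s^-1 * r)%g)) ?h ?mulr0 // => r _.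
    by rewrite mulgA irr_mulC ?finset.in_setT // mulgA.
  - rewrite big1 ?mulr0 // => s _; rewrite big1 ?mulr0 // => r _.
    by rewrite -[RHS](h (s^-1 * r)%g); apply: eq_bigr => q _; rewrite mulgA.
have /negP[] := young_symmetrizer_neq0 fb; apply/eqP.
set R' := rows _ _; set C' := cols _ _.
(* [extend] sends rows and columns of [la] into those of [mu], so [r] and [q] can be absorbed in
   [r'] and [q']; averaging over them changes nothing and exhibits the smaller symmetrizer as a
   factor. *)
have RC : \sum_(r' in R') \sum_(q' in C') (-1) ^+ q' * sym_char mu (r' * q')%g =
   (#|rows n w| * #|cols n w|)%:R^-1 * \sum_(q' in C') \sum_(r' in R') (-1) ^+ q' *
     \sum_(r in rows n w) \sum_(q in cols n w)
    (-1) ^+ q * sym_char mu (q' * r' * extend (r * q))%g.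
  have E r q : r \in rows n w -> q \in cols n w ->
     \sum_(q' in C') \sum_(r' in R') (-1) ^+ q' * ((-1) ^+ q * sym_char mu (q' * r' * extend (r * q))%g)
     = \sum_(r' in R') \sum_(q' in C') (-1) ^+ q' * sym_char mu (r' * q')%g.
    move=> Rr Cq; rewrite exchange_big (reindex_inj (mulIg (extend r)^-1%g)) /=.
    apply: eq_big => [r'|r' _]; first by rewrite groupMr // groupV extend_rows.
    rewrite (reindex_inj (mulgI (extend q)^-1%g)) /=.
    apply: eq_big => [q'|q' _]; first by rewrite groupMl // groupV extend_cols.
    rewrite odd_permM odd_permV odd_extend signr_addb mulrACA -expr2 sqrr_sign mul1r.
    congr (_ * _); rewrite extendM -!mulgA irr_mulC ?finset.in_setT //.
    by rewrite !mulgA mulgKV mulgK irr_mulC ?finset.in_setT.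
  set T := \sum_(r' in R') _ in E *.
  have -> : \sum_(q' in C') \sum_(r' in R') (-1) ^+ q' * (\sum_(r in rows n w)
     \sum_(q in cols n w) (-1) ^+ q * sym_char mu (q' * r' * extend (r * q))%g) =
     \sum_(r in rows n w) \sum_(q in cols n w) T.
    under eq_bigr => q' _ do under eq_bigr => r' _ do rewrite mulr_sumr.
    under eq_bigr => q' _ do rewrite exchange_big.
    rewrite exchange_big; apply: eq_bigr => r Rr /=.
    under eq_bigr => q' _ do under eq_bigr => r' _ do rewrite mulr_sumr.
    under eq_bigr => q' _ do rewrite exchange_big.
    by rewrite exchange_big; apply: eq_bigr => q Cq /=; exact: E.
  rewrite sumr_const sumr_const -mulrnA mulnC -[T *+ _]mulr_natl mulrA mulVf ?mul1r //.
  by rewrite pnatr_eq0 muln_eq0 negb_or -!lt0n (cardG_gt0 (rows n w)) (cardG_gt0 (cols n w)).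
rewrite RC big1 ?mulr0 // => q' _; rewrite big1 // => r' _.
by rewrite Z mulr0.
Qed.

(* A transposition inside a row, conjugated into a column, makes the sum vanish. *)
Lemma sum_sign_conj0 n (la mu : intpart n) (g : 'S_n) (i j : 'I_n) : i != j ->
  (box_of la i).2 = (box_of la j).2 -> (box_of mu (g i)).1 = (box_of mu (g j)).1 ->
  \sum_(r in row_group la) sign_cfun (col_group mu) (r ^ g)%g = 0.
Proof.
move=> ij fij cij; pose tau : 'S_n := tperm i j.
have tauR : tau \in row_group la.
  by apply/fiber_stabP => k; rewrite /tau; case: tpermP => [->|->|].
have tauC : (tau ^ g)%g \in col_group mu.
  apply/fiber_stabP => k; rewrite /tau tpermJ; case: tpermP => [->|->|] //.
set S := \sum_(r in _) _; suff SN : S = - S.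
  by apply/eqP; move/eqP: SN; rewrite -addr_eq0 -mulr2n mulrn_eq0.
rewrite {1}/S (reindex_inj (mulgI tau)) /= -sumrN.
apply: eq_big => [r|r _]; first by rewrite groupMl.
rewrite !sign_cfunE conjMg groupMl // odd_permM.
rewrite [odd_perm (tau ^ g)%g]odd_permJ odd_tperm ij.
by rewrite signr_addb expr1 mulN1r mulNrn.
Qed.

(** The common constituent makes ['[row_char la, col_char mu]] nonzero. This product is a sum over
    [g], in which [sum_sign_conj0] kills every [g] that sends two boxes of a row of [la] into one
    column of [mu]. *)
Lemma sym_Iirr_transversal n (la mu : intpart n) : sym_Iirr la = sym_Iirr mu ->
  exists g : 'S_n, forall i j, (box_of la i).2 = (box_of la j).2 ->
    (box_of mu (g i)).1 = (box_of mu (g j)).1 -> i = j.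
Proof.
move=> lm; have : '[row_char la, col_char mu] != 0.
  have /andP[la1 _] : (sym_Iirr la \in irr_constt (row_char la)) &&
    (sym_Iirr la \in irr_constt (col_char la)) by rewrite sym_Iirr_uniq.
  have /andP[_ mu2] : (sym_Iirr mu \in irr_constt (row_char mu)) &&
    (sym_Iirr mu \in irr_constt (col_char mu)) by rewrite sym_Iirr_uniq.
  have rC : row_char la \is a character by rewrite cfInd_char ?cfun1_char.
  have cC : col_char mu \is a character by rewrite cfInd_char ?sign_cfun_char.
  rewrite cfdot_sum_irr; apply/negP => /eqP s0.
  have pos i : true -> 0 <= '[row_char la, 'chi_i] * '[col_char mu, 'chi_i]^*.
    by move=> _; rewrite mulr_ge0 ?conjC_ge0 ?natr_ge0 ?Cnat_cfdot_char_irr.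
  have /eqP : '[row_char la, 'chi_(sym_Iirr la)] * '[col_char mu, 'chi_(sym_Iirr la)]^* = 0.
    exact: (psumr_eq0P pos s0).
  rewrite mulf_eq0 fmorph_eq0; rewrite !irr_consttE in la1 mu2.
  by rewrite (negbTE la1) lm (negbTE mu2).
apply: contraNP => nex.
rewrite /row_char -Frobenius_reciprocity cfdotE mulf_eq0; apply/orP; right; apply/eqP.
transitivity (\sum_(r in row_group la) #|col_group mu|%:R^-1 *
    \sum_(g in sym_group n) sign_cfun (col_group mu) (r ^ g)%g).
  apply: eq_bigr => r Rr; rewrite cfun1E Rr mul1r cfResE ?finset.subsetT //.
  rewrite cfIndE ?finset.subsetT // rmorphM fmorphV rmorph_nat rmorph_sum /=.
  congr (_ * _); apply: eq_bigr => g _.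
  by rewrite sign_cfunE rmorphMn rmorphXn rmorphN1.
rewrite -mulr_sumr exchange_big /= big1 ?mulr0 // => g _.
have [[i j] [/= fij cij ij]] : exists p : 'I_n * 'I_n,
    [/\ (box_of la p.1).2 = (box_of la p.2).2,
        (box_of mu (g p.1)).1 = (box_of mu (g p.2)).1 & p.1 <> p.2].
  apply: contrapT => nex'; apply: nex; exists g => i j fij cij.
  by apply: contrapT => ij; apply: nex'; exists (i, j).
by apply: (sum_sign_conj0 _ fij cij); apply/eqP.
Qed.

Lemma box_of_surj n (la : intpart n) x y : (x < part la y)%N ->
  exists i : 'I_n, box_of la i = (x, y).
Proof.
move=> xy; have sum_sh : sumn (parts la) = n by have /andP[_ /eqP] := valP la.
have lt : (flatten_index (parts la) y x < n)%N by rewrite -[X in (_ < X)%N]sum_sh flatten_indexP.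
exists (Ordinal lt); rewrite /box_of /=.
by rewrite flatten_indexKl ?flatten_indexKr.
Qed.

Definition low_rows n (la : intpart n) (k : nat) : {set 'I_n} :=
  [set i | ((box_of la i).2 < k)%N]%SET.

(* Every column of [mu] contains at most [k] of the images of the boxes in the
   first [k] rows of [la]; so these boxes fit in the first [k] rows of [mu]. *)
Lemma card_low_rows n (la mu : intpart n) k : sym_Iirr la = sym_Iirr mu ->
  (#|low_rows la k| <= #|low_rows mu k|)%N.
Proof.
move=> /sym_Iirr_transversal[g gP]; pose c (j : 'I_n) := (box_of mu j).1.
have cn j : (c j < n)%N.
  rewrite /c; apply: leq_trans (box_of_part mu j) _.
  have [ny|yn] := leqP n (box_of mu j).2; first by rewrite part_ge.
  by rewrite -[X in (_ <= X)%N](sum_part mu) (bigD1 (Ordinal yn)) //= leq_addr.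
have split (A : {set 'I_n}) : #|A| = (\sum_(x < n) #|[set j in A | c j == x]%SET|)%N.
  rewrite -sum1_card (partition_big (fun j => Ordinal (cn j)) xpredT) //=.
  by apply: eq_bigr => x _; rewrite -sum1_card; apply: eq_bigl => j; rewrite !inE.
rewrite -(card_imset _ (@perm_inj _ g)) split [X in (_ <= X)%N]split.
apply: leq_sum => x _; set B := [set j in low_rows mu k | _]%SET.
(* A column of [mu] that stays within the first [k] rows counts entirely. A taller one has exactly
   [k] boxes there, while the images in it come from distinct rows of [la] among the first [k]. *)
have [[j0 [cj0 kj0]]|nj] := pselect (exists j, c j = x /\ (k <= (box_of mu j).2)%N); last first.
  apply/subset_leq_card/fintype.subsetP => j; rewrite !inE => /andP[_ /eqP cj].
  rewrite cj eqxx andbT ltnNge; apply/negP => kj; apply: nj; by exists j.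
apply: (@leq_trans k).
  case: k B kj0 => [|k] B kj0.
    by rewrite leqn0 cards_eq0; apply/eqP/finset.setP => j; rewrite !inE;
      apply/negbTE/negP => /andP[/imsetP[i]]; rewrite inE.
  rewrite -[X in (_ <= X)%N]card_ord.
  have inj : {in [set j in g @: low_rows la k.+1 | c j == x]%SET &,
      injective (fun j => inord (box_of la (g^-1%g j)).2 : 'I_k.+1)}.
    move=> j j'; rewrite !inE => /andP[/imsetP[i + ->] /eqP ci] /andP[/imsetP[i' + ->] /eqP ci'].
    rewrite !inE => ik ik'; rewrite !permK => /(congr1 val) /=.
    rewrite !inordK // => ii; congr (g _); apply: gP => //; exact: etrans ci (esym ci').
  by rewrite -(card_in_imset inj); exact: max_card.
have /choice[h hP] : forall y : 'I_k, exists j, box_of mu j = (nat_of_ord x, nat_of_ord y).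
  move=> y; apply: box_of_surj; rewrite -cj0.
  by apply: leq_trans (box_of_part mu j0) (part_mono _ _); apply: leq_trans kj0; exact: ltnW.
rewrite -[X in (X <= _)%N]card_ord -(@card_imset _ _ h); last first.
  by move=> y y' yy'; have := hP y; rewrite yy' hP => -[]/val_inj.
apply/subset_leq_card/fintype.subsetP => _ /imsetP[y _ ->].
by rewrite !inE /c hP /= eqxx ltn_ord.
Qed.

Lemma card_row n (la : intpart n) y :
  (#|low_rows la y.+1| = #|low_rows la y| + part la y)%N.
Proof.
have -> : low_rows la y.+1 = (low_rows la y :|: [set i | (box_of la i).2 == y])%SET.
  by apply/finset.setP => i; rewrite !inE ltnS leq_eqVlt orbC.
rewrite cardsU (_ : _ :&: _ = finset.set0)%SET ?cards0 ?subn0; last first.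
  by apply/finset.setP => i; rewrite !inE; apply/negbTE/negP => /andP[+ /eqP iy]; rewrite iy ltnn.
congr (_ + _)%N; have /choice[h hP] : forall x : 'I_(part la y),
    exists j, box_of la j = (nat_of_ord x, y).
  by move=> x; exact: box_of_surj.
have hi : injective h by move=> x x' xx; have := hP x; rewrite xx hP => -[]/val_inj.
rewrite -[RHS]card_ord -(card_imset _ hi); apply: eq_card => i; rewrite !inE.
apply/eqP/imsetP => [iy|[x _ ->]]; last by rewrite hP.
have lt : ((box_of la i).1 < part la y)%N by rewrite -iy box_of_part.
exists (Ordinal lt) => //; apply: (@box_of_inj _ la); rewrite hP /= -iy.
exact: surjective_pairing.
Qed.

(** Dominance in both directions: the first [k] rows of both diagrams have the same total length for
    every [k]. *)
Lemma sym_Iirr_inj n : injective (@sym_Iirr n).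
Proof.
move=> la mu lm; have E k : #|low_rows la k| = #|low_rows mu k|.
  by apply/eqP; rewrite eqn_leq !card_low_rows.
by apply: part_inj => y; apply/eqP; rewrite -(eqn_add2l #|low_rows la y|) -card_row !E card_row.
Qed.

Definition extend_morphism n : {morphism (sym_group n) >-> 'S_n.+1} :=
  Morphism (in2W (@extendM n)).

Definition restrict n (phi : 'CF(sym_group n.+1)) : 'CF(sym_group n) :=
  cfMorph ('Res[(extend_morphism n @* sym_group n)%G] phi).

Lemma restrictE n (phi : 'CF(sym_group n.+1)) s : restrict phi s = phi (extend s).
Proof.
rewrite /restrict cfMorphE ?finset.in_setT // cfResE ?finset.subsetT //.
by apply/imsetP; exists s; rewrite ?finset.in_setT // finset.setIT finset.in_setT.
Qed.

Lemma restrict_char n (phi : 'CF(sym_group n.+1)) :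
  phi \is a character -> restrict phi \is a character.
Proof. by move=> ?; rewrite cfMorph_char // cfRes_char. Qed.

Lemma npaths_gt0 n (la : intpart n) : (0 < npaths la)%N.
Proof.
elim: n la => // n IH mu; have [w [sw ww mw]] := intpart_walk mu.
case/lastP: w sw ww mw => // w b; rewrite size_rcons => -[sw].
rewrite walk_rcons => /andP[ww ab] mw; have [la lw] := walk_fills ww.
rewrite sw in la lw; have [mu' cm mw'] := fills_rcons lw ab.
rewrite npathsS (bigD1 la) ?addn_gt0 ?IH //=.
by rewrite (fills_inj mw mw').
Qed.

Lemma sym_char1_gt0 n (la : intpart n) : 0 < sym_char la 1%g.
Proof. exact: irr1_gt0. Qed.

(** Each [la] below [mu] occurs in the restriction, and distinct [la] give distinct irreducible
    characters; so the multiplicities [a] dominate the multiplicities [b] of the sum, and equal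
    degrees force [a = b]. *)
Lemma restrict_sym_char n (mu : intpart n.+1) :
  \sum_(la | covers la mu) sym_char la 1%g <= sym_char mu 1%g ?= iff
  (restrict (sym_char mu) == \sum_(la | covers la mu) sym_char la).
Proof.
have rC : restrict (sym_char mu) \is a character by rewrite restrict_char ?irr_char.
pose a j := '[restrict (sym_char mu), 'chi_j].
pose b j : algC := \sum_(la | covers la mu) (j == sym_Iirr la)%:R.
have ab j : b j <= a j.
  have [[la cm jla]|nj] := pselect (exists2 la, covers la mu & j = sym_Iirr la); last first.
    rewrite /b big1 ?natr_ge0 ?Cnat_cfdot_char_irr // => la cm.
    by case: eqP => // jla; case: nj; exists la.
  rewrite /b (bigD1 la) //= jla eqxx big1 ?addr0 => [|ka /andP[_ kala]]; last first.
    by rewrite (inj_eq (@sym_Iirr_inj n)) eq_sym (negbTE kala).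
  have a0 : a (sym_Iirr la) != 0.
    rewrite /a cfdotE mulf_neq0 ?invr_eq0 ?neq0CG //.
    have := sym_char_restr_neq0 cm; congr (_ != _); apply: eq_bigr => s _.
    by rewrite restrictE -irr_inv.
  have /natrP[k ak] : a (sym_Iirr la) \is a Num.nat by exact: Cnat_cfdot_char_irr.
  by move: a0; rewrite ak pnatr_eq0 ler1n lt0n.
have aE : restrict (sym_char mu) = \sum_j a j *: 'chi_j by rewrite [LHS]cfun_sum_cfdot.
have bE : \sum_(la | covers la mu) sym_char la = \sum_j b j *: 'chi_j.
  under [RHS]eq_bigr do rewrite /b scaler_suml.
  rewrite exchange_big; apply: eq_bigr => la _ /=.
  rewrite (bigD1 (sym_Iirr la)) //= eqxx scale1r big1 ?addr0 // => j /negbTE ->.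
  by rewrite scale0r.
have a1 : sym_char mu 1%g = \sum_j a j * 'chi_j 1%g.
  by rewrite -(extend1 n) -restrictE aE sum_cfunE; apply: eq_bigr => j _; rewrite cfunE.
have b1 : \sum_(la | covers la mu) sym_char la 1%g = \sum_j b j * 'chi_j 1%g.
  by rewrite -sum_cfunE bE sum_cfunE; apply: eq_bigr => j _; rewrite cfunE.
have le : \sum_j b j * 'chi_j 1%g <= \sum_j a j * 'chi_j 1%g.
  by apply: ler_sum => j _; rewrite ler_wpM2r // ltW // irr1_gt0.
split; first by rewrite a1 b1.
apply/eqP/eqP => [|e]; last first.
  by rewrite -sum_cfunE -e restrictE extend1.
rewrite a1 b1 => /eqP; rewrite eq_sym -subr_eq0 -sumrB => /eqP ab0.
rewrite aE bE; apply: eq_bigr => j _; congr (_ *: _).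
have pos k : true -> 0 <= a k * 'chi_k 1%g - b k * 'chi_k 1%g.
  by rewrite -mulrBl mulr_ge0 ?subr_ge0 // ltW // irr1_gt0.
have /eqP : a j * 'chi_j 1%g - b j * 'chi_j 1%g = 0 by exact: (psumr_eq0P pos ab0).
by rewrite -mulrBl mulf_eq0 (negbTE (irr1_neq0 _)) orbF subr_eq0 => /eqP.
Qed.

(* The degrees dominate the numbers of paths, since the restrictions do; that
   both sums of squares are n! leaves no room. *)
Lemma sym_char1 n (la : intpart n) : sym_char la 1%g = (npaths la)%:R.
Proof.
suff eq m : (forall mu : intpart m, (npaths mu)%:R <= sym_char mu 1%g) ->
    forall la : intpart m, sym_char la 1%g = (npaths la)%:R.
  elim: n la => [|n IH]; apply: eq => mu.
    rewrite npaths0 /sym_char; have /natrP[d dE] := Cnat_char1 (irr_char (sym_Iirr mu)).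
    by have := irr1_gt0 (sym_Iirr mu); rewrite dE ltr0n ler1n.
  rewrite npathsS natr_sum; under eq_bigr do rewrite -IH.
  exact: restrict_sym_char.
move=> ge {}la.
have sq : \sum_(mu : intpart m) sym_char mu 1%g ^+ 2 <= m`!%:R.
  have <- : #|sym_group m|%:R = m`!%:R :> algC by rewrite cardsT card_Sn.
  rewrite -irr_sum_square.
  have -> : \sum_(mu : intpart m) sym_char mu 1%g ^+ 2 =
      \sum_(i in @sym_Iirr m @: [set: intpart m]%SET) 'chi_i 1%g ^+ 2.
    rewrite big_imset /=; last by move=> ? ? _ _; exact: sym_Iirr_inj.
    by apply: eq_bigl => mu; rewrite finset.in_setT.
  rewrite [leRHS](bigID (mem (@sym_Iirr m @: [set: intpart m]%SET))) /=.
  by rewrite lerDl sumr_ge0 // => i _; rewrite exprn_ge0 // ltW // irr1_gt0.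
rewrite -sum_npaths_sqr natr_sum -subr_le0 -sumrB in sq.
have pos (mu : intpart m) : true -> 0 <= sym_char mu 1%g ^+ 2 - (npaths mu ^ 2)%:R.
  by move=> _; rewrite natrX subr_ge0 ler_pXn2r ?nnegrE ?ler0n // ltW // sym_char1_gt0.
have {}sq := le_anti (introT andP (conj sq (sumr_ge0 _ pos))).
have /eqP : sym_char la 1%g ^+ 2 - (npaths la ^ 2)%:R = 0 by exact: (psumr_eq0P pos sq).
rewrite natrX subr_eq0 eqrXn2 ?ler0n // ?ltW ?sym_char1_gt0 //.
by move/eqP.
Qed.

Lemma sym_char_extend n (mu : intpart n.+1) (s : 'S_n) :
  sym_char mu (extend s) = \sum_(la | covers la mu) sym_char la s.
Proof.
have [_ /esym/eqP] := restrict_sym_char mu; rewrite -restrictE => e.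
have : \sum_(la | covers la mu) sym_char la 1%g == sym_char mu 1%g.
  by under eq_bigr do rewrite sym_char1; rewrite sym_char1 npathsS natr_sum.
by have [_ ->] := restrict_sym_char mu => /eqP ->; rewrite sum_cfunE.
Qed.

Lemma card_conj_eq (gT : finGroupType) (G : {group gT}) (x y : gT) : x \in G -> y \in G ->
  (#|[set g in G | (x ^ g)%g == y]%SET|)%:R = \sum_(i : Iirr G) 'chi_i x * 'chi_i y^-1%g.
Proof.
move=> Gx Gy; under eq_bigr do rewrite irr_inv.
rewrite (second_orthogonality_relation _ Gy).
have [/imsetP[h Gh xE]|nxy] := boolP (x \in _); last first.
  rewrite mulr0n (_ : finset _ = finset.set0) ?cards0 //; apply/finset.setP => g; rewrite !inE.
  apply/negbTE/negP => /andP[Gg /eqP e]; case/negP: nxy; apply/imsetP.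
  by exists g^-1%g; rewrite ?groupV // -e conjgK.
rewrite mulr1n; congr (_%:R); rewrite -(card_rcoset _ h).
apply: eq_card => g; rewrite mem_rcoset finset.in_set finset.in_setI groupMr ?groupV //.
congr (_ && _); rewrite cent1C conjgM; apply/eqP/cent1P => [e|/commgP/conjg_fixP ->].
  by apply/commgP/conjg_fixP; rewrite -[LHS](conjgKV h) e -xE.
by rewrite xE conjgK.
Qed.

(** The average of the conjugates of [y] is central and acts by the scalar ['chi_i y / 'chi_i 1].
    Here this is read off from the character expansion of the number of [g] with [y ^ g = z]. *)
Lemma sum_irr_conj (gT : finGroupType) (G : {group gT}) (i : Iirr G) (x y : gT) :
  x \in G -> y \in G ->
  'chi_i 1%g * \sum_(g in G) 'chi_i (x * y ^ g)%g = #|G|%:R * ('chi_i x * 'chi_i y).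
Proof.
move=> Gx Gy; have -> : \sum_(g in G) 'chi_i (x * y ^ g)%g =
    \sum_(z in G) 'chi_i (x * z)%g * \sum_(j : Iirr G) 'chi_j y * 'chi_j z^-1%g.
  rewrite (partition_big (fun g => (y ^ g)%g) (mem G)) /= => [|g Gg]; last by rewrite groupJ.
  apply: eq_bigr => z Gz; rewrite -card_conj_eq // (eq_bigr (fun=> 'chi_i (x * z)%g)).
    by rewrite sumr_const mulr_natr; congr (_ *+ _); apply: eq_card => g; rewrite !inE.
  by move=> g /andP[_ /eqP ->].
under eq_bigr do rewrite mulr_sumr.
rewrite exchange_big (bigD1 i) //= [X in _ + X]big1 => [|j ji]; last first.
  transitivity ('chi_j y * \sum_(z in G) 'chi_i (z * x)%g * 'chi_j z^-1%g).
    by rewrite mulr_sumr; apply: eq_bigr => z Gz; rewrite mulrCA (irr_mulC _ Gz).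
  have := generalized_orthogonality_relation x i j; rewrite eq_sym (negbTE ji) mul0r => /eqP.
  by rewrite mulf_eq0 invr_eq0 (negbTE (neq0CG _)) /= => /eqP ->; rewrite mulr0.
have := sum_irr_mul i x; rewrite addr0 => e.
transitivity ('chi_i 1%g * ('chi_i y * \sum_(z in G) 'chi_i (z * x)%g * 'chi_i z^-1%g)).
  congr (_ * _); rewrite mulr_sumr; apply: eq_bigr => z Gz.
  by rewrite mulrCA (irr_mulC _ Gz).
rewrite e mulrCA [X in _ * X]mulrCA [X in _ * (_ * X)]mulrCA divff ?irr1_neq0 // mulr1.
by rewrite mulrCA [X in _ * X]mulrC.
Qed.

(** Integers carry the character identities from [algC] to the real field of the measure. *)
Definition int_char n (la : intpart n) (s : 'S_n) : int := Num.floor (sym_char la s).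

Lemma int_charE n (la : intpart n) s : (int_char la s)%:~R = sym_char la s.
Proof. by rewrite /int_char floorK // sym_char_int. Qed.

Lemma int_char1 n (la : intpart n) : int_char la 1%g = npaths la.
Proof. by apply: (@intr_inj algC); rewrite int_charE sym_char1. Qed.

Lemma int_char_extend n (mu : intpart n.+1) s :
  int_char mu (extend s) = \sum_(la | covers la mu) int_char la s.
Proof.
apply: (@intr_inj algC); rewrite int_charE sym_char_extend rmorph_sum /=.
by apply: eq_bigr => la _; rewrite int_charE.
Qed.

Lemma int_char_mul n (la : intpart n) s t :
  (npaths la)%:Z * \sum_(g : 'S_n) int_char la (s * t ^ g)%g = n`!%:Z * (int_char la s * int_char la t).
Proof.
apply: (@intr_inj algC); rewrite !rmorphM rmorph_sum /= !int_charE.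
have := sum_irr_conj (sym_Iirr la) (finset.in_setT s) (finset.in_setT t).
rewrite -/(sym_char la) sym_char1 cardsT card_Sn => <-; congr (_ * _).
by apply: eq_big => [g|g _]; rewrite ?finset.in_setT // int_charE.
Qed.

Lemma int_char_le n (la : intpart n) s : `|int_char la s| <= (npaths la)%:Z.
Proof.
rewrite -(@ler_int algC) intr_norm int_charE -pmulrn -sym_char1.
by apply: char1_ge_norm; exact: irr_char.
Qed.

Lemma int_char_ortho n (la mu : intpart n) :
  \sum_(s : 'S_n) int_char la s * int_char mu s = n`!%:Z * (la == mu)%:Z.
Proof.
apply: (@intr_inj algC); rewrite rmorph_sum rmorphM /=.
have := cfdot_irr (sym_Iirr la) (sym_Iirr mu); rewrite (inj_eq (@sym_Iirr_inj n)) cfdotE.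
move=> e; transitivity ((n`!)%:R * (la == mu)%:R : algC); last by case: (la == mu).
rewrite -e cardsT card_Sn mulrA divff ?mul1r; last by rewrite pnatr_eq0 -lt0n fact_gt0.
apply: eq_big => [g|g _]; first by rewrite finset.in_setT.
by rewrite rmorphM /= !int_charE conj_intr // sym_char_int.
Qed.

Lemma int_charJ n (la : intpart n) s g : int_char la (s ^ g)%g = int_char la s.
Proof. by rewrite /int_char /sym_char cfunJ // finset.in_setT. Qed.

(** * Extremality *)

Lemma porbit_fixed n (s : 'S_n) x : s x = x -> porbit s x = [set x]%SET.
Proof.
move=> sx; apply/finset.setP => y; rewrite inE; apply/porbitP/eqP => [[i ->]|->]; last first.
  by exists 0%N; rewrite expg0 perm1.
by elim: i => [|i IH]; rewrite ?expg0 ?perm1 // expgSr permM IH.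
Qed.

Lemma card_porbit_gt1 n (s : 'S_n) x : (1 < #|porbit s x|)%N = (s x != x).
Proof.
have [sx|sx] := eqVneq (s x) x; first by rewrite porbit_fixed // cards1.
have <- : #|[set s x; x]%SET| = 2%N by rewrite cards2 sx.
apply/subset_leq_card/fintype.subsetP => y; rewrite !inE => /orP[]/eqP->.
  by rewrite -[X in X \in _]/(s x) -{1}[s]expg1 mem_porbit.
exact: porbit_id.
Qed.

Definition disjoint_perm n (s t : 'S_n) : Prop := forall i, s i = i \/ t i = i.

Lemma disjoint_permC n (s t : 'S_n) : disjoint_perm s t -> (s * t = t * s)%g.
Proof.
move=> d; apply/permP => i; rewrite !permM.
have fix2 (a b : 'S_n) : disjoint_perm a b -> b i = i -> b (a i) = a i.
  move=> dab bi; have [ai|//] := dab (a i).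
  by rewrite (perm_inj ai) bi.
have [si|ti] := d i; last by rewrite ti (fix2 s t).
by rewrite si (fix2 t s) // => j; have [] := d j; [right|left].
Qed.

Lemma porbit_disjoint n (s t : 'S_n) x : disjoint_perm s t -> s x != x ->
  porbit (s * t)%g x = porbit s x.
Proof.
move=> d sx; have E k : ((s * t) ^+ k)%g x = (s ^+ k)%g x.
  elim: k => [|k IH]; first by rewrite !expg0.
  rewrite !expgSr !permM IH; have [h|//] := d (s ((s ^+ k)%g x)).
  case/eqP: sx; apply: (@perm_inj _ (s ^+ k.+1)%g).
  by rewrite -permM -expgS expgSr permM expgSr permM h.
by apply/finset.setP => y; apply/porbitP/porbitP => -[i ->]; exists i; rewrite E.
Qed.

(** The nontrivial cycles of [s * t] are those of [s] together with those of [t]. They are indexed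
    by moved points, where [porbit_disjoint] applies. *)
Lemma thoma_char_disjoint (R : realType) (al be : nat -> R) n (s t : 'S_n) :
  disjoint_perm s t -> thoma_char al be (s * t)%g = thoma_char al be s * thoma_char al be t.
Proof.
move=> d; pose moved (u : 'S_n) := [set x | u x != x]%SET.
have nontriv (u : 'S_n) : [set C in porbits u | (1 < #|C|)%N]%SET = porbit u @: moved u.
  apply/finset.setP => C; rewrite !inE; apply/andP/imsetP => [[/imsetP[x _ ->] ux]|[x + ->]].
    by exists x; rewrite // inE -card_porbit_gt1.
  by rewrite inE -card_porbit_gt1 => ->; split=> //; exact: imset_f.
have thomaE (u : 'S_n) : thoma_char al be u = \prod_(C in porbit u @: moved u)
    (limn (series (fun i => al i ^+ #|C|))
     + (-1) ^+ #|C|.-1 * limn (series (fun i => be i ^+ #|C|))).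
  by rewrite -nontriv /thoma_char; apply: eq_bigl => C; rewrite inE.
have -> : thoma_char al be (s * t)%g = \prod_(C in porbit s @: moved s :|: porbit t @: moved t)
    (limn (series (fun i => al i ^+ #|C|))
     + (-1) ^+ #|C|.-1 * limn (series (fun i => be i ^+ #|C|))).
  rewrite thomaE; apply: eq_bigl; apply/fintype.subset_eqP; apply/andP; split.
    apply/fintype.subsetP => _ /imsetP[x + ->]; rewrite inE permM => stx.
    have [sx|sx] := eqVneq (s x) x.
      rewrite sx in stx; rewrite disjoint_permC // porbit_disjoint //; last first.
        by move=> i; have [] := d i; [right|left].
      by rewrite finset.in_setU [X in _ || X]imset_f ?orbT // inE.
    by rewrite porbit_disjoint // finset.in_setU imset_f // inE.
  apply/fintype.subsetP => C; rewrite finset.in_setU => /orP[]/imsetP[x + ->]; rewrite inE => mx.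
    rewrite -(porbit_disjoint d mx); apply: imset_f; rewrite inE.
    by rewrite -card_porbit_gt1 porbit_disjoint // card_porbit_gt1.
  have d' : disjoint_perm t s by move=> i; have [] := d i; [right|left].
  rewrite -(porbit_disjoint d' mx) -disjoint_permC //; apply: imset_f; rewrite inE.
  by rewrite -card_porbit_gt1 disjoint_permC // porbit_disjoint // card_porbit_gt1.
rewrite !thomaE -bigU /=; first by apply: eq_bigl => C; rewrite !inE.
apply/pred0P => C /=; apply/negbTE/negP.
case/andP => /imsetP[x + ->] /imsetP[y + e]; rewrite !inE => sx ty.
have : x \in porbit t y by rewrite -e porbit_id.
rewrite -eq_porbit_mem => /eqP tyx; case: (d x) => [h|h]; first by rewrite h eqxx in sx.
by move: ty; rewrite -card_porbit_gt1 -tyx porbit_fixed // cards1.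
Qed.

Lemma thoma_char1 (R : realType) (al be : nat -> R) n : thoma_char al be (1%g : 'S_n) = 1.
Proof.
rewrite /thoma_char big_pred0 // => C; apply/negbTE/negP => /andP[/imsetP[x _ ->]].
by rewrite card_porbit_gt1 perm1 eqxx.
Qed.

Definition supported n (s : 'S_n) (k : nat) : Prop := forall i : 'I_n, (k <= i)%N -> s i = i.

(** The exceptional [g], for which a permutation of the first [k] points and its conjugate by [g]
    may have overlapping supports. *)
Definition mixing n (k : nat) : {set 'S_n} :=
  [set g : 'S_n | [exists i : 'I_n, [&& (i < k)%N & (g i < k)%N]]]%SET.

Lemma supported_conj_disjoint n k (s t g : 'S_n) : supported s k -> supported t k ->
  g \notin mixing n k -> disjoint_perm s (t ^ g)%g.
Proof.
move=> ss st; rewrite inE negb_exists => /forallP gN x.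
have [kx|xk] := leqP k x; first by left; exact: ss.
right; rewrite /conjg !permM; have := gN (g^-1%g x); rewrite permKV xk andbT -leqNgt => /st ->.
by rewrite permKV.
Qed.

Lemma card_perm_value n (i j : 'I_n) : (n * #|[set g : 'S_n | g i == j]%SET| = n`!)%N.
Proof.
have E j' : #|[set g : 'S_n | g i == j']%SET| = #|[set g : 'S_n | g i == j]%SET|.
  rewrite -(card_imset _ (@mulIg _ (tperm j' j))); apply: eq_card => g; rewrite inE.
  apply/imsetP/eqP => [[h + ->]|gi]; first by rewrite inE permM => /eqP ->; rewrite tpermL.
  by exists (g * tperm j' j)%g; rewrite ?inE ?permM ?gi ?tpermR // -mulgA tperm2 mulg1.
rewrite -card_Sn -[RHS]sum1_card [RHS](partition_big (fun g : 'S_n => g i) xpredT) //=.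
rewrite [RHS](eq_bigr (fun=> #|[set g : 'S_n | g i == j]%SET|)) => [|j' _].
  by rewrite sum_nat_const card_ord.
by rewrite -(E j') -sum1_card; apply: eq_bigl => g; rewrite inE.
Qed.

(** Union bound over the at most [k ^ 2] pairs [(i, g i)], each prescribed for one [n]-th of all
    permutations. *)
Lemma card_mixing n k : (n * #|mixing n k| <= k ^ 2 * n`!)%N.
Proof.
have le : (#|mixing n k| <= \sum_(i : 'I_n | (i < k)%N) \sum_(j : 'I_n | (j < k)%N)
    #|[set g : 'S_n | g i == j]%SET|)%N.
  rewrite -sum1_card; under [X in (_ <= X)%N]eq_bigr do under eq_bigr do rewrite -sum1_card.
  under [X in (_ <= X)%N]eq_bigr do rewrite (exchange_big_dep xpredT) //=.
  rewrite (exchange_big_dep xpredT) //= big_mkcond; apply: leq_sum => g _.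
  case: ifP => // /[!inE] /existsP[i /andP[ik gik]].
  by rewrite (bigD1 i) /= ?ik // (bigD1 (g i)) /= ?gik ?inE ?eqxx.
have card_lt : (#|[pred i : 'I_n | (i < k)%N]| <= k)%N.
  case: k {le} => [|k]; first by rewrite fintype.eq_card0.
  rewrite -[X in (_ <= X)%N]card_ord -(@card_in_imset _ _ (fun i : 'I_n => inord i : 'I_k.+1)).
    exact: max_card.
  move=> i j; rewrite !inE /= => ik jk /(congr1 val) /=; rewrite !inordK // => ij.
  exact: val_inj.
apply: leq_trans (leq_mul (leqnn _) le) _.
rewrite big_distrr /=; under eq_bigr do rewrite big_distrr /=.
under eq_bigr do under eq_bigr do rewrite card_perm_value.
rewrite sum_nat_const sum_nat_const mulnA leq_mul2r -mulnn leq_mul ?orbT //.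
Qed.

Fixpoint extend_iter m k (s : 'S_k) : 'S_(m + k) :=
  if m is m'.+1 then extend (extend_iter m' s) else s.

Lemma supported_extend_iter m k (s : 'S_k) : supported (extend_iter m s) k.
Proof.
elim: m => [|m IH] i ki; first by have := ltn_ord i; rewrite ltnNge ki.
rewrite /=; have [j e|->] := unliftP ord_max i; last exact: extend_max.
by rewrite e extend_lift IH // -(val_lift_max j) -e.
Qed.

(** The coherence of the cylinder probabilities of a central measure. *)
Definition harmonic (R : realType) (p : forall n, intpart n -> R) : Prop :=
  forall n (la : intpart n), p n la = \sum_(mu | covers la mu) p n.+1 mu.

Definition weighted_char (R : realType) (p : forall n, intpart n -> R) n (s : 'S_n) : R :=
  \sum_(la : intpart n) p n la * (int_char la s)%:~R.

Section weighted_char.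
Variables (R : realType) (p : forall n, intpart n -> R).
Hypothesis hp : harmonic p.

(** By the branching rule, harmonic weights define one function on the infinite symmetric group. *)
Lemma weighted_char_extend n (s : 'S_n) : weighted_char p (extend s) = weighted_char p s.
Proof.
rewrite /weighted_char; under eq_bigr do rewrite int_char_extend rmorph_sum /= mulr_sumr.
rewrite (exchange_big_dep xpredT) //=; apply: eq_bigr => la _.
by rewrite hp mulr_suml.
Qed.

Lemma weighted_char_extend_iter m k (s : 'S_k) :
  weighted_char p (extend_iter m s) = weighted_char p s.
Proof. by elim: m => //= m IH; rewrite weighted_char_extend. Qed.

Lemma weighted_char1 n : weighted_char p (1%g : 'S_n) = \sum_(la : intpart n) p la * (npaths la)%:R.
Proof. by apply: eq_bigr => la _; rewrite int_char1. Qed.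

Lemma weighted_char1_const n : weighted_char p (1%g : 'S_n) = weighted_char p (1%g : 'S_0).
Proof. by elim: n => // n <-; rewrite -(extend1 n) weighted_char_extend. Qed.

End weighted_char.

Lemma weighted_char_inj (R : realType) n (p q : forall n, intpart n -> R) :
  (forall s : 'S_n, weighted_char p s = weighted_char q s) -> forall la : intpart n, p n la = q n la.
Proof.
move=> pq la; have E (r : forall n, intpart n -> R) :
    \sum_(s : 'S_n) weighted_char r s * (int_char la s)%:~R = n`!%:R * r n la.
  rewrite /weighted_char; under eq_bigr do rewrite mulr_suml.
  rewrite exchange_big (bigD1 la) //= [X in _ + X]big1 => [|mu mula].
    rewrite addr0; under eq_bigr do rewrite -mulrA -intrM.
    by rewrite -mulr_sumr -rmorph_sum int_char_ortho eqxx mulr1 mulrC.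
  under eq_bigr do rewrite -mulrA -intrM.
  by rewrite -mulr_sumr -rmorph_sum int_char_ortho (negbTE mula) mulr0 mulr0.
have := E p; under eq_bigr do rewrite pq; rewrite E => /esym; apply: mulfI.
by rewrite pnatr_eq0 -lt0n fact_gt0.
Qed.

Section extremality.
Variables (R : realType) (p : forall n, intpart n -> R).
Hypothesis hp : harmonic p.
Hypothesis p_ge0 : forall n (la : intpart n), 0 <= p la.
Hypothesis p1 : weighted_char p (1%g : 'S_0) = 1.
Hypothesis p_mult : forall n (s t : 'S_n), disjoint_perm s t ->
  weighted_char p (s * t)%g = weighted_char p s * weighted_char p t.

Let Theta n (s : 'S_n) := weighted_char p s.
(** [p la * d la] is the probability of the shape [la] at level [n], and [X] the normalized
    character; the sums below are expectations for this law. *)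
Let d n (la : intpart n) : R := (npaths la)%:R.
Let X n (la : intpart n) (s : 'S_n) : R := (int_char la s)%:~R / d la.

Let d_gt0 n (la : intpart n) : 0 < d la.
Proof. by rewrite ltr0n npaths_gt0. Qed.

Let sum_pd n : \sum_(la : intpart n) p la * d la = 1.
Proof. by rewrite -weighted_char1 // weighted_char1_const. Qed.

Let X_le1 n (la : intpart n) s : `|X la s| <= 1.
Proof.
rewrite /X normrM normfV (gtr0_norm (d_gt0 la)) ler_pdivrMr // mul1r.
by rewrite -intr_norm /d -[(npaths la)%:R]/((npaths la)%:Z%:~R) ler_int int_char_le.
Qed.

Let charE n (la : intpart n) s : (int_char la s)%:~R = d la * X la s.
Proof. by rewrite /X mulrCA divff ?mulr1 // gt_eqF. Qed.

Let Theta_le1 n (s : 'S_n) : `|Theta s| <= 1.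
Proof.
rewrite -(sum_pd n) /Theta /weighted_char; apply: le_trans (ler_norm_sum _ _ _) _.
apply: ler_sum => la _; rewrite charE mulrA normrM ger0_norm ?mulr_ge0 ?(ltW (d_gt0 _)) //.
by rewrite ler_piMr ?X_le1 // mulr_ge0 // ltW.
Qed.

Let second_moment n (s : 'S_n) :
  \sum_(la : intpart n) p la * d la * X la s ^+ 2 = n`!%:R^-1 * \sum_(g : 'S_n) Theta (s * s ^ g)%g.
Proof.
rewrite /Theta /weighted_char exchange_big mulr_sumr; apply: eq_bigr => la _ /=.
rewrite -mulr_sumr -rmorph_sum /=.
have n0 : n`!%:R != 0 :> R by rewrite pnatr_eq0 -lt0n fact_gt0.
have d0 : d la != 0 by rewrite gt_eqF.
have := congr1 (fun z : int => z%:~R : R) (int_char_mul la s s); rewrite !intrM /= -!pmulrn => e.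
have -> : (\sum_(g : 'S_n) int_char la (s * s ^ g)%g)%:~R = n`!%:R * (d la * X la s * (d la * X la s)) / d la.
  by rewrite -charE -e mulrAC divff ?mul1r.
by field; rewrite n0 d0.
Qed.

(** The mean of [X] is [Theta s], and [second_moment] makes the variance an average of
    [Theta (s * s ^ g) - Theta s ^+ 2]. This vanishes for [g] outside [mixing n k] and is at most 1
    otherwise. *)
Let variance n k (s : 'S_n) : (0 < n)%N -> supported s k ->
  \sum_(la : intpart n) p la * d la * (X la s - Theta s) ^+ 2 <= k%:R ^+ 2 / n%:R.
Proof.
move=> n0 sk; have nf0 : 0 < n`!%:R :> R by rewrite ltr0n fact_gt0.
have -> : \sum_(la : intpart n) p la * d la * (X la s - Theta s) ^+ 2 =
    n`!%:R^-1 * \sum_(g : 'S_n) (Theta (s * s ^ g)%g - Theta s ^+ 2).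
  rewrite sumrB sumr_const card_Sn mulrBr -second_moment -[X in _ - _ * X]mulr_natl mulKf ?gt_eqF //.
  transitivity (\sum_(la : intpart n) (p la * d la * X la s ^+ 2 +
     (Theta s ^+ 2 * (p la * d la) - 2 * Theta s * (p la * (int_char la s)%:~R)))).
    by apply: eq_bigr => la _; rewrite charE; ring.
  rewrite big_split sumrB /= -!mulr_sumr sum_pd -/(weighted_char p s) -/(Theta s).
  by congr (_ + _); ring.
rewrite mulrC ler_pdivrMr // mulrAC ler_pdivlMr ?ltr0n //.
apply: (@le_trans _ _ (#|mixing n k|%:R * n%:R)); last first.
  by rewrite mulrC -natrX -!natrM ler_nat card_mixing.
rewrite ler_pM2r ?ltr0n // -sum1_card natr_sum [leRHS]big_mkcond /=; apply: ler_sum => g _.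
case: ifPn => [_|/(supported_conj_disjoint sk sk)/p_mult].
  rewrite lerBlDr (le_trans (ler_norm _)) // (le_trans (Theta_le1 _)) // lerDl sqr_ge0 //.
rewrite -/(Theta _) => ->; rewrite -/(Theta _) -/(Theta _).
have -> : Theta (s ^ g)%g = Theta s.
  by apply: eq_bigr => la _; rewrite int_charJ.
by rewrite -expr2 subrr.
Qed.

(* The normalized characters of [s] converge to [Theta s] in mean square, so
   weighting them by a density does not change the limit up to a factor. *)
Lemma harmonic_minorant (q : forall n, intpart n -> R) : harmonic q ->
  (forall n (la : intpart n), 0 <= q n la <= p la) ->
  forall n (la : intpart n), q n la = weighted_char q (1%g : 'S_0) * p la.
Proof.
move=> hq q0p; set c := weighted_char q _.
suff lim k (s : 'S_k) : weighted_char q s = c * Theta s.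
  move=> n; apply: (@weighted_char_inj _ _ _ (fun n la => c * p la)) => s.
  by rewrite lim mulr_sumr; apply: eq_bigr => la _; rewrite mulrA.
have c1 n : \sum_(la : intpart n) q n la * d la = c.
  by rewrite -weighted_char1 weighted_char1_const.
have c_ge0 : 0 <= c by rewrite -(c1 0%N) sumr_ge0 // => la _; rewrite mulr_ge0 ?(ltW (d_gt0 _)) //; case/andP: (q0p _ la).
have c_le1 : c <= 1.
  rewrite -(c1 0%N) -(sum_pd 0); apply: ler_sum => la _.
  by rewrite ler_pM2r //; case/andP: (q0p _ la).
pose D := weighted_char q s - c * Theta s.
have DE m : D = \sum_(la : intpart (m + k)) q _ la * d la * (X la (extend_iter m s) - Theta s).
  rewrite /D -(weighted_char_extend_iter hq m) -(c1 (m + k)%N) mulr_suml -sumrB.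
  by apply: eq_bigr => la _; rewrite charE mulrBr mulrA.
have bound m : D ^+ 2 <= k%:R ^+ 2 / (m.+1 + k)%:R.
  pose Y (la : intpart (m.+1 + k)) := X la (extend_iter m.+1 s) - Theta s.
  pose w (la : intpart (m.+1 + k)) := q _ la * d la.
  have w_ge0 la : 0 <= w la by rewrite mulr_ge0 ?(ltW (d_gt0 _)) //; case/andP: (q0p _ la).
  have sw : \sum_la w la = c by exact: c1.
  have DY : D = \sum_la w la * Y la by exact: (DE m.+1).
  (* Cauchy-Schwarz for weights of total mass [c <= 1] with [D] the weighted sum of [Y]: expand the
     nonnegative sum of [w la * (Y la - D) ^+ 2]. *)
  apply: (@le_trans _ _ (\sum_la w la * Y la ^+ 2)).
    have : 0 <= \sum_la w la * (Y la - D) ^+ 2.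
      by apply: sumr_ge0 => la _; rewrite mulr_ge0 ?sqr_ge0.
    have -> : \sum_la w la * (Y la - D) ^+ 2 =
        \sum_la w la * Y la ^+ 2 + (D ^+ 2 * \sum_la w la - 2 * D * \sum_la w la * Y la).
      by rewrite !mulr_sumr -sumrB -big_split; apply: eq_bigr => la _ /=; ring.
    rewrite sw -DY => h; rewrite -subr_ge0.
    have : 0 <= D ^+ 2 * (1 - c) by rewrite mulr_ge0 ?sqr_ge0 ?subr_ge0.
    by move: h; lra.
  apply: (@le_trans _ _ (\sum_la p la * d la * Y la ^+ 2)).
    apply: ler_sum => la _; rewrite ler_wpM2r ?sqr_ge0 // ler_pM2r //.
    by case/andP: (q0p _ la).
  have := @variance (m.+1 + k)%N k (extend_iter m.+1 s) isT (@supported_extend_iter _ _ s).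
  by rewrite /Theta weighted_char_extend_iter.
suff : D ^+ 2 <= 0 by rewrite exprn_even_le0 //= subr_eq0 => /eqP.
rewrite leNgt; apply/negP => D0.
have := archi_boundP (ltW (divr_gt0 (ltr0Sn R (k ^ 2)) D0)).
move: (Num.bound _) => m; rewrite ltr_pdivrMr // => lt.
have := bound m; rewrite ler_pdivlMr ?ltr0n // leNgt => /negP; apply.
apply: (@lt_le_trans _ _ (m%:R * D ^+ 2)).
  by apply: le_lt_trans lt; rewrite -natrX ler_nat.
by rewrite mulrC ler_pM2l // ler_nat addSn ltnW // ltnS leq_addr.
Qed.
End extremality.

(** * Cylinders and central measures *)

(** The step is an involution, so the transducer runs backwards: an emitted letter and the state
    after it give the state before it and the letter read. Injectivity and surjectivity of
    [jdt_word] rest on this. *)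
Lemma slide_stepK x a : slide_step (slide_step x a).1 (slide_step x a).2 = (x, a).
Proof.
by rewrite /slide_step; case l : (linked x a); rewrite /= ?l // linkedC l.
Qed.

Definition carry_word (w : seq box) : box := if w is x :: v then carry x v else (0, 0)%N.

Lemma jdt_word_rcons w a : w != [::] ->
  jdt_word (rcons w a) = rcons (jdt_word w) (slide_step (carry_word w) a).1.
Proof. by case: w => // x v _; rewrite /= slide_rcons. Qed.

Lemma carry_word_rcons w a : w != [::] ->
  carry_word (rcons w a) = (slide_step (carry_word w) a).2.
Proof. by case: w => // x v _; rewrite /= carry_rcons. Qed.

Lemma size_jdt_word w : size (jdt_word w) = (size w).-1.
Proof. by case: w => // x v; rewrite /= size_slide. Qed.

Lemma jdt_word_inj w w' : size w = size w' -> jdt_word w = jdt_word w' ->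
  carry_word w = carry_word w' -> w = w'.
Proof.
elim/last_ind: w w' => [|w a IH] w'; first by case: w'.
case/lastP: w' => [|w' a']; first by rewrite size_rcons.
rewrite !size_rcons => -[sw]; have [w0|w0] := eqVneq w [::].
  by move: sw; rewrite w0; case: w' => // _ _ /= ->.
have w'0 : w' != [::] by rewrite -size_eq0 -sw size_eq0.
rewrite !jdt_word_rcons // !carry_word_rcons // => /rcons_inj[ww e1] e2.
have := slide_stepK (carry_word w) a; rewrite e1 e2 slide_stepK => -[c <-].
by rewrite (IH w').
Qed.

Lemma walk_jdt_carry w : w != [::] -> walk [::] w ->
  walk [::] (rcons (jdt_word w) (carry_word w)) /\ rcons (jdt_word w) (carry_word w) =i w.
Proof.
by case: w => // x v _ wv; split; [exact: walk_slide|exact: mem_slide].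
Qed.

Lemma jdt_word_surj u x : walk [::] (rcons u x) ->
  exists w, [/\ size w = (size u).+1, walk [::] w, jdt_word w = u & carry_word w = x].
Proof.
elim/last_ind: u x => [|u b IH] x; first by exists [:: x].
rewrite -cats1 -[rcons u b]cats1 -catA walk_cat => /andP[wu].
rewrite cats0 => wbx; have yu : young (rev u) by rewrite (eq_young (mem_rev u)) walk0_young.
have := walk_slide_step yu wbx; set c := (slide_step b x).1; set a := (slide_step b x).2 => wca.
have wuc : walk [::] (rcons u c).
  by rewrite walk_rcons wu -(eq_addable c (mem_rev u)); case/andP: wca.
have [w [sw ww jw cw]] := IH _ wuc; have w0 : w != [::] by rewrite -size_eq0 sw.
exists (rcons w a); rewrite ?cats1 jdt_word_rcons // carry_word_rcons // cw jw slide_stepK.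
split=> //; first by rewrite !size_rcons sw.
rewrite walk_rcons ww /=; have [_ e] := walk_jdt_carry w0 ww.
rewrite -(eq_addable a e) jw cw (@eq_addable _ (c :: rev u)); first by case/and3P: wca.
by move=> d; rewrite mem_rcons !inE mem_rev.
Qed.

Lemma cylinder_nil : cylinder [::] = setT.
Proof. by apply/seteqP; split. Qed.

Lemma cylinder_rconsE w b : cylinder (rcons w b) = cylinder w `&` [set t : tableau | t b = Some (size w).+1].
Proof. by apply/seteqP; split=> t /cylinder_rcons. Qed.

Lemma measurable_entry b (A : set entry) : measurable [set t : tableau | A (t b)].
Proof. by apply: sub_sigma_algebra; exists b, A. Qed.

Lemma measurable_cylinder w : measurable (cylinder w).
Proof.
elim/last_ind: w => [|w b IH]; first by rewrite cylinder_nil.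
by rewrite cylinder_rconsE; apply: measurableI => //; exact: (measurable_entry b [set Some (size w).+1]).
Qed.

Definition cylinders : set (set tableau) := [set E | exists w, E = cylinder w].

Lemma cylinder_prefix t w n : cylinder w t -> (size w <= n)%N ->
  exists v, size (w ++ v) = n /\ cylinder (w ++ v) t.
Proof.
move=> tw wn; have [u su tu] := cylinder_exists t n; exists (drop (size w) u).
suff -> : w ++ drop (size w) u = u by [].
rewrite -[RHS](cat_take_drop (size w)); congr (_ ++ _).
apply: (cylinder_inj _ tw); first by rewrite size_takel // su.
by apply: (@cylinder_cat _ (drop (size w) u)); rewrite cat_take_drop.
Qed.

Lemma cylinder_bigcup_entry b n :
  [set t : tableau | t b = Some n.+1] = \bigcup_(w in [set w | size w = n]) cylinder (rcons w b).
Proof.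
apply/seteqP; split=> [t /= tb|t [w /= <-] /cylinder_rcons[]//].
have [w sw tw] := cylinder_exists t n; exists w => //.
by apply/cylinder_rcons; rewrite sw.
Qed.

(** That a box has a given finite entry is a countable union of cylinders; the entry [None] is the
    complement of all finite ones. *)
Lemma measurable_cylinders : measurable = <<s cylinders >> :> set (set tableau).
Proof.
apply/seteqP; split; last first.
  apply: smallest_sub; first exact: sigma_algebra_measurable.
  by move=> _ [w ->]; exact: measurable_cylinder.
apply: smallest_sub; first exact: smallest_sigma_algebra.
pose T := g_sigma_algebraType cylinders.
have mcyl w : measurable (cylinder w : set T) by apply: sub_sigma_algebra; exists w.
have mcup (W : set (seq box)) (f : seq box -> seq box) :
    measurable (\bigcup_(w in W) cylinder (f w) : set T).
  rewrite bigcup_mkcond; apply: countable_bigcupT_measurable; first exact: countableP.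
  by move=> w; case: ifP.
have mk b k : measurable ([set t : tableau | t b = Some k] : set T).
  case: k => [|k]; last by rewrite cylinder_bigcup_entry; exact: mcup.
  rewrite (_ : mkset _ = set0) //; apply/seteqP; split=> // t /= tb.
  by have [/(_ b)] := entriesP t.
have mA b (A : set entry) : measurable ([set t : tableau | exists2 k, A (Some k) & t b = Some k] : set T).
  rewrite (_ : mkset _ = \bigcup_(k in [set k | A (Some k)]) [set t : tableau | t b = Some k]).
    by apply: bigcup_measurable => k _; exact: mk.
  by apply/seteqP; split=> t /= [k Ak tk]; exists k.
move=> _ [b [A ->]]; suff : measurable ([set t : tableau | A (t b)] : set T) by [].
have [AN|AN] := pselect (A None).
  rewrite (_ : mkset _ = [set t : tableau | exists2 k, A (Some k) & t b = Some k] `|`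
     ~` [set t : tableau | exists2 k, (@setT entry) (Some k) & t b = Some k]).
    by apply: measurableU => //; apply: measurableC.
  apply/seteqP; split=> t /=; case e : (t b) => [k|].
  - by left; exists k.
  - by right=> -[].
  - by move=> [[k' Ak [->]]//|[]]; exists k.
  - by [].
rewrite (_ : mkset _ = [set t : tableau | exists2 k, A (Some k) & t b = Some k]) //.
apply/seteqP; split=> t /=; case e : (t b) => [k|] //.
- by exists k.
- by move=> [k' Ak [->]].
- by move=> [].
Qed.

Lemma setI_closed_cylinders : setI_closed cylinders.
Proof.
suff cI w w' : (size w <= size w')%N -> cylinders (cylinder w `&` cylinder w').
  move=> _ _ [w ->] [w' ->]; have [/cI//|/ltnW/cI] := leqP (size w) (size w').
  by rewrite setIC.
move=> ww; have [e|ne] := eqVneq w (take (size w) w').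
  exists w'; apply/setIidPr => t; rewrite {1}e -{1}(cat_take_drop (size w) w').
  exact: cylinder_cat.
(* Cylinders are nested or disjoint; the empty set is the cylinder of a word that is not a walk. *)
exists [:: (1, 0)%N]; apply/seteqP; split=> t.
  move=> [tw tw']; case/eqP: ne; apply: (cylinder_inj _ tw).
    by rewrite size_takel.
  by apply: (@cylinder_cat _ (drop (size w) w')); rewrite cat_take_drop.
by move=> /cylinder_walk.
Qed.

Lemma cylinder_measure_unique (R : realType) (m1 m2 : {measure set tableau -> \bar R}) :
  (forall w, m1 (cylinder w) = m2 (cylinder w)) -> (m1 setT < +oo)%E ->
  forall E, measurable E -> m1 E = m2 E.
Proof.
move=> m12 moo; apply: (@measure_unique _ _ _ cylinders (fun=> setT)).
- exact: measurable_cylinders.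
- exact: setI_closed_cylinders.
- by move=> _; exists [::]; rewrite cylinder_nil.
- by apply/seteqP; split=> // t _; exists 0%N.
- by move=> _ [w ->].
- by [].
Qed.

Lemma jdt_preimage_cylinder u : jdt @^-1` cylinder u =
  \bigcup_(w in [set w | size w = (size u).+1 /\ jdt_word w = u]) cylinder w.
Proof.
apply/seteqP; split=> t.
  move=> /= tu; have [w sw tw] := cylinder_exists t (size u).+1; exists w => //; split=> //.
  by apply: (cylinder_inj _ (jdt_cylinder tw) tu); rewrite size_jdt_word sw.
by move=> [w [_ <-]] /jdt_cylinder.
Qed.

Lemma measurable_jdt : measurable_fun setT jdt.
Proof.
apply: (measurability _ measurable_cylinders) => _ [_ [u ->] <-].
rewrite setTI jdt_preimage_cylinder bigcup_mkcond.
apply: countable_bigcupT_measurable; first exact: countableP.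
by move=> w; case: ifP => // _; exact: measurable_cylinder.
Qed.

Lemma measure_bigcup_eq (d : measure_display) (T : measurableType d) (R : realType)
    (m : {measure set T -> \bar R}) (I : countType) (W : set I) (A B : I -> set T) :
  (forall i, W i -> measurable (A i)) -> (forall i, W i -> measurable (B i)) ->
  trivIset W A -> trivIset W B -> (forall i, W i -> m (A i) = m (B i)) ->
  m (\bigcup_(i in W) A i) = m (\bigcup_(i in W) B i).
Proof.
move=> mA mB tA tB mAB; pose F (C : I -> set T) n :=
  if pickle_inv n is Some i then if `[< W i >] then C i else set0 else set0.
have FE C : \bigcup_(i in W) C i = \bigcup_n F C n.
  apply/seteqP; split=> x.
    by move=> [i Wi Cx]; exists (pickle i) => //; rewrite /F pickleK_inv asboolT.
  move=> [n _]; rewrite /F; case: (pickle_inv n) => // i.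
  by case: asboolP => // Wi Cx; exists i.
have mF C : (forall i, W i -> measurable (C i)) -> forall n, measurable (F C n).
  by move=> mC n; rewrite /F; case: (pickle_inv n) => // i; case: asboolP => // /mC.
have tF C : trivIset W C -> trivIset setT (F C).
  move=> tC n n' _ _ [x []]; rewrite /F.
  case e : (pickle_inv n) => [i|//]; case: asboolP => // Wi Cx.
  case e' : (pickle_inv n') => [i'|//]; case: asboolP => // Wi' Cx'.
  have ii : i = i' by apply: tC => //; exists x.
  have := @pickle_invK I n; have := @pickle_invK I n'; rewrite e e' /= => <- <-.
  by rewrite ii.
rewrite !FE !measure_semi_bigcup; try by [apply: mF|apply: tF|].
- apply: eq_eseriesr => n _; rewrite /F; case: (pickle_inv n) => // i.
  by case: asboolP => // /mAB.
- by apply: bigcupT_measurable; exact: mF.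
- by apply: bigcupT_measurable; exact: mF.
Qed.

Lemma trivIset_cylinder (I : Type) (W : set I) (f : I -> seq box) :
  (forall i j, W i -> W j -> f i = f j -> i = j) ->
  (forall i j, W i -> W j -> size (f i) = size (f j)) -> trivIset W (fun i => cylinder (f i)).
Proof. by move=> fi fs i j Wi Wj [t [ti tj]]; apply: fi => //; apply: cylinder_inj ti tj; exact: fs. Qed.

Lemma intpart_inhabited n : exists la : intpart n, True.
Proof.
have [w sw tw] := cylinder_exists (Tableau row_is_tableau) n.
by have [la _] := walk_fills (cylinder_walk tw); rewrite sw in la; exists la.
Qed.

Lemma take_inj_walk w w' : size w = size w' -> walk [::] w -> walk [::] w' ->
  (forall i, (i <= size w)%N -> take i w =i take i w') -> w = w'.
Proof.
elim/last_ind: w w' => [|w b IH] w'; first by case: w'.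
case/lastP: w' => [|w' b']; first by rewrite size_rcons.
rewrite !size_rcons => -[sw]; rewrite !walk_rcons => /andP[ww ab] /andP[ww' ab'] e.
have ww'E : w = w'.
  apply: IH => // i iw; have := e i (leqW iw).
  by rewrite -!cats1 !takel_cat // -sw.
rewrite -ww'E in ab' *; congr rcons; have := e _ (leqnn _).
rewrite !take_oversize ?size_rcons ?sw // => /(_ b).
rewrite -ww'E !mem_rcons !inE eqxx /= => /esym/orP[/eqP//|].
by case/andP: ab => /negbTE ->.
Qed.

Lemma take_walk w i : walk [::] w -> walk [::] (take i w).
Proof. by rewrite -{1}(cat_take_drop i w) walk_cat => /andP[]. Qed.

(** Passes from sequences of diagrams to words of boxes, which determine each other by
    [take_inj_walk]. *)
Lemma vershik_kerov_cylinder (R : realType) (M : probability tableau R)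
    (p : forall n, intpart n -> R) :
  (forall (n : nat) (L : forall i, intpart i),
     (forall i, (i < n)%N -> add_box (L i) (L i.+1)) ->
     M [set t | forall i, (i <= n)%N -> subshape t i = boxes (L i)] = (p n (L n))%:E) ->
  forall n (la : intpart n) w, filling la w -> M (cylinder w) = (p n la)%:E.
Proof.
move=> hp n la w [sw ww lw].
(* [L] must be total, so beyond [n] any partition will do. *)
have Lex i : exists la' : intpart i, (i <= n)%N -> fills la' (take i w).
  have [in_|_] := leqP i n; last by have [la' _] := intpart_inhabited i; exists la'.
  have [la' h] := walk_fills (take_walk i ww).
  by rewrite size_takel ?sw // in la' h *; exists la'.
have [L LP] : exists L : forall i, intpart i, forall i, (i <= n)%N -> fills (L i) (take i w).
  by exists (fun i => projT1 (cid (Lex i))) => i; exact: (projT2 (cid (Lex i))).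
have add i : (i < n)%N -> add_box (L i) (L i.+1).
  move=> ni; have tE : take i.+1 w = rcons (take i w) (nth (0, 0)%N w i).
    by rewrite -take_nth ?sw.
  have wi := take_walk i.+1 ww; rewrite tE walk_rcons in wi; case/andP: wi => wi ab.
  have [mu cm mh] := fills_rcons (LP i (ltnW ni)) ab.
  rewrite (_ : L i.+1 = mu); first exact/asboolP.
  by apply: (fills_inj (LP _ ni)); rewrite tE.
have -> : la = L n by apply: (fills_inj lw); have := LP n (leqnn n); rewrite take_oversize ?sw.
rewrite -(hp n L add); congr (M _); apply/seteqP; split=> t.
  move=> tw i ni; have ti : cylinder (take i w) t.
    by apply: (@cylinder_cat _ (drop i w)); rewrite cat_take_drop.
  have := subshape_cylinder ti; rewrite size_takel ?sw // => ->.
  by apply/esym/fills_boxes; exact: LP.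
move=> /= tL; have [w' sw' tw'] := cylinder_exists t n.
suff -> : w = w' by [].
apply: take_inj_walk => //; [by rewrite sw|exact: cylinder_walk tw'|].
move=> i; rewrite sw => ni b; rewrite (LP i ni).
have ti : cylinder (take i w') t.
  by apply: (@cylinder_cat _ (drop i w')); rewrite cat_take_drop.
have := subshape_cylinder ti; rewrite size_takel ?sw' // tL // => e.
by have /fills_boxes -> := e.
Qed.

Lemma pushforward_exists (d : measure_display) (T : measurableType d) (R : realType)
    (m : {measure set T -> \bar R}) (f : T -> T) : measurable_fun setT f ->
  exists m' : {measure set T -> \bar R}, forall E, m' E = m (f @^-1` E).
Proof. by move=> mf; unshelve eexists (pushforward m f). Qed.

Lemma probability_lty (d : measure_display) (T : measurableType d) (R : realType)
    (P : probability T R) (E : set T) : measurable E -> (P E < +oo)%E.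
Proof. by move=> mE; apply: le_lt_trans (probability_le1 P mE) _; rewrite ltry. Qed.

Section central_measure.
Variables (R : realType) (M : probability tableau R) (p : forall n, intpart n -> R).
Hypothesis Mp : forall n (la : intpart n) w, filling la w -> M (cylinder w) = (p la)%:E.

Lemma central_walk w w' : walk [::] w -> walk [::] w' -> size w = size w' -> w =i w' ->
  M (cylinder w) = M (cylinder w').
Proof.
move=> ww ww' sw e; have [la lw] := walk_fills ww.
have fw : filling la w by split.
have fw' : filling la w' by split=> // b; rewrite -e lw.
by rewrite (Mp fw) (Mp fw').
Qed.

(* A tableau with prefix [w] is given by the shape of its next level, and
   also, after a slide, by the box at which the slide path leaves [w]. *)
Lemma jdt_measure_preserving : measure_preserving M jdt.
Proof.
split; first exact: measurable_jdt.
have [m mE] := pushforward_exists M measurable_jdt.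
move=> E mE'; rewrite -mE; move: E mE'.
apply: cylinder_measure_unique => [u|]; last by rewrite mE preimage_setT; exact: probability_lty measurableT.
rewrite mE jdt_preimage_cylinder.
pose W := [set w | [/\ walk [::] w, size w = (size u).+1 & jdt_word w = u]].
have -> : \bigcup_(w in [set w | size w = (size u).+1 /\ jdt_word w = u]) cylinder w =
    \bigcup_(w in W) cylinder w.
  apply/seteqP; split=> t [w].
    by move=> [sw jw] tw; exists w => //; split=> //; exact: cylinder_walk tw.
  by move=> [_ sw jw] tw; exists w.
(* Every box that continues [u] is the carry of exactly one [w] in [W]. So [W] cuts both events into
   pieces, and matching pieces have words filling the same diagram. *)
have -> : cylinder u = \bigcup_(w in W) cylinder (rcons u (carry_word w)).
  apply/seteqP; split=> t; last by move=> [w _]; rewrite cylinder_rconsE => -[].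
  move=> tu; have [v] := cylinder_prefix tu (leqnSn _).
  case: v => [|x [|y v]]; rewrite size_cat /= ?addn0 ?addn1 ?addnS => -[] // sv.
    by move: sv; lia.
  - rewrite cats1 => tux.
    have [w [sw ww jw cw]] := jdt_word_surj (cylinder_walk tux).
    by exists w; rewrite ?cw.
  - by move: sv; lia.
apply: measure_bigcup_eq => [w _|w _|||w [ww sw jw]].
- exact: measurable_cylinder.
- exact: measurable_cylinder.
- by apply: (trivIset_cylinder (f := id)) => // w w' [_ -> _] [_ -> _].
- apply: trivIset_cylinder => w w' [_ sw jw] [_ sw' jw']; last by rewrite !size_rcons.
  by move=> /rcons_inj[cc]; apply: jdt_word_inj; rewrite ?sw ?jw.
have w0 : w != [::] by rewrite -size_eq0 sw.
have [wj e] := walk_jdt_carry w0 ww; rewrite jw in wj e.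
by apply: central_walk => //; rewrite ?sw ?size_rcons // => b; rewrite e.
Qed.

Lemma measurable_iter_jdt k : measurable_fun setT (iter k jdt).
Proof.
elim: k => [|k IH]; first exact: measurable_id.
exact: (measurableT_comp measurable_jdt IH).
Qed.

Lemma iter_jdt_cylinder k w t : cylinder w t -> cylinder (iter k jdt_word w) (iter k jdt t).
Proof. by move=> tw; elim: k => //= k; exact: jdt_cylinder. Qed.

Lemma size_iter_jdt_word k w : size (iter k jdt_word w) = (size w - k)%N.
Proof. by elim: k => [|k IH] /=; rewrite ?subn0 // size_jdt_word IH subnS. Qed.

(* By confluence of the slides, the effect of |w| slides on the remaining
   entries depends on the shape of [w] only. *)
Lemma central_iter_jdt w w' E : walk [::] w -> walk [::] w' -> size w = size w' -> w =i w' ->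
  measurable E ->
  M (iter (size w) jdt @^-1` E `&` cylinder w) = M (iter (size w) jdt @^-1` E `&` cylinder w').
Proof.
move=> ww ww' sw e; pose k := size w.
have [m mE] := pushforward_exists (mrestr M (measurable_cylinder w)) (measurable_iter_jdt k).
have [m' mE'] := pushforward_exists (mrestr M (measurable_cylinder w')) (measurable_iter_jdt k).
rewrite -[M _]/(mrestr M (measurable_cylinder w) _) -mE.
rewrite -[M _ in RHS]/(mrestr M (measurable_cylinder w') _) -mE'; move: E.
apply: cylinder_measure_unique => [u|]; last first.
  rewrite mE preimage_setT -[X in (X < _)%E]/(M (setT `&` cylinder w)) setTI.
  by apply: probability_lty; exact: measurable_cylinder.
rewrite mE mE' -[LHS]/(M (iter k jdt @^-1` cylinder u `&` cylinder w)).
rewrite -[RHS]/(M (iter k jdt @^-1` cylinder u `&` cylinder w')).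
(* Stated with [w], this index set serves [w'] as well, since both conditions depend on the prefix
   through its diagram only. *)
pose W := [set v | [/\ size v = size u, walk [::] (w ++ v) & iter k jdt_word (w ++ v) = u]].
have split v0 : walk [::] v0 -> size v0 = k -> v0 =i w ->
    iter k jdt @^-1` cylinder u `&` cylinder v0 = \bigcup_(v in W) cylinder (v0 ++ v).
  move=> wv0 sv0 ev0; have walkE v : walk [::] (v0 ++ v) = walk [::] (w ++ v).
    rewrite !walk_cat wv0 ww /=; apply: eq_walk => b.
    by rewrite !cats0 !mem_rev ev0.
  have jE v : walk [::] (v0 ++ v) -> iter k jdt_word (v0 ++ v) = iter k jdt_word (w ++ v).
    by move=> wv; rewrite -{1}sv0; apply: iter_jdt_word_prefix.
  apply/seteqP; split=> t /=.
    move=> [tu tv0]; have le : (size v0 <= k + size u)%N by rewrite sv0 leq_addr.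
    have [v [sv tv]] := cylinder_prefix tv0 le; exists v => //.
    have wv := cylinder_walk tv; split; [|by rewrite -walkE|].
      by move/eqP: sv; rewrite size_cat sv0 eqn_add2l => /eqP.
    rewrite -jE //; apply: (cylinder_inj _ (@iter_jdt_cylinder k _ _ tv) tu).
    by rewrite size_iter_jdt_word sv addKn.
  move=> [v [sv wv jv] tv]; split; last exact: cylinder_cat tv.
  by rewrite -jv -jE ?walkE //; exact: iter_jdt_cylinder.
rewrite (split w) // (split w') //.
have inj v0 : trivIset W (fun v => cylinder (v0 ++ v)).
  apply: trivIset_cylinder => v v' [sv _ _] [sv' _ _]; last by rewrite !size_cat sv sv'.
  by move/eqP; rewrite eqseq_cat // eqxx => /eqP.
apply: measure_bigcup_eq => [v _|v _|||v [sv wv jv]] //; try exact: measurable_cylinder.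
apply: central_walk => //; last 2 first.
- by rewrite !size_cat sw.
- by move=> b; rewrite !mem_cat e.
move: wv; rewrite !walk_cat ww' => /andP[_]; rewrite (@eq_walk _ (rev w' ++ [::])) // => b.
by rewrite !cats0 !mem_rev e.
Qed.

Lemma invariant_cylinder E : measurable E -> jdt @^-1` E = E -> forall w w',
  walk [::] w -> walk [::] w' -> size w = size w' -> w =i w' ->
  M (E `&` cylinder w) = M (E `&` cylinder w').
Proof.
move=> mE JE w w' ww ww' sw e; have JkE k : iter k jdt @^-1` E = E.
  elim: k => // k IH; rewrite -[RHS]IH -[in RHS]JE //.
by have := central_iter_jdt ww ww' sw e mE; rewrite JkE.
Qed.
End central_measure.

Lemma filling_last_inj n (mu : intpart n.+1) w b c :
  filling mu (rcons w b) -> filling mu (rcons w c) -> b = c.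
Proof.
move=> [_ + mb] [_ _ mc]; rewrite walk_rcons => /andP[_ /and3P[bw _ _]].
have : b \in rcons w c by rewrite mc -mb mem_rcons mem_head.
by rewrite mem_rcons inE (negbTE bw) orbF => /eqP.
Qed.

Lemma measure_cylinder_covers (R : realType) (m : {measure set tableau -> \bar R})
    n (la : intpart n) w (b : intpart n.+1 -> box) E : measurable E -> filling la w ->
  (forall mu, covers la mu -> filling mu (rcons w (b mu))) ->
  m (E `&` cylinder w) = (\sum_(mu | covers la mu) m (E `&` cylinder (rcons w (b mu))))%E.
Proof.
move=> mE [sw ww lw] bP.
have mEc v : measurable (E `&` cylinder v) by apply: measurableI => //; exact: measurable_cylinder.
have -> : E `&` cylinder w = \bigcup_(mu in [set` covers la]) (E `&` cylinder (rcons w (b mu))).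
  rewrite -setI_bigcupr; congr (_ `&` _); apply/seteqP; split=> t; last first.
    by move=> [mu _]; rewrite cylinder_rconsE => -[].
  move=> tw; have [v] := cylinder_prefix tw (leqnSn _).
  case: v => [|x [|y v]]; rewrite size_cat /= ?addn0 ?addn1 ?addnS => -[] // sv.
  - by move: sv; lia.
  - rewrite cats1 => twx; have := cylinder_walk twx; rewrite walk_rcons => /andP[_ ax].
    have [mu cm mx] := fills_rcons lw ax; exists mu => //.
    rewrite (filling_last_inj (bP mu cm) (c := x)) //; split=> //.
      by rewrite size_rcons sw.
    exact: cylinder_walk twx.
  - by move: sv; lia.
rewrite measure_fin_bigcup //; last 1 first.
- move=> mu mu' cm cm' [t [[_ h] [_ h']]].
  have e : rcons w (b mu) = rcons w (b mu').
    by apply: (cylinder_inj _ h h'); rewrite !size_rcons.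
  have [_ _ f] := bP mu cm; have [_ _ f'] := bP mu' cm'.
  by rewrite e in f; exact: fills_inj f f'.
by apply/esym/bigfs => [|mu _]; [exact: index_enum_uniq|rewrite mem_index_enum].
Qed.

Theorem theorem1p2 (R : realType) (al be : nat -> R) (ga : R)
  (hT : thoma_simplex al be ga)
  (M : probability tableau R) (hM : vershik_kerov al be M) :
  measure_preserving M jdt /\ ergodic M jdt.
Proof.
have [p [Mp thomaE]] := hM; have {}Mp := vershik_kerov_cylinder Mp.
split; first exact: jdt_measure_preserving Mp.
move=> E mE JE.
(* One word for each partition; by [invariant_cylinder] the values [q] do not depend on this
   choice. *)
pose wit n (la : intpart n) := projT1 (cid (intpart_walk la)).
have witP n (la : intpart n) : filling la (wit n la) by exact: (projT2 (cid (intpart_walk la))).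
pose q n (la : intpart n) : R := fine (M (E `&` cylinder (wit n la))).
have mEc v : measurable (E `&` cylinder v) by apply: measurableI => //; exact: measurable_cylinder.
have Mq n (la : intpart n) w : filling la w -> M (E `&` cylinder w) = (q n la)%:E.
  move=> fw; have [sw ww lw] := fw; have [sw' ww' lw'] := witP n la.
  rewrite /q fineK; last by rewrite ge0_fin_numE ?measure_ge0 // probability_lty.
  apply: (invariant_cylinder Mp) => //; first by rewrite sw sw'.
  by move=> b; rewrite lw lw'.
(* Additivity over the next box gives harmonicity; it is used for the whole space and for [E]. *)
have split_sum (m : {measure set tableau -> \bar R}) (F : forall n, intpart n -> R) E' :
    measurable E' -> (forall n (la : intpart n) w, filling la w -> m (E' `&` cylinder w) = (F n la)%:E) ->
    harmonic F.
  move=> mE' mF n la; have fw := witP n la; set w := wit n la in fw.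
  have /choice[b bP] : forall mu, exists b, covers la mu -> filling mu (rcons w b).
    move=> mu; have [cm|_] := boolP (covers la mu); last by exists (0, 0)%N.
    by have [b] := filling_rcons fw cm; exists b.
  apply: EFin_inj; rewrite -(mF _ _ _ fw) (measure_cylinder_covers _ mE' fw bP) -sumEFin.
  by apply: eq_bigr => mu cm; rewrite (mF _ mu) //; exact: bP.
have hp : harmonic p.
  by apply: (split_sum M p setT) => // n la w fw; rewrite setTI; exact: Mp.
have hq : harmonic q by exact: (split_sum M q E).
have pE n (la : intpart n) : (p n la)%:E = M (cylinder (wit n la)) by rewrite (Mp _ la).
have p_ge0 n (la : intpart n) : 0 <= p n la by rewrite -lee_fin pE measure_ge0.
have q0p n (la : intpart n) : 0 <= q n la <= p n la.
  rewrite -!lee_fin pE -(Mq _ la _ (witP n la)) measure_ge0 /=.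
  by apply: le_measure; rewrite ?inE //; exact: measurable_cylinder.
have thomaE' n (s : 'S_n) : thoma_char al be s = weighted_char p s by exact: thomaE.
have p1 : weighted_char p (1%g : 'S_0) = 1 by rewrite -thomaE' thoma_char1.
have pM n (s t : 'S_n) : disjoint_perm s t ->
    weighted_char p (s * t)%g = weighted_char p s * weighted_char p t.
  by move=> d; rewrite -!thomaE' thoma_char_disjoint.
have qE := harmonic_minorant hp p_ge0 p1 pM hq q0p.
set c := weighted_char q _ in qE.
have indep w : M (E `&` cylinder w) = (c%:E * M (cylinder w))%E.
  have [ww|nw] := boolP (walk [::] w); last first.
    have -> : cylinder w = set0.
      by apply/seteqP; split=> t // /cylinder_walk; rewrite (negbTE nw).
    by rewrite setI0 measure0 mule0.
  have [la lw] := walk_fills ww; have fw : filling la w by [].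
  by rewrite (Mq _ la) // (Mp _ la) // qE EFinM.
have ME : M E = c%:E.
  by have := indep [::]; rewrite cylinder_nil setIT probability_setT mule1.
have c_ge0 : 0 <= c by rewrite -lee_fin -ME measure_ge0.
(* The restriction of [M] to [E] and the multiple [c] of [M] agree on cylinders, hence on [E]
   itself; this gives [c = c * c]. *)
have EE : M (E `&` E) = (c%:E * M E)%E.
  rewrite -[LHS]/(mrestr M mE E) -[RHS]/(mscale (NngNum c_ge0) M E).
  apply: cylinder_measure_unique => // [w|].
    by rewrite -[LHS]/(M (cylinder w `&` E)) setIC indep.
  by rewrite -[X in (X < _)%E]/(M (setT `&` E)) setTI; exact: probability_lty.
move: EE; rewrite setIid ME -EFinM => -[/eqP]; rewrite -subr_eq0 -{1}[c]mulr1 -mulrBr mulf_eq0.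
by move=> /orP[/eqP->|]; [left|rewrite subr_eq0 => /eqP <-; right].
Qed.
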